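(* Let $N=1$, $s=1/2$, $L>0$, $P_1>P_2>0$, and $$h_0(x):=\begin{cases} L+P_1 & \text{if } x\le 0,\\ -P_2 & \text{if } x>0.\end{cases}$$ Let $h$ be the selfsimilar very weak solution of $\partial_t h+(-\Delta)^{1/2}\Phi_2(h)=0$ in $\mathbb{R}\times(0,T)$ with initial data $h_0$, let $H$ be its enthalpy profile, and let $\xi_{\mathrm w}$ and $\xi_{\mathrm i}$ be its interphase points with the water region and the ice region, respectively. Then $$0<\xi_{\mathrm w}<\xi_{\mathrm i}.$$
   Context: $\Phi_2(r):=\max\{r-L,0\}+\min\{r,0\}$. $(-\Delta)^s$ is the fractional Laplacian on $\mathbb{R}^N$ (Fourier multiplier $|\xi|^{2s}$). $Q_T:=\mathbb{R}^N\times(0,T)$ with $T>0$. Very weak solution: for $\Phi:\mathbb{R}\to\mathbb{R}$ nondecreasing and locally Lipschitz, $h\in L^\infty(Q_T)$ is a very weak solution of $\partial_t h+(-\Delta)^s\Phi(h)=0$ with initial data $h_0\in L^\infty(\mathbb{R}^N)$ if for all $\psi\in C_c^\infty(\mathbb{R}^N\times[0,T))$, $$\int_0^T\int_{\mathbb{R}^N}\big(h\,\partial_t\psi-\Phi(h)(-\Delta)^s\psi\big)\,dx\,dt+\int_{\mathbb{R}^N}h_0(x)\psi(x,0)\,dx=0.$$ It is known that for every $h_0\in L^\infty(\mathbb{R}^N)$ there exists exactly one very weak solution. Profiles: for the step datum $h_0$ above the solution is selfsimilar, $h(x,t)=H(xt^{-1/(2s)})$ (here $2s=1$), where the enthalpy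 profile $H$ is bounded and nonincreasing with limits $L+P_1$ at $-\infty$ and $-P_2$ at $+\infty$ (a monotone representative is used), and satisfies $-\frac{1}{2s}\xi H'(\xi)+(-\Delta)^s\Phi_2(H)(\xi)=0$ in $\mathcal{D}'(\mathbb{R})$. The temperature profile $U:=\Phi_2(H)$ is continuous and bounded on $\mathbb{R}$. Interphase points: $\xi_{\mathrm w}\le\xi_{\mathrm i}$ are the unique finite points such that $H(\xi_{\mathrm w}^-)=L$ and $H(\xi)>L$ for $\xi<\xi_{\mathrm w}$, and $H(\xi_{\mathrm i}^+)=0$ and $H(\xi)<0$ for $\xi>\xi_{\mathrm i}$ (one-sided limits); equivalently, $\{\xi\in\mathbb{R}: U(\xi)=0\}=[\xi_{\mathrm w},\xi_{\mathrm i}]$. *)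

(* Defs.v *)
From HB Require Import structures.
From mathcomp Require Import all_boot all_order all_algebra.
From mathcomp Require Import all_classical all_reals all_analysis.
From mathcomp Require Import complex.

Set Implicit Arguments.
Unset Strict Implicit.
Unset Printing Implicit Defensive.
Import Order.TTheory GRing.Theory Num.Theory.
Import numFieldNormedType.Exports.
Local Open Scope classical_set_scope.
Local Open Scope ring_scope.
Local Open Scope complex_scope.

Definition cintegral (R : realType) (f : R -> R[i]) : R[i] :=
  (\int[lebesgue_measure]_(x in [set: R]) complex.Re (f x))%R +i*
  (\int[lebesgue_measure]_(x in [set: R]) complex.Im (f x))%R.

Definition expi (R : realType) (a : R) : R[i] := cos a +i* sin a.

Definition fourier (R : realType) (u : R -> R) (k : R) : R[i] :=
  cintegral (fun x : R => (u x)%:C * expi (- (k * x))).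

Definition inv_fourier (R : realType) (g : R -> R[i]) (x : R) : R[i] :=
  ((2 * pi)^-1)%:C * cintegral (fun k : R => g k * expi (k * x)).

(** [(-Delta)^s u] on the line, used below for test functions [u] only.  For
    real [u] the inverse transform is real, since the multiplier is even; [Re]
    only changes the type. *)
Definition fracLap (R : realType) (s : R) (u : R -> R) (x : R) : R :=
  complex.Re (inv_fourier (fun k : R => (`|k| `^ (2 * s))%:C * fourier u k) x).

(** [C^n] through iterated directional derivatives; in finite dimension this is
    the usual notion. *)
Fixpoint Cn (R : realType) (V : normedModType R) (n : nat) (f : V -> R) : Prop :=
  match n with
  | 0 => continuous f
  | n'.+1 => continuous f /\
      forall v : V, (forall x : V, derivable f x v) /\
                    Cn n' (fun x : V => 'D_v f x)
  end.

Definition smooth (R : realType) (V : normedModType R) (f : V -> R) : Prop :=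
  forall n : nat, Cn n f.

Definition test_line (R : realType) (phi : R -> R) : Prop :=
  smooth phi /\ compact (closure [set x : R | phi x != 0]).

(** [C_c^oo(R x [0,T))].  A test function is represented by a smooth function
    on the whole plane; only its restriction to [R x [0,T)] matters, and that
    restriction has compact support in [R x [0,T)].  Nothing is required of
    the values at negative times, so [psi (x, 0)] need not vanish. *)
Definition test_cylinder (R : realType) (T : R) (psi : R * R -> R) : Prop :=
  smooth psi /\
  exists K : set (R * R),
    [/\ compact K, K `<=` [set z : R * R | 0 <= z.2 < T] &
        forall z : R * R, 0 <= z.2 < T -> ~ K z -> psi z = 0].

Definition cylinder (R : realType) (T : R) : set (R * R) :=
  [set z : R * R | 0 < z.2 < T].

Definition leb2 (R : realType) :=
  (@lebesgue_measure R \x @lebesgue_measure R)%E.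
Arguments leb2 R : clear implicits.

(** Very weak solutions of [d_t h + (-Delta)^s (Phi h) = 0] in [R x (0,T)]
    with initial datum [h0]; points of the plane are pairs [(x, t)]. *)
Definition very_weak_solution (R : realType) (s T : R) (Phi : R -> R)
    (h0 : R -> R) (h : R * R -> R) : Prop :=
  h \_ (cylinder T) \in Lfun (leb2 R) +oo%E /\
  forall psi : R * R -> R, test_cylinder T psi ->
    (\int[lebesgue_measure]_(t in `]0%R, T[)
       (\int[lebesgue_measure]_(x in [set: R])
          (h (x, t) * derive1 (fun r : R => psi (x, r)) t
           - Phi (h (x, t)) * fracLap s (fun y : R => psi (y, t)) x)))%R
    + (\int[lebesgue_measure]_(x in [set: R]) (h0 x * psi (x, 0)))%R = 0.

Definition Phi2 (R : realType) (L r : R) : R :=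
  Num.max (r - L) 0 + Num.min r 0.

Definition step_datum (R : realType) (L P1 P2 x : R) : R :=
  if x <= 0 then L + P1 else - P2.

(** [- (2s)^-1 xi H'(xi) + (-Delta)^s U(xi) = 0] in [D'(R)]: tested against
    [phi], the first term is [(2s)^-1] times the integral of [H (xi phi)']. *)
Definition profile_equation (R : realType) (s : R) (H U : R -> R) : Prop :=
  forall phi : R -> R, test_line phi ->
    (2 * s)^-1 *
      (\int[lebesgue_measure]_(xi in [set: R])
         (H xi * derive1 (fun y : R => y * phi y) xi))%R
    + (\int[lebesgue_measure]_(xi in [set: R]) (U xi * fracLap s phi xi))%R = 0.

(** [H] is the monotone representative of the enthalpy profile of the
    selfsimilar solution [h] (an element of [L^oo], hence the a.e. identity)
    with step datum. *)
Definition enthalpy_profile (R : realType) (s T L P1 P2 : R)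
    (h : R * R -> R) (H : R -> R) : Prop :=
  [/\ {ae leb2 R, forall z : R * R, cylinder T z ->
        h z = H (z.1 * z.2 `^ (- (2 * s)^-1))},
      [/\ exists M : R, forall xi : R, `|H xi| <= M,
          {homo H : x y / x <= y >-> y <= x},
          H xi @[xi --> -oo] --> L + P1 &
          H xi @[xi --> +oo] --> - P2],
      profile_equation s H (Phi2 L \o H),
      continuous (Phi2 L \o H) &
      exists M : R, forall xi : R, `|(Phi2 L \o H) xi| <= M].

Definition water_interphase (R : realType) (L : R) (H : R -> R) (xw : R) : Prop :=
  H xi @[xi --> xw^'-] --> L /\ forall xi : R, xi < xw -> L < H xi.

Definition ice_interphase (R : realType) (H : R -> R) (xi0 : R) : Prop :=
  H xi @[xi --> xi0^'+] --> (0 : R) /\ forall xi : R, xi0 < xi -> H xi < 0.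

(* Main.v *)
Require Import Defs.
From mathcomp Require Import all_boot all_order all_algebra.
From mathcomp Require Import all_classical all_reals all_analysis.
From mathcomp Require Import measurable_realfun ring lra.

Import Order.TTheory GRing.Theory Num.Theory.
Import numFieldNormedType.Exports.
Local Open Scope classical_set_scope.
Local Open Scope ring_scope.

Set Implicit Arguments.
Unset Strict Implicit.
Unset Printing Implicit Defensive.

(** Write [U] for the temperature and [E = H - U] for the latent part of the
    enthalpy: [E] is nonincreasing, equals [L] to the left of [xi_w] and
    vanishes to the right of [xi_i], while [U] is positive, zero and negative
    on the water, the mushy region and the ice.  Everything is read off from the
    profile equation [- xi H' + (-Delta)^(1/2) U = 0] by a good choice of test
    functions.

    On test functions the Fourier multiplier [|k|] is the singular integral
    [halfLap] of second differences ([fracLapE]): damping the multiplier by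
    [exp(-d|k|)] turns it into an explicit convolution kernel of mean zero, and
    [d] is sent to zero.  A change of variable then gives the equation seen from
    any point at any scale ([profile_scaled]).  Three contradictions follow.

    The origin lies strictly to the left of the ice, [0 < xi_i]
    ([xi_gt0]).  The weight [w(y) = 1 / (1 + y^2)] satisfies
    [(-Delta)^(1/2) w = (y w)' =: k], so the equation tested with [w] at
    scale [t] reads [t int H(t y) k(y) dy + int U(t y) k(y) dy = 0], that is
    [(1 + t) int U(t y) k(y) dy = - t int E(t y) k(y) dy].  If [xi_i <= 0], the
    right side is nonnegative because [E] is nonincreasing and vanishes on the
    positive axis.  But [int U(t y) k(y) dy] is, up to a negative factor, the
    derivative in [t] of [int U(t y) w(y) dy], which is [pi] times the harmonic
    extension of [U] at the point [(0, t)].  That extension is therefore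
    nonincreasing in [t] ([extension_noninc]); it starts from [U 0 <= 0] and
    tends to [(P1 - P2) / 2 > 0], which is absurd.

    The mushy region does not begin at or before the origin:
    [xi_w <= 0 < xi_i] is impossible ([mushy_off_origin]).  Take a bump [f] on [[1, 2]]
    and set [g(d) = int H(d y) (y f(y))' dy].  Since [H] is nonincreasing,
    [g >= 0], and [g(d)] tends to zero with [d] because [H] has a one-sided
    limit at the origin and [y f] has compact support.  On the other hand [U]
    vanishes on the support of the dilated bump, so the equation expresses [g(d)] through
    the far field of the bump: [pi g(d) = int U(x) (int f(z) / (d z - x)^2 dz) dx].
    As [d] grows the bump moves away from the water and towards the ice, so
    the right side strictly decreases; a nonnegative strictly decreasing
    function cannot tend to zero at the left end of its domain.

    Finally [xi_w < xi_i]: if the two points coincide, blowing up at the common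
    point [a] leaves only the jump of [H], and the equation becomes
    [L a f(0) = 0] for every test function [f], hence [a = 0] ([no_jump]),
    which the two previous points exclude. *)

(** * Integration on the line *)

(** The Borel structure of the line lives on the alias [measurableTypeR R];
    fixing it here keeps this type out of the statements. *)
Definition mfun (R : realType) (f : R -> R) : Prop :=
  measurable_fun [set: measurableTypeR R] (f : measurableTypeR R -> R).

Definition integ (R : realType) (f : R -> R) : Prop :=
  (@lebesgue_measure R).-integrable [set: R] (EFin \o f).

Definition Int (R : realType) (f : R -> R) : R :=
  Rintegral (@lebesgue_measure R) [set: R] f.

Section integral_toolkit.
Context {R : realType}.
Implicit Types f g h : R -> R.
Local Notation mu := (@lebesgue_measure R).

Lemma integ_mfun f : integ f -> mfun f.
Proof. by move=> /measurable_int /measurable_EFinP. Qed.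

Lemma cont_mfun f : continuous f -> mfun f.
Proof. exact: continuous_measurable_fun. Qed.

Lemma mfunM f g : mfun f -> mfun g -> mfun (fun x => f x * g x).
Proof. exact: measurable_funM. Qed.

Lemma mfunD f g : mfun f -> mfun g -> mfun (fun x => f x + g x).
Proof. exact: measurable_funD. Qed.

Lemma mfunB f g : mfun f -> mfun g -> mfun (fun x => f x - g x).
Proof. exact: measurable_funB. Qed.

Lemma mfun_cst (c : R) : mfun (fun _ => c).
Proof. exact: measurable_cst. Qed.

Lemma mfun_comp f g : mfun f -> mfun g -> mfun (fun x => f (g x)).
Proof. by move=> mf mg; exact: (measurableT_comp mf mg). Qed.

Lemma mfun_inv : mfun (fun x : R => x^-1).
Proof.
have -> : (fun x : R => x^-1) = (fun x => if x == 0 then 0 else x^-1).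
  by apply/funext => x; case: eqP => // ->; rewrite invr0.
apply: measurable_fun_if => //.
- exact: measurable_fun_eqr.
- have -> : [set: measurableTypeR R] `&` (fun x : R => x == 0) @^-1` [set false]
            = [set x : R | x != 0].
    by apply/seteqP; split => x /=; [move=> [_ /negbT]|move/negbTE].
  apply: open_continuous_measurable_fun.
    exact: open_neq.
  by move=> x /[!inE] x0; exact: inv_continuous.
Qed.

Lemma le_integ f h : mfun f -> integ h -> (forall x, `|f x| <= h x) -> integ f.
Proof.
move=> mf ih fh; apply: (le_integrable measurableT _ _ ih).
  exact/measurable_EFinP.
by move=> x _ /=; rewrite lee_fin (le_trans (fh x)) ?ler_norm.
Qed.

Lemma integD f g : integ f -> integ g -> integ (fun x => f x + g x).
Proof. by move=> i1 i2; exact: (integrableD measurableT i1 i2). Qed.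

Lemma integB f g : integ f -> integ g -> integ (fun x => f x - g x).
Proof. by move=> i1 i2; exact: (integrableB measurableT i1 i2). Qed.

Lemma integZ c f : integ f -> integ (fun x => c * f x).
Proof. by move=> i1; exact: (integrableZl measurableT c i1). Qed.

Lemma integ_norm f : integ f -> integ (fun x => `|f x|).
Proof. by move=> i1; exact: (integrable_norm i1). Qed.

Lemma integ_bdM c f g : mfun f -> (forall x, `|f x| <= c) -> integ g ->
  integ (fun x => f x * g x).
Proof.
move=> mf fc ig; apply: (@le_integ _ (fun x => c * `|g x|)).
- exact: (mfunM mf (integ_mfun ig)).
- exact/integZ/integ_norm.
- by move=> x; rewrite normrM ler_wpM2r.
Qed.

Lemma eq_Int f g : f =1 g -> Int f = Int g.
Proof. by move=> /funext ->. Qed.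

Lemma eq_integ f g : f =1 g -> integ f -> integ g.
Proof. by move=> /funext ->. Qed.

Lemma IntD f g : integ f -> integ g -> Int (fun x => f x + g x) = Int f + Int g.
Proof. by move=> i1 i2; exact: RintegralD. Qed.

Lemma IntB f g : integ f -> integ g -> Int (fun x => f x - g x) = Int f - Int g.
Proof. by move=> i1 i2; exact: RintegralB. Qed.

Lemma IntZ c f : integ f -> Int (fun x => c * f x) = c * Int f.
Proof. by move=> i1; exact: RintegralZl. Qed.

Lemma Int0 : Int (fun _ : R => 0) = 0.
Proof. by rewrite /Int Rintegral_cst // mul0r. Qed.

Lemma Int_ge0 f : (forall x, 0 <= f x) -> 0 <= Int f.
Proof. by move=> f0; exact: Rintegral_ge0. Qed.

Lemma le_Int f g : integ f -> integ g -> (forall x, f x <= g x) -> Int f <= Int g.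
Proof. by move=> i1 i2 fg; exact: le_Rintegral. Qed.

Lemma le_norm_Int f h : integ f -> integ h -> (forall x, `|f x| <= h x) ->
  `|Int f| <= Int h.
Proof.
move=> i1 i2 fh; apply: (le_trans (le_normr_Rintegral measurableT i1)).
exact: (le_Int (integ_norm i1)).
Qed.

Lemma Int_dominated_cvg (f : nat -> R -> R) g h : (forall n, mfun (f n)) ->
  (forall x, f n x @[n --> \oo] --> g x) -> integ h ->
  (forall n x, `|f n x| <= h x) ->
  integ g /\ Int (f n) @[n --> \oo] --> Int g.
Proof.
move=> mf fg ih fh.
have mg : mfun g by apply: (measurable_fun_cvg mf) => x _; exact: fg.
have mf' n : measurable_fun [set: measurableTypeR R] (EFin \o f n) by apply/measurable_EFinP;
    exact: mf.
have mg' : measurable_fun [set: measurableTypeR R] (EFin \o g) by exact/measurable_EFinP.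
have cv0 : {ae mu, forall x, [set: measurableTypeR R] x -> (EFin \o f n) x @[n --> \oo] -->
    (EFin \o g) x}.
  by apply: aeW => x _ /=; apply: cvg_EFin; [exact: nearW|exact: fg].
have ub : {ae mu, forall x (n : nat), [set: measurableTypeR R] x -> (`|(EFin \o f n) x| <= (EFin \o h) x)%E}.
  by apply: aeW => x n _ /=; rewrite lee_fin.
have [ig _ cv] := dominated_convergence measurableT mf' mg' cv0 ih ub.
split => //.
apply: fine_cvg; rewrite fineK; first exact: cv.
exact: integrable_fin_num.
Qed.

(** Strict positivity needs only an interval on which the integrand is
    positive, so no continuity has to be established. *)
Lemma Int_gt0 f (p q : R) : integ f -> (forall x, 0 <= f x) -> p < q ->
  (forall x, p < x < q -> 0 < f x) -> 0 < Int f.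
Proof.
move=> iF f0 pq fpq.
rewrite lt_neqAle Int_ge0 // andbT; apply/eqP => /esym If0.
have : (\int[mu]_(x in setT) `|(f x)%:E|)%E = 0%E.
  under eq_integral do rewrite gee0_abs ?lee_fin //.
  rewrite -[LHS]fineK; last exact: integrable_fin_num.
  by rewrite -/(Rintegral mu setT f) -/(Int f) If0.
move/(ae_eq_integral_abs mu measurableT (measurable_int _ iF)).
move=> [N [mN N0 sN]].
have : (mu `]p, q[%classic <= mu N)%E.
  apply: le_measure; rewrite ?inE//.
  move=> x /=; rewrite in_itv /= => /fpq fx; apply: sN => /= /(_ I) [] f00.
  by rewrite f00 ltxx in fx.
rewrite N0 lebesgue_measure_itv /= lte_fin pq -EFinD lee_fin subr_le0.
by rewrite leNgt pq.
Qed.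

(** An affine change of variable multiplies the measure by a constant; this
    covers integrands that are only measurable, such as those containing a
    monotone function. *)
Lemma ge0_integral_affine a d (f : measurableTypeR R -> \bar R) : 0 < d ->
  measurable_fun setT f -> (forall x, (0 <= f x)%E) ->
  (\int[mu]_y f (a + d * y)%R = (d^-1)%:E * \int[mu]_x f x)%E.
Proof.
move=> d0 mf f0.
pose phi (y : measurableTypeR R) : measurableTypeR R := a + d * y.
have mphi : measurable_fun [set: measurableTypeR R] phi.
  by apply: mfunD; [exact: mfun_cst|apply: mfunM; [exact: mfun_cst|exact: measurable_id]].
have d0' : 0 <= d^-1 by rewrite invr_ge0 ltW.
pose nu : {measure set (measurableTypeR R) -> \bar R} :=
  measure_function_pushforward__canonical__measure_function_Measure mu mphi.
have mumu : forall X, measurable X -> mu X = mscale (NngNum (ltW d0)) nu X.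
  apply: lebesgue_measure_unique => // _ [[p q]] _ <-.
  have E2 : phi @^-1` `]p, q] = `](d^-1 * (p - a)), (d^-1 * (q - a))]%classic.
    apply/seteqP; split => x /=; rewrite !in_itv /= /phi => /andP[h1 h2].
      by rewrite ltr_pdivrMl // ler_pdivlMl // ltrBlDl lerBrDl h1 h2.
    by move: h1 h2; rewrite ltr_pdivrMl // ler_pdivlMl // ltrBlDl lerBrDl => -> ->.
  change (mu `]p, q] = (d%:E * mu (phi @^-1` `]p, q]))%E).
  rewrite E2 !lebesgue_measure_itv /= !lte_fin ltr_pM2l ?invr_gt0 // ltrD2r.
  case: ifP => _; last by rewrite mule0.
  by rewrite -!EFinB -EFinM; congr EFin; field; rewrite gt_eqF.
transitivity (\int[nu]_y f y)%E.
  by rewrite (ge0_integral_pushforward mphi).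
rewrite [in RHS](eq_measure_integral (mscale (NngNum (ltW d0)) nu)); last first.
  by move=> A mA _; exact: mumu.
rewrite ge0_integral_mscale // muleA -EFinM mulVf ?mul1e //.
by rewrite gt_eqF.
Qed.

Lemma ge0_integral_opp (f : measurableTypeR R -> \bar R) :
  measurable_fun setT f -> (forall x, (0 <= f x)%E) ->
  (\int[mu]_y f (- y)%R = \int[mu]_x f x)%E.
Proof.
move=> mf f0.
have mN : measurable_fun setT (-%R : measurableTypeR R -> measurableTypeR R).
  exact: oppr_measurable.
transitivity (\int[pushforward mu (-%R : measurableTypeR R -> measurableTypeR R)]_y f y)%E.
  by rewrite ge0_integral_pushforward.
by apply: eq_measure_integral => A mA _; exact: lebesgue_measureN.
Qed.

Let Int_transfer (phi : R -> R) (c : R) f : 0 <= c -> mfun phi ->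
  (forall g : measurableTypeR R -> \bar R,
    measurable_fun setT g -> (forall x, (0 <= g x)%E) ->
    (\int[mu]_y g (phi y) = c%:E * \int[mu]_x g x)%E) ->
  integ f -> integ (f \o phi) /\ Int (f \o phi) = c * Int f.
Proof.
move=> c0 mphi H iF.
have mf : measurable_fun setT (EFin \o f : measurableTypeR R -> \bar R).
  by have := measurable_int _ iF.
have iFp : integ (f \o phi).
  apply/integrableP; split.
    by apply/measurable_EFinP; apply: mfun_comp => //; exact: integ_mfun.
  have := H (abse \o (EFin \o f)) (measurableT_comp _ mf) (fun=> abse_ge0 _).
  rewrite /= => -> //.
  by case/integrableP : iF => _ h; rewrite lte_mul_pinfty.
split => //.
have Ep : (\int[mu]_x ((EFin \o (f \o phi))^\+ x)%E = c%:E * \int[mu]_x ((EFin \o f)^\+ x)%E)%E.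
  by rewrite -(H _ (measurable_funepos mf) (fun=> funepos_ge0 _ _)); apply: eq_integral => x _; rewrite !funeposE.
have Em : (\int[mu]_x ((EFin \o (f \o phi))^\- x)%E = c%:E * \int[mu]_x ((EFin \o f)^\- x)%E)%E.
  by rewrite -(H _ (measurable_funeneg mf) (fun=> funeneg_ge0 _ _)); apply: eq_integral => x _; rewrite !funenegE.
have ip := integrable_fin_num measurableT (integrable_funepos measurableT iF).
have im := integrable_fin_num measurableT (integrable_funeneg measurableT iF).
have EI g : Int g = fine (\int[mu]_x ((EFin \o g)^\+ x)%E - \int[mu]_x ((EFin \o g)^\- x)%E)%E.
  by rewrite -integralE.
by rewrite !EI Ep Em fineB ?fin_numM // fineB // !fineM // mulrBr.
Qed.

Lemma Int_affine a d f : 0 < d -> integ f ->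
  integ (fun y => f (a + d * y)) /\ Int (fun y => f (a + d * y)) = d^-1 * Int f.
Proof.
move=> d0; apply: Int_transfer => [||g mg g0]; last exact: ge0_integral_affine.
  by rewrite invr_ge0 ltW.
by apply: mfunD; [exact: mfun_cst|apply: mfunM; [exact: mfun_cst|exact: measurable_id]].
Qed.

Lemma Int_opp f : integ f ->
  integ (fun y => f (- y)) /\ Int (fun y => f (- y)) = Int f.
Proof.
move=> iF; have [||g mg g0|? h] := @Int_transfer -%R 1 f _ _ _ iF => //.
- exact: oppr_measurable.
- by rewrite mul1e ge0_integral_opp.
- by rewrite mul1r in h.
Qed.

End integral_toolkit.

(** * Fubini and the fundamental theorem of calculus *)
Section fubini_ftc.
Context {R : realType}.
Implicit Types f g h : R -> R.
Local Notation mu := (@lebesgue_measure R).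

Definition mfun2 (F : R -> R -> R) : Prop :=
  measurable_fun [set: measurableTypeR R * measurableTypeR R]
    (fun z : measurableTypeR R * measurableTypeR R => F z.1 z.2).

Lemma mfun2_l f : mfun f -> mfun2 (fun x _ => f x).
Proof. by move=> mf; exact: (measurableT_comp mf measurable_fst). Qed.

Lemma mfun2_r f : mfun f -> mfun2 (fun _ y => f y).
Proof. by move=> mf; exact: (measurableT_comp mf measurable_snd). Qed.

Lemma mfun2M (F G : R -> R -> R) : mfun2 F -> mfun2 G -> mfun2 (fun x y => F x y * G x y).
Proof. exact: measurable_funM. Qed.

Lemma mfun2D (F G : R -> R -> R) : mfun2 F -> mfun2 G -> mfun2 (fun x y => F x y + G x y).
Proof. exact: measurable_funD. Qed.

Lemma mfun2B (F G : R -> R -> R) : mfun2 F -> mfun2 G -> mfun2 (fun x y => F x y - G x y).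
Proof. exact: measurable_funB. Qed.

Lemma mfun2_comp f (F : R -> R -> R) : mfun f -> mfun2 F -> mfun2 (fun x y => f (F x y)).
Proof. by move=> mf mF; exact: (measurableT_comp mf mF). Qed.

Lemma mfun2_sec1 (F : R -> R -> R) x : mfun2 F -> mfun (F x).
Proof. by move=> mF; exact: (measurableT_comp mF (pair1_measurable x)). Qed.

Lemma mfun2_sec2 (F : R -> R -> R) y : mfun2 F -> mfun (F ^~ y).
Proof. by move=> mF; exact: (measurableT_comp mF (pair2_measurable y)). Qed.

(** Domination by a product of integrable functions is the only form of
    integrability over the plane that occurs below; besides the exchange it
    yields the measurability of the partial integral. *)
Lemma Int_fubini (F : R -> R -> R) g h : mfun2 F -> integ g -> integ h ->
  (forall x y, `|F x y| <= g x * h y) ->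
  integ (fun x => Int (F x)) /\
  Int (fun x => Int (F x)) = Int (fun y => Int (F ^~ y)).
Proof.
move=> mF ig ih FM.
have mE : measurable_fun [set: measurableTypeR R * measurableTypeR R]
    (EFin \o (fun z : measurableTypeR R * measurableTypeR R => F z.1 z.2)).
  exact/measurable_EFinP.
have i1 x : integ (F x).
  apply: (@le_integ _ _ (fun y => g x * h y)) => //; [exact: mfun2_sec1|exact: integZ].
have i2 y : integ (F ^~ y).
  apply: (@le_integ _ _ (fun x => h y * g x)) => //; [exact: mfun2_sec2|exact: integZ|].
  by move=> x; rewrite mulrC.
have iF : (mu \x mu)%E.-integrable [set: measurableTypeR R * measurableTypeR R]
    (EFin \o (fun z : measurableTypeR R * measurableTypeR R => F z.1 z.2)).
  apply/(integrable12ltyP mu mu mE).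
  pose Ih : \bar R := (\int[mu]_y `|(h y)%:E|)%E.
  have Ih_fin : Ih \is a fin_num.
    by apply: (integrable_fin_num measurableT); exact: integrable_abse.
  apply: (@le_lt_trans _ _ (\int[mu]_x (Ih * `|(g x)%:E|)%E)%E).
    apply: ge0_le_integral => //.
    - by move=> x _; exact: integral_ge0.
    - apply: (measurable_fun_fubini_tonelli_F
        (abse \o (EFin \o (fun z : measurableTypeR R * measurableTypeR R => F z.1 z.2)))) => [|z].
        exact: measurableT_comp.
      exact: abse_ge0.
    - apply: measurable_funeM.
      by apply: measurableT_comp => //; exact: (measurable_int _ ig).
    - move=> x _ /=.
      rewrite muleC -ge0_integralZl //; last first.
        by apply: measurableT_comp => //; exact: (measurable_int _ ih).
      apply: ge0_le_integral => //.
      + by apply/measurable_EFinP; apply: measurableT_comp => //; exact: (integ_mfun (i1 x)).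
      + apply: measurable_funeM.
        by apply: measurableT_comp => //; exact: (measurable_int _ ih).
      + move=> y _ /=; rewrite -EFinM lee_fin -normrM.
        exact: le_trans (FM x y) (ler_norm _).
  have mg : measurable_fun [set: measurableTypeR R] (abse \o (EFin \o g)).
    by apply: measurableT_comp => //; exact: (measurable_int _ ig).
  have -> : (\int[mu]_x (Ih * `|(g x)%:E|) = Ih * \int[mu]_x `|(g x)%:E|)%E.
    by apply: ge0_integralZl => //; exact: integral_ge0.
  have Ih0 : (0 <= Ih)%E by apply: integral_ge0 => y _; exact: abse_ge0.
  by rewrite lte_mul_pinfty //; case/integrableP: ig.
have EF x : (\int[mu]_y (F x y)%:E)%E = (Int (F x))%:E.
  by rewrite fineK //; exact: (integrable_fin_num measurableT (i1 x)).
have EG y : (\int[mu]_x (F x y)%:E)%E = (Int (F ^~ y))%:E.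
  by rewrite fineK //; exact: (integrable_fin_num measurableT (i2 y)).
split.
  have := integrable_fubini_F iF; apply: eq_integrable => // x _.
  by rewrite /fubini_F /= EF.
have E := Fubini iF; rewrite /Int /Rintegral; congr fine.
transitivity (\int[mu]_x \int[mu]_y (F x y)%:E)%E.
  by apply: eq_integral => x _; rewrite EF.
by rewrite E; apply: eq_integral => x _; rewrite EG.
Qed.

Lemma integ_pt c : integ (fun x : R => (x == c)%:R) /\ Int (fun x : R => (x == c)%:R) = 0.
Proof.
have E : (fun x : R => (x == c)%:R) = \1_[set c] :> (R -> R).
  by apply/funext => x; rewrite indicE in_set1.
have mc : measurable ([set c] : set (measurableTypeR R)) by exact: measurable_set1.
split.
  rewrite E /integ; apply/integrableP; split.
    by apply/measurable_EFinP; exact: measurable_indic.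
  under eq_integral do rewrite /= ger0_norm //.
  rewrite integral_indic // setIT.
  apply: (@le_lt_trans _ _ 0%E) => //.
  by rewrite le_eqVlt; apply/orP; left; apply/eqP; exact: lebesgue_measure_set1.
rewrite -[RHS](Rintegral_set1 (fun=> 1) c) Rintegral_mkcond /Int E.
by congr (Rintegral _ _ _); apply/funext => x; rewrite patchE indicE; case: ifP.
Qed.

(** Closed formulas for the kernels fail at one point, the zero lag or the
    jump, where the totalised division or a comparison takes another value. *)
Lemma Int_eq_off c f g : integ f -> (forall x, x != c -> f x = g x) ->
  integ g /\ Int g = Int f.
Proof.
move=> iF fg; have [i0 I0] := integ_pt c.
have -> : g = (fun x => f x + (g c - f c) * (x == c)%:R).
  apply/funext => x; have [->|xc] := eqVneq x c; first by rewrite mulr1 addrC subrK.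
  by rewrite mulr0 addr0 fg.
split; first exact: (integD iF (integZ _ i0)).
by rewrite (IntD iF (integZ _ i0)) IntZ // I0 mulr0 addr0.
Qed.

Lemma FTC_itv f (F : R -> R) (a b : R) : continuous f -> (forall x : R, is_derive x 1 F (f x)) ->
  a < b -> Int (fun x => (a <= x <= b)%R%:R * f x) = F b - F a.
Proof.
move=> cf dF ab.
have cF : continuous F.
  by move=> x; apply/differentiable_continuous/derivable1_diffP; have [] := dF x.
have := @continuous_FTC2 R f F a b ab.
rewrite (_ : (fun x => _) = f \_ `[a, b]); last first.
  apply/funext => x; rewrite patchE mem_setE /= in_itv /=.
  by case: ifP; rewrite ?mul1r ?mul0r.
rewrite /Int -Rintegral_mkcond /Rintegral => -> //.
- exact: continuous_subspaceT.
- split; first by move=> x _; have [] := dF x.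
  + by apply: cvg_at_right_filter; exact: cF.
  + by apply: cvg_at_left_filter; exact: cF.
- by move=> x _; rewrite derive1E; have [_] := dF x.
Qed.

Lemma mfun_le (a : R) : mfun (fun x : R => (a <= x)%R%:R).
Proof. by apply: nondecreasing_measurable => // x y xy; case: (leP a x) => // ax; rewrite (le_trans ax). Qed.

Lemma mfun_ge (a : R) : mfun (fun x : R => (x <= a)%R%:R).
Proof.
apply: nonincreasing_measurable => // x y xy.
by case: (leP y a) => // ya; rewrite (le_trans xy).
Qed.

Lemma mfun_itv (a b : R) : mfun (fun x : R => (a <= x <= b)%R%:R).
Proof.
rewrite (_ : (fun x => _) = (fun x : R => (a <= x)%R%:R * (x <= b)%R%:R)).
  exact: mfunM (mfun_le _) (mfun_ge _).
by apply/funext => x; rewrite -natrM mulnb.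
Qed.

Lemma cvg_itv_ind (x : R) (a b : nat -> R) : 
  (\forall n \near \oo, a n <= x) -> (\forall n \near \oo, x <= b n) ->
  (a n <= x <= b n)%R%:R @[n --> \oo] --> (1 : R).
Proof.
move=> A B; apply: cvg_near_cst.
by apply: filterS2 A B => n -> ->.
Qed.

Lemma near_natr_ge (c : R) : \forall n \near \oo, c <= n.+1%:R.
Proof.
near=> n; apply: (@le_trans _ _ n%:R); last by rewrite ler_nat.
by near: n; exact: nbhs_infty_ger.
Unshelve. all: by end_near. Qed.

Lemma cvgn_natS : (n.+1%:R : R) @[n --> \oo] --> +oo.
Proof. by apply/cvgryPge => A; exact: near_natr_ge. Qed.

Let FTC_gen (g f F : R -> R) (a b : nat -> R) (la lb : R) :
  continuous f -> (forall x : R, is_derive x 1 F (f x)) -> (forall n, a n < b n) ->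
  integ g ->
  (forall n x, (a n <= x <= b n)%R%:R * f x = (a n <= x <= b n)%R%:R * g x) ->
  (forall x, (a n <= x <= b n)%R%:R * g x @[n --> \oo] --> g x) ->
  F (a n) @[n --> \oo] --> la -> F (b n) @[n --> \oo] --> lb ->
  Int g = lb - la.
Proof.
move=> cf dF ab ig fg cg Fa Fb.
have bd n x : `|(a n <= x <= b n)%R%:R * g x| <= `|g x|.
  by rewrite normrM; case: (_ <= _ <= _); rewrite ?normr1 ?normr0 ?mul1r ?mul0r.
have [_ C] := Int_dominated_cvg (fun n => mfunM (mfun_itv (a n) (b n)) (integ_mfun ig)) cg (integ_norm ig) bd.
apply: (cvg_unique _ C) => //.
rewrite (_ : (fun n => _) = (fun n => F (b n) - F (a n))); first exact: cvgB.
by apply/funext => n; rewrite -(FTC_itv cf dF (ab n)); apply: eq_Int => x; rewrite fg.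
Qed.

Lemma FTC_line f (F : R -> R) (l l' : R) : continuous f -> (forall x : R, is_derive x 1 F (f x)) ->
  integ f -> F x @[x --> +oo] --> l -> F x @[x --> -oo] --> l' -> Int f = l - l'.
Proof.
move=> cf dF iF Fl Fl'.
apply: (FTC_gen (a := fun n => - n.+1%:R) (b := fun n => n.+1%:R) cf dF) => //.
- by move=> n; rewrite gtrN.
- move=> x; rewrite -[X in _ --> X]mul1r; apply: cvgM; last exact: cvg_cst.
  apply: cvg_itv_ind; last exact: near_natr_ge.
  by apply: filterS (near_natr_ge (- x)) => n; rewrite lerNl.
- apply: (cvg_comp _ _ _ Fl').
  apply/cvgrNyPle => A.
  by apply: filterS (near_natr_ge (- A)) => n; rewrite lerNl.
- exact: (cvg_comp _ _ cvgn_natS Fl).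
Qed.

Lemma FTC_right f (F : R -> R) (a l : R) : continuous f -> (forall x : R, is_derive x 1 F (f x)) ->
  integ (fun x => (a <= x)%R%:R * f x) -> F x @[x --> +oo] --> l ->
  Int (fun x => (a <= x)%R%:R * f x) = l - F a.
Proof.
move=> cf dF iF Fl.
apply: (FTC_gen (a := fun n => a) (b := fun n => a + n.+1%:R) cf dF) => //.
- by move=> n; rewrite ltrDl.
- by move=> n x; rewrite mulrA -natrM mulnb; case: (a <= x); rewrite ?andbT ?andbF.
- move=> x; case: (leP a x) => ax; last first.
    by apply: cvg_near_cst; apply: nearW => n; rewrite ?andbF /= !mul0r ?mulr0.
  rewrite -[X in _ --> X]mul1r; apply: cvgM; last exact: cvg_cst.
  have -> : (fun n => (true && (x <= a + n.+1%:R)%R)%:R) =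
      (fun n => (a <= x <= a + n.+1%:R)%R%:R : R).
    by rewrite ax.
  apply: cvg_itv_ind; first exact: nearW.
  by apply: filterS (near_natr_ge (x - a)) => n; rewrite lerBlDl.
- exact: cvg_cst.
- apply: (cvg_comp _ _ _ Fl); apply/cvgryPge => A.
  by apply: filterS (near_natr_ge (A - a)) => n; rewrite lerBlDl.
Qed.

Lemma FTC_left f (F : R -> R) (a l : R) : continuous f -> (forall x : R, is_derive x 1 F (f x)) ->
  integ (fun x => (x <= a)%R%:R * f x) -> F x @[x --> -oo] --> l ->
  Int (fun x => (x <= a)%R%:R * f x) = F a - l.
Proof.
move=> cf dF iF Fl.
apply: (FTC_gen (a := fun n => a - n.+1%:R) (b := fun n => a) cf dF) => //.
- by move=> n; rewrite gtrBl.
- by move=> n x; rewrite mulrA -natrM mulnb; case: (x <= a); rewrite ?andbT ?andbF.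
- move=> x; case: (leP x a) => ax; last first.
    by apply: cvg_near_cst; apply: nearW => n; rewrite ?andbF /= !mul0r ?mulr0.
  rewrite -[X in _ --> X]mul1r; apply: cvgM; last exact: cvg_cst.
  have -> : (fun n => ((a - n.+1%:R <= x) && true)%R%:R) =
      (fun n => (a - n.+1%:R <= x <= a)%R%:R : R).
    by rewrite ax.
  apply: cvg_itv_ind; last exact: nearW.
  by apply: filterS (near_natr_ge (a - x)) => n; rewrite !lerBlDl addrC.
- apply: (cvg_comp _ _ _ Fl); apply/cvgrNyPle => A.
  by apply: filterS (near_natr_ge (a - A)) => n; rewrite !lerBlDl addrC.
- exact: cvg_cst.
Qed.

End fubini_ftc.

(** * Derivatives and the Lorentzian weight *)
Section calculus.
Context {R : realType}.
Implicit Types f g h : R -> R.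
Local Notation mu := (@lebesgue_measure R).

Definition Der f (g : R -> R) : Prop := forall x : R, is_derive x 1 f (g x).

Lemma der_cst (c : R) (x : R) : is_derive x 1 (fun _ : R => c) 0.
Proof. exact: is_derive_cst. Qed.

Lemma der_id (x : R) : is_derive x 1 (fun y : R => y) 1.
Proof. exact: is_derive_id. Qed.

Lemma derD f g (x df dg : R) : is_derive x 1 f df -> is_derive x 1 g dg ->
  is_derive x 1 (fun y => f y + g y) (df + dg).
Proof. by move=> h1 h2; exact: is_deriveD. Qed.

Lemma derB f g (x df dg : R) : is_derive x 1 f df -> is_derive x 1 g dg ->
  is_derive x 1 (fun y => f y - g y) (df - dg).
Proof. by move=> h1 h2; exact: is_deriveB. Qed.

Lemma derN f (x df : R) : is_derive x 1 f df -> is_derive x 1 (fun y => - f y) (- df).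
Proof. by move=> h1; exact: is_deriveN. Qed.

Lemma derM f g (x df dg : R) : is_derive x 1 f df -> is_derive x 1 g dg ->
  is_derive x 1 (fun y => f y * g y) (df * g x + f x * dg).
Proof.
move=> h1 h2; have h := is_deriveM h1 h2.
by apply: (is_derive_eq h); rewrite /GRing.scale /= addrC [g x * _]mulrC.
Qed.

Lemma derV f (x df : R) : f x != 0 -> is_derive x 1 f df ->
  is_derive x 1 (fun y => (f y)^-1) (- df / (f x) ^+ 2).
Proof.
move=> fx0 h1; have h := is_deriveV fx0 h1.
by apply: (is_derive_eq h); rewrite /GRing.scale /=; field.
Qed.

Lemma der_comp f g (x df dg : R) : is_derive (g x) 1 f df -> is_derive x 1 g dg ->
  is_derive x 1 (fun y => f (g y)) (df * dg).
Proof.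
move=> h1 h2; have h := is_derive1_comp h1 h2.
by apply: (is_derive_eq h); rewrite mulrC.
Qed.

Lemma Der_cont f g : Der f g -> continuous f.
Proof.
by move=> dF x; apply/differentiable_continuous/derivable1_diffP; have [] := dF x.
Qed.

(** [pi] times the Poisson kernel of the half-plane at height one. *)
Definition lorentz (x : R) : R := (1 + x ^+ 2)^-1.

(** At once the derivative of [x * lorentz x] and the half-Laplacian of
    [lorentz], see [der_xlorentz] and [halfLap_lorentz]. *)
Definition dxlorentz (x : R) : R := (1 - x ^+ 2) / (1 + x ^+ 2) ^+ 2.

Lemma sqr1_gt0 (x : R) : 0 < 1 + x ^+ 2.
Proof. by rewrite ltr_wpDr ?sqr_ge0. Qed.

Lemma sqr1_neq0 (x : R) : 1 + x ^+ 2 != 0.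
Proof. by rewrite gt_eqF ?sqr1_gt0. Qed.

Lemma lorentz_gt0 x : 0 < lorentz x.
Proof. by rewrite invr_gt0 sqr1_gt0. Qed.

Lemma lorentz_le1 x : lorentz x <= 1.
Proof. by rewrite invf_le1 ?sqr1_gt0 // lerDl sqr_ge0. Qed.

Lemma lorentzN x : lorentz (- x) = lorentz x.
Proof. by rewrite /lorentz sqrrN. Qed.

Lemma der_sqr1 (x : R) : is_derive x 1 (fun y : R => 1 + y ^+ 2) (2 * x).
Proof.
apply: (is_derive_eq (derD (der_cst 1 x) (derM (der_id x) (der_id x)))).
by ring.
Qed.

Lemma der_lorentz : Der lorentz (fun x => - (2 * x) * lorentz x ^+ 2).
Proof.
move=> x; have h := derV (sqr1_neq0 x : (fun y : R => 1 + y ^+ 2) x != 0) (der_sqr1 x).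
apply: (is_derive_eq h).
by rewrite /lorentz exprVn.
Qed.

Lemma der_xlorentz : Der (fun x => x * lorentz x) dxlorentz.
Proof.
move=> x; apply: is_derive_eq (derM (der_id x) (der_lorentz x)) _.
by rewrite /dxlorentz /lorentz; field; exact: sqr1_neq0.
Qed.

Lemma lorentz_cont : continuous lorentz.
Proof. exact: Der_cont der_lorentz. Qed.

Lemma lorentz_mfun : mfun lorentz.
Proof. exact: cont_mfun lorentz_cont. Qed.

Lemma dxlorentz_cont : continuous dxlorentz.
Proof.
have -> : dxlorentz = (fun x => (1 - x ^+ 2) * lorentz x ^+ 2).
  by apply/funext => x; rewrite /dxlorentz /lorentz exprVn.
move=> x; apply: cvgM.
  by apply: cvgB; [exact: cvg_cst|exact: exprn_continuous].
by rewrite expr2; under eq_fun do rewrite expr2; apply: cvgM; exact: lorentz_cont.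
Qed.

Lemma dxlorentz_le x : `|dxlorentz x| <= lorentz x.
Proof.
rewrite /dxlorentz /lorentz normrM normfV (ger0_norm (sqr_ge0 (1 + x ^+ 2))).
rewrite ler_pdivrMr ?exprn_gt0 ?sqr1_gt0 // expr2 mulKf ?sqr1_neq0 //.
by rewrite ler_norml; have := sqr_ge0 x; lra.
Qed.

Lemma integ_Int_lorentz : integ lorentz /\ Int lorentz = pi.
Proof.
have E : (\int[mu]_x (lorentz x)%:E = pi%:E)%E.
  rewrite ge0_symfun_integralT; last 3 first.
  - by move=> x; exact/ltW/lorentz_gt0.
  - exact: lorentz_cont.
  - by move=> x; rewrite /= lorentzN.
  rewrite -set_itvcy (@ge0_continuous_FTC2y R lorentz atan 0 (pi / 2)) //.
  - by rewrite atan0 sube0 -EFinM mulrC divfK.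
  - by move=> x _; exact/ltW/lorentz_gt0.
  - by apply: continuous_subspaceT; exact: lorentz_cont.
  - exact: cvgy_atan.
  - by apply: cvg_at_right_filter; exact: continuous_atan.
  - by move=> x _; rewrite derive1_atan.
split; last by rewrite /Int /Rintegral E.
apply/integrableP; split; first by apply/measurable_EFinP; exact: lorentz_mfun.
under eq_integral do rewrite gee0_abs ?lee_fin ?ltW ?lorentz_gt0 //.
by rewrite E ltry.
Qed.

Lemma integ_lorentz : integ lorentz. Proof. exact: integ_Int_lorentz.1. Qed.
Lemma Int_lorentz : Int lorentz = pi. Proof. exact: integ_Int_lorentz.2. Qed.

Lemma integ_dxlorentz : integ dxlorentz.
Proof. exact: le_integ (cont_mfun dxlorentz_cont) integ_lorentz dxlorentz_le. Qed.

Lemma xlorentz_le x : `|x * lorentz x| <= 2^-1.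
Proof.
rewrite normrM (ger0_norm (ltW (lorentz_gt0 x))) /lorentz ler_pdivrMr ?sqr1_gt0 //.
by rewrite -(real_normK (num_real x)); have := sqr_ge0 (`|x| - 1); lra.
Qed.

Lemma cvg_xlorentz_pinfty : x * lorentz x @[x --> +oo] --> (0 : R).
Proof.
apply/cvgr0Pnorm_lt => e e0.
near=> x.
have x0 : 0 < x by near: x; exact: nbhs_pinfty_gt.
have xe : e^-1 < x by near: x; apply: nbhs_pinfty_gt; rewrite num_real.
rewrite ger0_norm ?mulr_ge0 ?ltW ?lorentz_gt0 // /lorentz ltr_pdivrMr ?sqr1_gt0 //.
move: xe; rewrite -(ltr_pM2r e0) mulVf ?gt_eqF // => xe.
by rewrite -(ltr_pM2r x0) in xe; nra.
Unshelve. all: by end_near. Qed.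

Lemma cvg_xlorentz_ninfty : x * lorentz x @[x --> -oo] --> (0 : R).
Proof.
apply/cvgNy_compNP; rewrite /comp.
under eq_fun do rewrite lorentzN mulNr.
by have := cvgN cvg_xlorentz_pinfty; rewrite oppr0; apply.
Qed.

Lemma Int_dxlorentz_le0 : Int (fun x => (x <= 0)%R%:R * dxlorentz x) = 0.
Proof.
have iK : integ (fun x => (x <= 0)%R%:R * dxlorentz x).
  apply: (@integ_bdM _ 1) => //; [exact: mfun_ge| |exact: integ_dxlorentz].
  by move=> x; rewrite ger0_norm ?ler0n // lern1 leq_b1.
by rewrite (FTC_left dxlorentz_cont der_xlorentz iK cvg_xlorentz_ninfty) mul0r subr0.
Qed.

Lemma Int_dxlorentz : Int dxlorentz = 0.
Proof.
by rewrite (FTC_line dxlorentz_cont der_xlorentz integ_dxlorentz cvg_xlorentz_pinfty cvg_xlorentz_ninfty) subr0.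
Qed.

End calculus.

(** * The half-Laplacian as a singular integral *)
Section nonlocal.
Context {R : realType}.
Implicit Types f g h : R -> R.

(** The symmetric second difference makes the integrand bounded near the zero
    lag, so that no principal value is needed. *)
Definition sdq f (x y : R) : R := (2 * f x - f (x + y) - f (x - y)) / y ^+ 2.

(** The kernel of the half-Laplacian is [1 / (pi y^2)]; the extra factor two
    compensates that the second difference visits each point twice. *)
Definition halfLap f (x : R) : R := (2 * pi)^-1 * Int (sdq f x).

Definition lorentz_sum (x y : R) : R := lorentz y + lorentz (x + y) + lorentz (x - y).

Lemma lorentz_sum_ge0 x y : 0 <= lorentz_sum x y.
Proof. by rewrite !addr_ge0 // ltW // lorentz_gt0. Qed.

Lemma Int_shift f (x : R) : integ f ->
  integ (fun y => f (x + y)) /\ Int (fun y => f (x + y)) = Int f.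
Proof.
move=> iF; have [i1 I1] := Int_affine x ltr01 iF.
rewrite invr1 mul1r in I1.
split; last by rewrite -I1; apply: eq_Int => y; rewrite mul1r.
by apply: eq_integ i1 => y; rewrite mul1r.
Qed.

Lemma Int_reflect f (x : R) : integ f ->
  integ (fun y => f (x - y)) /\ Int (fun y => f (x - y)) = Int f.
Proof.
move=> iF; have [i1 I1] := Int_shift x iF.
by have [i2 I2] := Int_opp i1; split => //; rewrite I2.
Qed.

Lemma lorentz_sum_int (x : R) : integ (lorentz_sum x) /\ Int (lorentz_sum x) = 3 * pi.
Proof.
have [i1 I1] := Int_shift x (@integ_lorentz R).
have [i2 I2] := Int_reflect x (@integ_lorentz R).
have i0 := integD (@integ_lorentz R) i1.
split; first exact: (integD i0 i2).
rewrite /lorentz_sum (IntD i0 i2) (IntD (@integ_lorentz R) i1) I1 I2 Int_lorentz; ring.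
Qed.

(** Divide [1 + (u + v)^2 <= 2 (1 + u^2) + 2 (1 + v^2)] by the product of the
    three denominators. *)
Lemma lorentz_split (u v : R) : lorentz u * lorentz v <= 2 * lorentz (u + v) * (lorentz u + lorentz v).
Proof.
have h (a b c : R) : 0 < a -> 0 < b -> 0 < c -> c <= 2 * (a + b) ->
    a^-1 * b^-1 <= 2 * c^-1 * (a^-1 + b^-1).
  move=> a0 b0 c0 cab.
  have -> : 2 * c^-1 * (a^-1 + b^-1) = (2 * (a + b) / c) * (a^-1 * b^-1).
    by field; rewrite !gt_eqF.
  have ab0 : 0 <= a^-1 * b^-1 by rewrite mulr_ge0 // invr_ge0 ltW.
  by rewrite ler_peMl // ler_pdivlMr // mul1r.
by apply: h; rewrite ?sqr1_gt0 //; have := sqr_ge0 (u - v); nra.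
Qed.

Lemma sdqN f x y : sdq f x (- y) = sdq f x y.
Proof. by rewrite /sdq sqrrN opprK; congr (_ / _); ring. Qed.

Lemma MVT_line f g (a b : R) : Der f g -> a < b ->
  exists2 c, a < c < b & f b - f a = g c * (b - a).
Proof.
move=> dF ab.
have [||c] := @MVT R f g a b ab.
- by move=> x _; exact: dF.
- by apply: continuous_subspaceT; exact: Der_cont dF.
by rewrite in_itv /= => cab ->; exists c.
Qed.

Lemma second_diff f f1 f2 (x y : R) : Der f f1 -> Der f1 f2 -> 0 < y ->
  exists2 d, x - y < d < x + y &
    `|2 * f x - f (x + y) - f (x - y)| <= 2 * `|f2 d| * y ^+ 2.
Proof.
move=> d1 d2 y0.
pose p t := f (x + t) + f (x - t).
have dp : Der p (fun t => f1 (x + t) - f1 (x - t)).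
  move=> t.
  have e1 : is_derive t 1 (fun t : R => x + t) 1.
    by apply: (is_derive_eq (derD (der_cst x t) (der_id t))); rewrite add0r.
  have e2 : is_derive t 1 (fun t : R => x - t) (-1).
    by apply: (is_derive_eq (derB (der_cst x t) (der_id t))); rewrite sub0r.
  apply: (is_derive_eq (derD (@der_comp _ f (fun t => x + t) t _ _ (d1 (x + t)) e1)
    (@der_comp _ f (fun t => x - t) t _ _ (d1 (x - t)) e2))).
  by rewrite mulr1 mulrN1.
have [c /andP[c0 cy] Ec] := MVT_line dp y0.
have [|d /andP[dl du] Ed] := MVT_line d2 (_ : x - c < x + c); first by lra.
exists d; first by apply/andP; split; lra.
have -> : 2 * f x - f (x + y) - f (x - y) = - (f2 d * (2 * c) * y).
  have : p y - p 0 = f2 d * (2 * c) * y.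
    by rewrite Ec Ed; ring.
  by rewrite /p addr0 subr0 => <-; ring.
rewrite normrN !normrM (gtr0_norm y0) (gtr0_norm c0) (ger0_norm (ler0n _ 2)).
have yc : 0 <= y - c by lra.
by have := mulr_ge0 (mulr_ge0 (normr_ge0 (f2 d)) (ltW y0)) yc; nra.
Qed.

(** Two regimes: for lags below one the second difference is controlled by the
    second derivative at a point nearby, for larger lags each of its terms is
    estimated separately and [lorentz_split] redistributes the decay.  The bound
    factors [lorentz x] out, so that [halfLap f] inherits the decay of [f]. *)
Lemma sdq_bd f f1 f2 (M : R) : Der f f1 -> Der f1 f2 ->
  (forall x, `|f x| <= M * lorentz x) -> (forall x, `|f2 x| <= M * lorentz x) ->
  forall x y, `|sdq f x y| <= 12 * M * lorentz x * lorentz_sum x y.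
Proof.
move=> d1 d2 fM f2M x y.
have M0 : 0 <= M.
  by have := le_trans (normr_ge0 _) (fM 0); rewrite pmulr_lge0 // lorentz_gt0.
wlog y0 : y / 0 < y => [hw|].
  have [y0|y0|->] := ltgtP y 0.
  - rewrite -sdqN (_ : lorentz_sum x y = lorentz_sum x (- y));
        last by rewrite /lorentz_sum lorentzN opprK; ring.
    by apply: hw; rewrite oppr_gt0.
  - exact: hw.
  - rewrite /sdq expr0n invr0 mulr0 normr0.
    by rewrite !mulr_ge0 // ?lorentz_sum_ge0 // ltW // lorentz_gt0.
have wx := lorentz_gt0 x; have wy := lorentz_gt0 y.
have wp := lorentz_gt0 (x + y); have wm := lorentz_gt0 (x - y).
rewrite /sdq normrM normfV (ger0_norm (sqr_ge0 y)).
rewrite ler_pdivrMr ?exprn_gt0 //.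
have [y1|y1] := leP 1 y.
- have b1 : lorentz (x + y) * lorentz y <= 2 * lorentz x * (lorentz (x + y) + lorentz y).
    by have := lorentz_split (x + y) (- y); rewrite lorentzN addrK.
  have b2 : lorentz (x - y) * lorentz y <= 2 * lorentz x * (lorentz (x - y) + lorentz y).
    by have := lorentz_split (x - y) y; rewrite subrK.
  have b3 : 1 <= 2 * lorentz y * y ^+ 2.
    by rewrite /lorentz mulrAC ler_pdivlMr ?sqr1_gt0 //; nra.
  have tri : `|2 * f x - f (x + y) - f (x - y)| <=
      M * (2 * lorentz x + lorentz (x + y) + lorentz (x - y)).
    apply: (le_trans (ler_normB _ _)).
    apply: (le_trans (lerD (ler_normB _ _) (lexx _))).
    rewrite normrM (ger0_norm (ler0n _ 2)).
    have := fM x; have := fM (x + y); have := fM (x - y); nra.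
  apply: (le_trans tri).
  have S0 : 0 <= M * (2 * lorentz x + lorentz (x + y) + lorentz (x - y)).
    by rewrite mulr_ge0 // !addr_ge0 // ?mulr_ge0 // ltW.
  apply: (@le_trans _ _ (M * (2 * lorentz x + lorentz (x + y) + lorentz (x - y)) * (2 * lorentz y * y ^+ 2))).
    by rewrite ler_peMr.
  rewrite (_ : _ * (2 * lorentz y * y ^+ 2) =
    (2 * M * (2 * lorentz x * lorentz y + lorentz (x + y) * lorentz y +
      lorentz (x - y) * lorentz y)) * y ^+ 2); last by ring.
  rewrite ler_wpM2r ?sqr_ge0 //.
  rewrite (_ : 12 * M * lorentz x * lorentz_sum x y = 2 * M * (6 * lorentz x * lorentz_sum x y)); last by ring.
  rewrite ler_wpM2l ?mulr_ge0 // /lorentz_sum.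
  have := mulr_ge0 (ltW wx) (ltW wp); have := mulr_ge0 (ltW wx) (ltW wm).
  have := mulr_ge0 (ltW wx) (ltW wy).
  lra.
- have [d /andP[dl du] Hd] := second_diff x d1 d2 y0.
  apply: (le_trans Hd); rewrite ler_wpM2r ?sqr_ge0 //.
  have wd : lorentz d <= 3 * lorentz x.
    rewrite /lorentz ler_pdivlMr ?sqr1_gt0 // mulrC ler_pdivrMr ?sqr1_gt0 //.
    have e1 : (x - d) ^+ 2 <= 1 by nra.
    by have := sqr_ge0 (x - 2 * d); have := sqr_ge0 d; lra.
  have wy2 : 1 <= 2 * lorentz y.
    by rewrite /lorentz ler_pdivlMr ?sqr1_gt0 // mul1r; nra.
  apply: (@le_trans _ _ (12 * M * lorentz x * lorentz y)); last first.
    have Mw : 0 <= 12 * M * lorentz x by rewrite !mulr_ge0 // ltW.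
    apply: ler_wpM2l => //; rewrite /lorentz_sum -addrA lerDl.
    by rewrite addr_ge0 // ltW.
  have := f2M d.
  have : M * lorentz d <= M * (3 * lorentz x) by rewrite ler_wpM2l.
  have : M * lorentz x <= M * lorentz x * (2 * lorentz y) by rewrite ler_peMr // mulr_ge0 // ltW.
  lra.
Qed.

Lemma sdq_mfun2 f : mfun f -> mfun2 (sdq f).
Proof.
move=> mf.
have mx := @mfun2_l R _ (@measurable_id _ _ setT : mfun (fun x => x)).
have my := @mfun2_r R _ (@measurable_id _ _ setT : mfun (fun x => x)).
apply: mfun2M.
  apply: mfun2B; last exact: mfun2_comp mf (mfun2B mx my).
  apply: mfun2B; last exact: mfun2_comp mf (mfun2D mx my).
  by apply: mfun2_l; apply: mfunM => //; exact: mfun_cst.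
apply: mfun2_r; apply: (@mfun_comp _ (fun z => z^-1)); first exact: mfun_inv.
exact: cont_mfun (@exprn_continuous _ 2).
Qed.

Section bounded_kernel.
Variables (f f1 f2 : R -> R) (M : R).
Hypotheses (d1 : Der f f1) (d2 : Der f1 f2)
  (fM : forall x, `|f x| <= M * lorentz x) (f2M : forall x, `|f2 x| <= M * lorentz x).

Let mf : mfun f. Proof. exact: cont_mfun (Der_cont d1). Qed.

Lemma integ_sdq x : integ (sdq f x).
Proof.
apply: (@le_integ _ _ (fun y => 12 * M * lorentz x * lorentz_sum x y));
    last exact: sdq_bd d1 d2 fM f2M x.
- exact: mfun2_sec1 (sdq_mfun2 mf).
- by apply: integZ; exact: (lorentz_sum_int x).1.
Qed.

Lemma halfLap_bd x : `|halfLap f x| <= 18 * M * lorentz x.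
Proof.
rewrite /halfLap normrM ger0_norm; last by rewrite invr_ge0 mulr_ge0 // pi_ge0.
have [iE IE] := lorentz_sum_int x.
have := le_norm_Int (integ_sdq x) (integZ (12 * M * lorentz x) iE) (sdq_bd d1 d2 fM f2M x).
rewrite IntZ // IE => h.
rewrite ler_pdivrMl ?mulr_gt0 ?pi_gt0 //; apply: (le_trans h).
by rewrite le_eqVlt; apply/orP; left; apply/eqP; ring.
Qed.

(** The weight [lorentz x] makes the kernel dominated by a product, which is what
    makes the parametric integral measurable in [x]. *)
Lemma halfLap_mfun : mfun (halfLap f).
Proof.
pose F x y := lorentz x * sdq f x y.
have M0 : 0 <= M.
  by have := le_trans (normr_ge0 _) (fM 0); rewrite pmulr_lge0 // lorentz_gt0.
have wxE x y : lorentz x * lorentz_sum x y <= 9 * lorentz y.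
  have h1 := lorentz_split (x + y) (- x); rewrite lorentzN addrAC subrr add0r in h1.
  have h2 := lorentz_split x (y - x).
  rewrite (_ : x + (y - x) = y) in h2; last by ring.
  rewrite -(lorentzN (y - x)) opprB in h2.
  have := lorentz_gt0 y; have := lorentz_gt0 x; have := lorentz_gt0 (x + y); have := lorentz_gt0 (x - y).
  have := lorentz_le1 y; have := lorentz_le1 x; have := lorentz_le1 (x + y); have := lorentz_le1 (x - y).
  rewrite /lorentz_sum; nra.
have FM x y : `|F x y| <= 108 * M * lorentz x * lorentz y.
  rewrite /F normrM (gtr0_norm (lorentz_gt0 x)).
  apply: (@le_trans _ _ (lorentz x * (12 * M * lorentz x * lorentz_sum x y))).
    by apply: ler_wpM2l; [exact/ltW/lorentz_gt0|exact: sdq_bd d1 d2 fM f2M x y].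
  rewrite (_ : lorentz x * _ = 12 * M * lorentz x * (lorentz x * lorentz_sum x y)); last by ring.
  rewrite (_ : 108 * _ * _ * _ = 12 * M * lorentz x * (9 * lorentz y)); last by ring.
  by rewrite ler_wpM2l // !mulr_ge0 // ltW // lorentz_gt0.
have mF : mfun2 F by apply: mfun2M (mfun2_l lorentz_mfun) (sdq_mfun2 mf).
have [iF _] := Int_fubini mF (integZ (108 * M) (@integ_lorentz R)) (@integ_lorentz R) FM.
have -> : halfLap f = (fun x => (2 * pi)^-1 * ((lorentz x)^-1 * Int (F x))).
  apply/funext => x; rewrite /halfLap /F IntZ; last exact: integ_sdq.
  by rewrite mulKf // gt_eqF // lorentz_gt0.
apply: mfunM; first exact: mfun_cst.
apply: mfunM; last exact: integ_mfun iF.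
exact: mfun_comp mfun_inv lorentz_mfun.
Qed.

Lemma integ_halfLap : integ (halfLap f).
Proof. exact: le_integ halfLap_mfun (integZ _ (@integ_lorentz R)) halfLap_bd. Qed.
End bounded_kernel.

Lemma cvg_lorentz_pinfty : lorentz x @[x --> +oo] --> (0 : R).
Proof.
apply: (@squeeze_cvgr _ _ _ _ (fun=> 0) (fun x => x * lorentz x)).
- near=> x.
  have x1 : 1 <= x by near: x; apply: nbhs_pinfty_ge; rewrite num_real.
  by rewrite ltW ?lorentz_gt0 //= ler_peMl // ltW // lorentz_gt0.
- exact: cvg_cst.
- exact: cvg_xlorentz_pinfty.
Unshelve. all: by end_near. Qed.

Lemma cvg_shift_pinfty (a : R) : (x + a) @[x --> +oo] --> +oo.
Proof.
apply/cvgryPge => c; near=> x; rewrite -lerBlDr.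
by near: x; apply: nbhs_pinfty_ge; rewrite num_real.
Unshelve. all: by end_near. Qed.

Lemma cvg_ln_ratio (x : R) :
  (ln (1 + (y + x) ^+ 2) - ln (1 + (y - x) ^+ 2)) @[y --> +oo] --> (0 : R).
Proof.
have E y : ln (1 + (y + x) ^+ 2) - ln (1 + (y - x) ^+ 2) =
    ln (1 + 4 * x * ((y - x) * lorentz (y - x) + x * lorentz (y - x))).
  rewrite -ln_div ?posrE ?sqr1_gt0 //; congr ln.
  by rewrite /lorentz; field; exact: sqr1_neq0.
under eq_fun do rewrite E.
have c0 : (1 + 4 * x * ((y - x) * lorentz (y - x) + x * lorentz (y - x))) @[y --> +oo] --> (1 : R).
  have -> : nbhs (1 : R) = nbhs (1 + 4 * x * (0 + x * 0) : R) by rewrite mulr0 addr0 mulr0 addr0.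
  apply: cvgD; first exact: cvg_cst.
  apply: cvgM; first exact: cvg_cst.
  apply: cvgD; first exact: (cvg_comp _ _ (cvg_shift_pinfty (- x)) cvg_xlorentz_pinfty).
  apply: cvgM; first exact: cvg_cst.
  exact: (cvg_comp _ _ (cvg_shift_pinfty (- x)) cvg_lorentz_pinfty).
rewrite -ln1; apply: (cvg_comp _ _ c0); exact: continuous_ln.
Qed.

Lemma cvg_atan_ninfty : (@atan R) x @[x --> -oo] --> - (pi / 2).
Proof.
apply/cvgNy_compNP; rewrite /comp; under eq_fun do rewrite atanN.
by have h := cvgN (@cvgy_atan R); exact: h.
Qed.

Lemma der2_lorentz : Der (fun x : R => - (2 * x) * lorentz x ^+ 2)
  (fun x => (6 * x ^+ 2 - 2) * lorentz x ^+ 3).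
Proof.
move=> x; have dw := der_lorentz x.
have d2 : is_derive x 1 (fun x : R => - (2 * x)) (- 2).
  by apply: (is_derive_eq (derN (derM (der_cst 2 x) (der_id x)))); rewrite mul0r add0r mulr1.
apply: (is_derive_eq (derM d2 (derM dw dw))).
by rewrite /lorentz; field; exact: sqr1_neq0.
Qed.

Lemma lorentz2_bd (x : R) : `|(6 * x ^+ 2 - 2) * lorentz x ^+ 3| <= 6 * lorentz x.
Proof.
have w0 := lorentz_gt0 x.
rewrite normrM (ger0_norm (exprn_ge0 3 (ltW w0))).
rewrite (_ : lorentz x ^+ 3 = lorentz x ^+ 2 * lorentz x); last by ring.
rewrite [leLHS]mulrA; apply: ler_wpM2r; first exact: ltW.
rewrite /lorentz exprVn ler_pdivrMr ?exprn_gt0 ?sqr1_gt0 //.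
rewrite ler_norml; have := sqr_ge0 x; have := sqr_ge0 (x ^+ 2).
by move=> h1 h2; apply/andP; split; lra.
Qed.

Lemma lorentz_bd6 (x : R) : `|lorentz x| <= 6 * lorentz x.
Proof. by have := lorentz_gt0 x => w0; rewrite ger0_norm ?ltW //; lra. Qed.

(** Partial fractions in the lag variable, with denominators [1 + (y + x)^2]
    and [1 + (y - x)^2]: the logarithmic part of the antiderivative vanishes at
    both ends and only the arctangents contribute. *)
Lemma halfLap_lorentz : halfLap lorentz =1 @dxlorentz R.
Proof.
move=> x; set a := 1 + x ^+ 2.
have a0 : a != 0 := sqr1_neq0 x.
pose q (y : R) := 2 * (y ^+ 2 + 1 - 3 * x ^+ 2) * (lorentz (y + x) * lorentz (y - x)) / a.
pose B := (1 - x ^+ 2) / (2 * a).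
pose Q (y : R) := 2 / a * (- (x / a) / 2 *
   (ln (1 + (y + x) ^+ 2) - ln (1 + (y - x) ^+ 2)) + B * (atan (y + x) + atan (y - x))).
have iK := integ_sdq der_lorentz der2_lorentz lorentz_bd6 lorentz2_bd x.
have [iq Iq] : integ q /\ Int q = Int (sdq lorentz x).
  apply: (Int_eq_off (c := 0) iK) => y y0.
  rewrite /sdq /q /a /lorentz; field.
  by rewrite y0 !sqr1_neq0.
have dQ : Der Q q.
  move=> y.
  have e1 (c : R) : is_derive y 1 (fun y : R => y + c) 1.
    by apply: (is_derive_eq (derD (der_id y) (der_cst c y))); rewrite addr0.
  have l (c : R) : is_derive y 1 (fun y : R => ln (1 + (y + c) ^+ 2)) (lorentz (y + c) * (2 * (y + c))).
    have h := @der_comp _ (fun z => 1 + z ^+ 2) (fun y => y + c) y _ _ (der_sqr1 (y + c)) (e1 c).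
    have g := is_derive1_ln (sqr1_gt0 (y + c)).
    have := @der_comp _ (@ln R) (fun y => 1 + (y + c) ^+ 2) y _ _ g h.
    by rewrite mulr1.
  have t (c : R) : is_derive y 1 (fun y : R => atan (y + c)) (lorentz (y + c)).
    have := @der_comp _ (@atan R) (fun y => y + c) y _ _ (is_derive1_atan (y + c)) (e1 c).
    by rewrite mulr1.
  apply: (is_derive_eq (derM (der_cst (2 / a) y)
    (derD (derM (der_cst (- (x / a) / 2) y) (derB (l x) (l (- x))))
          (derM (der_cst B y) (derD (t x) (t (- x))))))).
  rewrite /q /B /a /lorentz; field.
  by rewrite !sqr1_neq0.
have cq : continuous q.
  have cs (c : R) : continuous (fun y : R => lorentz (y + c)).
    move=> y; apply: (@continuous_comp _ _ _ (fun y => y + c) lorentz); last exact: lorentz_cont.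
    by apply: cvgD; [exact: cvg_id|exact: cvg_cst].
  move=> y; apply: cvgM; last exact: cvg_cst.
  apply: cvgM; last by apply: cvgM; exact: cs.
  apply: cvgM; first exact: cvg_cst.
  apply: cvgB; last exact: cvg_cst.
  by apply: cvgD; [exact: exprn_continuous|exact: cvg_cst].
have Qp : Q y @[y --> +oo] --> 2 / a * (- (x / a) / 2 * 0 + B * (pi / 2 + pi / 2)).
  apply: cvgM; first exact: cvg_cst.
  apply: cvgD; first by apply: cvgM; [exact: cvg_cst|exact: cvg_ln_ratio].
  apply: cvgM; first exact: cvg_cst.
  by apply: cvgD; apply: (cvg_comp _ _ (cvg_shift_pinfty _)); exact: cvgy_atan.
have Qm : Q y @[y --> -oo] --> - (2 / a * (- (x / a) / 2 * 0 + B * (pi / 2 + pi / 2))).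
  apply/cvgNy_compNP.
  have -> : Q \o -%R = (fun y => - Q y).
    apply/funext => y; rewrite /= /Q.
    have -> : - y + x = - (y - x) by ring.
    have -> : - y - x = - (y + x) by ring.
    by rewrite !atanN !sqrrN; ring.
  exact: cvgN Qp.
rewrite /halfLap -Iq (FTC_line cq dQ iq Qp Qm) /dxlorentz -/a /B.
have fin (b p : R) : b != 0 -> p != 0 -> (2 * p)^-1 *
    (2 / b * (- (x / b) / 2 * 0 + (1 - x ^+ 2) / (2 * b) * (p / 2 + p / 2)) -
     - (2 / b * (- (x / b) / 2 * 0 + (1 - x ^+ 2) / (2 * b) * (p / 2 + p / 2)))) =
    (1 - x ^+ 2) / b ^+ 2.
  by move=> b0 p0; field; rewrite b0 p0.
by apply: fin => //; rewrite gt_eqF // pi_gt0.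
Qed.

End nonlocal.

(** * Test functions *)
Section smooth_functions.
Context {R : realType}.
Implicit Types f g h : R -> R.

(** Derivatives are carried as witnesses rather than computed, so that the
    rules for products and compositions apply by plain induction. *)
Fixpoint Ck (n : nat) f : Prop :=
  match n with
  | 0 => continuous f
  | n'.+1 => exists g, Der f g /\ Ck n' g
  end.

Lemma Ck_cont n f : Ck n f -> continuous f.
Proof. by case: n => //= n [g [d _]]; exact: Der_cont d. Qed.

Lemma CkS n f : Ck n.+1 f -> Ck n f.
Proof.
elim: n f => [|n IH] f; first exact: (@Ck_cont 1).
by move=> [g [d c]]; exists g; split => //; exact: IH.
Qed.

Lemma Ck_cst n (c : R) : Ck n (fun=> c).
Proof.
elim: n c => [|n IH] c /=; first by move=> x; exact: cvg_cst.
by exists (fun=> 0); split => // x; exact: der_cst.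
Qed.

Lemma CkD n f g : Ck n f -> Ck n g -> Ck n (fun x => f x + g x).
Proof.
elim: n f g => [|n IH] f g /=; first by move=> cf cg x; apply: cvgD; [exact: cf|exact: cg].
move=> [f' [df cf]] [g' [dg cg]]; exists (fun x => f' x + g' x); split; last exact: IH.
by move=> x; exact: derD.
Qed.

Lemma CkM n f g : Ck n f -> Ck n g -> Ck n (fun x => f x * g x).
Proof.
elim: n f g => [|n IH] f g; first by move=> cf cg x; apply: cvgM; [exact: cf|exact: cg].
move=> cf cg; move: (cf) (cg) => [f' [df cf']] [g' [dg cg']].
exists (fun x => f' x * g x + f x * g' x); split.
  by move=> x; exact: derM.
by apply: CkD; apply: IH => //; exact: CkS.
Qed.

Lemma Ck_id n : Ck n (fun x : R => x).
Proof.
case: n => [|n]; first by move=> x; exact: cvg_id.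
by exists (fun=> 1); split; [move=> x; exact: der_id|exact: Ck_cst].
Qed.

Lemma Ck_affine n f (a b : R) : Ck n f -> Ck n (fun x => f (a * x + b)).
Proof.
have da (x : R) : is_derive x 1 (fun x : R => a * x + b) a.
  apply: (is_derive_eq (derD (derM (der_cst a x) (der_id x)) (der_cst b x))).
  by rewrite mul0r add0r mulr1 addr0.
elim: n f => [|n IH] f /=.
  move=> cf x; apply: (@continuous_comp _ _ _ (fun x => a * x + b) f); last exact: cf.
  by apply: (Der_cont (g := fun=> a)) => y; exact: da.
move=> [f' [df cf]]; exists (fun x => f' (a * x + b) * a); split.
  by move=> x; exact: (@der_comp _ f (fun x => a * x + b) x _ _ (df _) (da x)).
by apply: CkM; [exact: IH|exact: Ck_cst].
Qed.

Lemma Ck_lorentz n : Ck n (@lorentz R).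
Proof.
elim: n => [|n IH]; first exact: lorentz_cont.
exists (fun x => - (2 * x) * lorentz x ^+ 2); split; first exact: der_lorentz.
have -> : (fun x : R => - (2 * x) * lorentz x ^+ 2) = (fun x => (-2 * x) * (lorentz x * lorentz x)).
  by apply/funext => x; ring.
by apply: CkM; [apply: CkM; [exact: Ck_cst|exact: Ck_id]|exact: CkM].
Qed.

Lemma Der_uniq f g h : Der f g -> Der f h -> g = h.
Proof. by move=> d1 d2; apply/funext => x; have [_ <-] := d1 x; have [_ <-] := d2 x. Qed.

Lemma Der_deriveE f g (v x : R) : Der f g -> derivable f x v /\ 'D_v f x = v * g x.
Proof.
move=> d; have [df gE] := d x.
have dif : differentiable f x by apply/derivable1_diffP.
split; first exact: diff_derivable.
by rewrite deriveE // -{1}(mulr1 v) linearZ /= -deriveE // gE.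
Qed.

Lemma Ck_Cn n f : Ck n f -> Cn n f.
Proof.
elim: n f => [|n IH] f //= => -[g [d c]]; split; first exact: Der_cont d.
move=> v; split; first by move=> x; exact: (Der_deriveE v x d).1.
have -> : (fun x : R => 'D_v f x) = (fun x => v * g x).
  by apply/funext => x; exact: (Der_deriveE v x d).2.
by apply: IH; apply: CkM => //; exact: Ck_cst.
Qed.

(** Covers the point where a function is glued to zero: a bound by the square
    of the distance is all that is known there. *)
Lemma is_derive_quad f (x l C : R) :
  (forall h : R, `|f (x + h) - f x - l * h| <= C * h ^+ 2) -> is_derive x 1 f l.
Proof.
move=> H.
have C0 : 0 <= C by have := le_trans (normr_ge0 _) (H 1); rewrite expr1n mulr1.
have cv : h^-1 *: ((f \o shift x) (h *: (1 : R)) - f x) @[h --> 0^'] --> l.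
  apply/cvgrPdist_le => e e0; near=> h.
  have h0 : h != 0 by near: h; exact: nbhs_dnbhs_neq.
  have hn : 0 < `|h| by rewrite normr_gt0.
  rewrite /= /GRing.scale /= mulr1 (addrC h x).
  rewrite (_ : l - _ = - (h^-1 * (f (x + h) - f x - l * h))); last by field.
  rewrite normrN normrM normfV ler_pdivrMl //.
  apply: (le_trans (H h)); rewrite -(real_normK (num_real h)) expr2 mulrA mulrC ler_pM2l //.
  rewrite (@le_trans _ _ ((C + 1) * `|h|)) ?ler_wpM2r ?lerDl //.
  rewrite mulrC -ler_pdivlMr ?ltr_wpDl //.
  near: h; apply: dnbhs0_le; rewrite divr_gt0 // ltr_wpDl //.
apply: DeriveDef; first by apply/cvg_ex; exists l.
exact: cvg_lim cv.
Unshelve. all: by end_near. Qed.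

(** The family [x^(-m) exp(-1/x)], extended by zero, is stable under
    differentiation up to linear combinations; this is why all its members are
    smooth. *)
Definition flat_exp (m : nat) (x : R) : R := if 0 < x then x^-1 ^+ m * expR (- x^-1) else 0.

Lemma flat_exp_ge0 m x : 0 <= flat_exp m x.
Proof.
rewrite /flat_exp; case: ifP => // x0.
by rewrite mulr_ge0 ?expR_ge0 // exprn_ge0 // invr_ge0 ltW.
Qed.

Lemma flat_exp_quad m : exists C : R, forall x, flat_exp m x <= C * x ^+ 2.
Proof.
exists ((m.+2)`!%:R) => x; rewrite /flat_exp; case: ifP => x0; last by rewrite mulr_ge0 ?sqr_ge0.
have y0 : 0 < x^-1 by rewrite invr_gt0.
have F0 : 0 < (m.+2)`!%:R :> R by rewrite ltr0n fact_gt0.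
have h := expR_ge1Dxn m.+1 (ltW y0).
have h2 : x^-1 ^+ m.+2 / (m.+2)`!%:R <= expR x^-1 by apply: le_trans h; rewrite lerDr.
rewrite expRN ler_pdivrMr ?expR_gt0 //.
apply: (@le_trans _ _ ((m.+2)`!%:R * x ^+ 2 * (x^-1 ^+ m.+2 / (m.+2)`!%:R))); last first.
  by rewrite ler_wpM2l // mulr_ge0 ?sqr_ge0 // ltW.
rewrite !exprS expr0 mulr1 le_eqVlt; apply/orP; left; apply/eqP.
by field; rewrite !gt_eqF.
Qed.

Lemma Der_flat_exp m : Der (flat_exp m) (fun x => flat_exp m.+2 x - m%:R * flat_exp m.+1 x).
Proof.
move=> x; have [x0|x0|->] := ltgtP x 0.
- rewrite /flat_exp !ltNge (ltW x0) /= mulr0 subr0.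
  apply: (near_eq_is_derive _ (der_cst 0 x)).
  near=> y; rewrite ifF //; apply/negbTE; rewrite -leNgt ltW //.
  by near: y; exact: lt_nbhsl.
- rewrite /flat_exp x0.
  have xn : x != 0 by rewrite gt_eqF.
  have dV : is_derive x 1 (fun y : R => y^-1) (- x^-1 ^+ 2).
    by apply: (is_derive_eq (derV xn (der_id x))); field.
  have dX : is_derive x 1 (fun y : R => y^-1 ^+ m) (- m%:R * x^-1 ^+ m.+1).
    elim: (m) => [|k IH].
      by apply: (is_derive_eq (der_cst 1 x)); rewrite oppr0 mul0r.
    have -> : (fun y : R => y^-1 ^+ k.+1) = (fun y => y^-1 * y^-1 ^+ k).
      by apply/funext => y; rewrite exprS.
    apply: (is_derive_eq (derM dV IH)).
    by rewrite -natr1 !exprS; ring.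
  have dE : is_derive x 1 (fun y : R => expR (- y^-1)) (expR (- x^-1) * x^-1 ^+ 2).
    have := @der_comp _ (@expR R) (fun y => - y^-1) x _ _ (is_derive_expR _) (derN dV).
    by rewrite opprK.
  have dP : is_derive x 1 (fun y : R => y^-1 ^+ m * expR (- y^-1))
      (x^-1 ^+ m.+2 * expR (- x^-1) - m%:R * (x^-1 ^+ m.+1 * expR (- x^-1))).
    by apply: (is_derive_eq (derM dX dE)); rewrite !exprS; ring.
  apply: (near_eq_is_derive _ dP).
  near=> y; rewrite ifT //.
  by near: y; exact: lt_nbhsr.
- have e0 k : flat_exp k 0 = 0 by rewrite /flat_exp ltxx.
  rewrite !e0 mulr0 subr0.
  have [C hC] := flat_exp_quad m.
  apply: (is_derive_quad (C := C)) => h.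
  by rewrite e0 add0r mul0r !subr0 ger0_norm ?flat_exp_ge0.
Unshelve. all: by end_near. Qed.

Lemma Ck_flat_exp n m : Ck n (flat_exp m).
Proof.
elim: n m => [|n IH] m; first exact: Der_cont (@Der_flat_exp m).
exists (fun x => flat_exp m.+2 x - m%:R * flat_exp m.+1 x); split; first exact: Der_flat_exp.
have -> : (fun x => flat_exp m.+2 x - m%:R * flat_exp m.+1 x) =
    (fun x => flat_exp m.+2 x + (- m%:R) * flat_exp m.+1 x).
  by apply/funext => x; rewrite mulNr.
by apply: CkD => //; apply: CkM => //; exact: Ck_cst.
Qed.

(** A form of [test_line] with explicit derivatives and an explicit support. *)
Definition testfun f : Prop :=
  (forall n, Ck n f) /\ exists K : R, forall x : R, K < `|x| -> f x = 0.

Definition bump (x : R) : R := flat_exp 0 (1 * x + 1) * flat_exp 0 (-1 * x + 1).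

Lemma bump_ge0 x : 0 <= bump x.
Proof. by rewrite mulr_ge0 // flat_exp_ge0. Qed.

Lemma flat_exp0_gt0 x : 0 < x -> 0 < flat_exp 0 x.
Proof. by move=> x0; rewrite /flat_exp x0 mul1r expR_gt0. Qed.

Lemma flat_exp0_le1 x : flat_exp 0 x <= 1.
Proof.
rewrite /flat_exp; case: ifP => // x0.
by rewrite mul1r expR_le1 oppr_le0 invr_ge0 ltW.
Qed.

Lemma bump_le1 x : bump x <= 1.
Proof. by rewrite mulr_ile1 ?flat_exp_ge0 ?flat_exp0_le1. Qed.

Lemma bump_gt0 x : -1 < x < 1 -> 0 < bump x.
Proof. by move=> /andP[h1 h2]; rewrite mulr_gt0 // flat_exp0_gt0 //; lra. Qed.

Lemma bump_eq0 x : 1 <= `|x| -> bump x = 0.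
Proof.
rewrite ler_normr /bump => /orP[h|h].
  by rewrite {2}/flat_exp ifF ?mulr0 //; apply/negbTE; rewrite -leNgt; lra.
by rewrite {1}/flat_exp ifF ?mul0r //; apply/negbTE; rewrite -leNgt; lra.
Qed.

Lemma testfun_bump : testfun bump.
Proof.
split; first by move=> n; apply: CkM; exact: Ck_affine (Ck_flat_exp n 0).
by exists 1 => x h; apply: bump_eq0; exact: ltW.
Qed.

Lemma testfun_mul f g : testfun f -> (forall n, Ck n g) -> testfun (fun x => f x * g x).
Proof.
move=> [cf [K hK]] cg; split; first by move=> n; exact: CkM.
by exists K => x hx; rewrite hK // mul0r.
Qed.

Lemma testfun_affine f (a b : R) : a != 0 -> testfun f -> testfun (fun x => f (a * x + b)).
Proof.
move=> a0 [cf [K hK]]; split; first by move=> n; exact: Ck_affine.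
exists ((K + `|b|) / `|a|) => x; rewrite ltr_pdivrMr ?normr_gt0 // => hx; apply: hK.
have := ler_normB (a * x + b) b; rewrite addrK normrM mulrC; lra.
Qed.

Lemma testfun_test_line f : testfun f -> test_line f.
Proof.
move=> [cf [K hK]]; split; first by move=> n; exact: Ck_Cn.
apply: (@subclosed_compact _ _ `[- K, K]); [exact: closed_closure|exact: segment_compact|].
have -> : `[- K, K]%classic = closure `[- K, K]%classic.
  by apply/closure_id; exact: interval_closed.
apply: closureS => x /= fx; rewrite in_itv /= -ler_norml leNgt.
by apply: contra fx => /hK ->.
Qed.

Lemma testfun_der f : testfun f -> exists g, Der f g /\ testfun g.
Proof.
move=> [cf [K hK]].
have [g [d _]] := cf 1%N.
exists g; split => //; split.
  move=> n; have [g' [d' c']] := cf n.+1.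
  by rewrite (Der_uniq d d').
exists K => x hx; have [_ <-] := d x.
have -> : 0 = 'D_1 (fun _ : R => 0 : R) x by rewrite derive_cst.
apply: near_eq_derive; near=> y; apply: hK; near: y.
have : (fun y : R => `|y|) @ x --> `|x| by apply: cvg_norm; exact: cvg_id.
by move/cvgr_gt; apply.
Unshelve. all: by end_near. Qed.

Lemma testfun_bd f : testfun f -> exists B : R, forall x : R, `|f x| <= B.
Proof.
move=> [cf [K hK]].
have K0 : - `|K| <= `|K| by rewrite ge0_cp.
have cn : {within `[- `|K|, `|K|], continuous (fun x => `|f x|)}.
  apply: continuous_subspaceT => x; apply: cvg_norm; exact: (cf 0%N).
have [c _ hc] := EVT_max K0 cn.
exists `|f c| => x; have [hx|hx] := leP `|x| `|K|.
  by apply: hc; rewrite in_itv /= -ler_norml.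
by rewrite hK ?normr0 // (le_lt_trans (ler_norm K)).
Qed.

Lemma testfun_lorentz f : testfun f -> exists M : R, forall x : R, `|f x| <= M * lorentz x.
Proof.
move=> tf; have [B hB] := testfun_bd tf; move: tf => [cf [K hK]].
have B0 : 0 <= B by exact: le_trans (normr_ge0 _) (hB 0).
exists (B * (1 + K ^+ 2)) => x; have [hx|hx] := leP `|x| K; last first.
  by rewrite hK // normr0 !mulr_ge0 ?addr_ge0 ?sqr_ge0 // ltW // lorentz_gt0.
apply: (le_trans (hB x)); rewrite -mulrA ler_peMr //.
rewrite /lorentz ler_pdivlMr ?sqr1_gt0 // mul1r lerD2l.
rewrite -(real_normK (num_real x)) lerXn2r // nnegrE //.
exact: le_trans hx.
Qed.

Lemma testfun_integ f : testfun f -> integ f.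
Proof.
move=> tf; have [M hM] := testfun_lorentz tf.
by apply: (le_integ _ (integZ M (@integ_lorentz R)) hM); apply: cont_mfun; exact: (tf.1 0%N).
Qed.

End smooth_functions.

(** * The Fourier multiplier is the singular integral *)
Section fourier_side.
Context {R : realType}.
Implicit Types f g h F : R -> R.
Local Notation harm := (@harmonic R).

Lemma cvg0_bounded {T : Type} (FF : set_system T) {FFF : Filter FF} (u v : T -> R) (B : R) :
  u x @[x --> FF] --> 0 -> (forall x, `|v x| <= B) -> u x * v x @[x --> FF] --> 0.
Proof.
move=> u0 vB.
have u0B : `|u x| * B @[x --> FF] --> 0.
  by rewrite -(mul0r B); apply: cvgM; [rewrite -(@normr0 _ R); exact: cvg_norm|exact: cvg_cst].
apply/norm_cvg0P; apply: (@squeeze_cvgr _ _ _ _ (fun=> 0) (fun x => `|u x| * B)) => //.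
- by near=> x; rewrite normr_ge0 normrM ler_wpM2l.
- exact: cvg_cst.
Unshelve. all: by end_near. Qed.

Definition cosT F (k : R) : R := Int (fun z => F z * cos (k * z)).

Lemma cos_mfun (k : R) : mfun (fun z : R => cos (k * z)).
Proof.
apply: mfun_comp; first exact: cont_mfun (@continuous_cos R).
by apply: mfunM; [exact: mfun_cst|exact: measurable_id].
Qed.

Lemma integ_cos F k : integ F -> integ (fun z => F z * cos (k * z)).
Proof.
move=> iF; apply: (@eq_integ _ (fun z => cos (k * z) * F z)).
  by move=> z; rewrite mulrC.
by apply: (@integ_bdM _ 1) => //; [exact: cos_mfun|move=> z; exact: cos_max].
Qed.

Lemma cosT_bd F k : integ F -> `|cosT F k| <= Int (fun z => `|F z|).
Proof.
move=> iF; apply: le_norm_Int; [exact: integ_cos|exact: integ_norm|].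
by move=> z; rewrite normrM ler_piMr // cos_max.
Qed.

Lemma cosT_ibp F F1 F2 k : testfun F -> Der F F1 -> testfun F1 -> Der F1 F2 -> testfun F2 ->
  k ^+ 2 * cosT F k = - cosT F2 k.
Proof.
move=> tF d1 tF1 d2 tF2.
have ds (z : R) : is_derive z 1 (fun z : R => sin (k * z)) (k * cos (k * z)).
  have e : is_derive z 1 (fun z : R => k * z) k.
    by apply: (is_derive_eq (derM (der_cst k z) (der_id z))); rewrite mul0r add0r mulr1.
  have := @der_comp _ (@sin R) (fun z => k * z) z _ _ (is_derive_sin _) e.
  by rewrite mulrC.
have dc (z : R) : is_derive z 1 (fun z : R => cos (k * z)) (- (k * sin (k * z))).
  have e : is_derive z 1 (fun z : R => k * z) k.
    by apply: (is_derive_eq (derM (der_cst k z) (der_id z))); rewrite mul0r add0r mulr1.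
  have := @der_comp _ (@cos R) (fun z => k * z) z _ _ (is_derive_cos _) e.
  by rewrite mulrC mulrN.
pose G z := F1 z * cos (k * z) + k * (F z * sin (k * z)).
pose g z := F2 z * cos (k * z) + k ^+ 2 * (F z * cos (k * z)).
have dG : Der G g.
  move=> z; apply: (is_derive_eq (derD (derM (d2 z) (dc z))
    (derM (der_cst k z) (derM (d1 z) (ds z))))).
  by rewrite /g; ring.
have cc : continuous (fun z : R => cos (k * z)).
  by apply: (Der_cont (g := fun z => - (k * sin (k * z)))) => z; exact: dc.
have cg : continuous g.
  move=> z; apply: cvgD; first by apply: cvgM; [exact: (tF2.1 0%N)|exact: cc].
  by apply: cvgM; [exact: cvg_cst|apply: cvgM; [exact: (tF.1 0%N)|exact: cc]].
have i2 := integ_cos k (testfun_integ tF2).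
have i0 := integZ (k ^+ 2) (integ_cos k (testfun_integ tF)).
have ig : integ g := integD i2 i0.
have [K1 h1] := tF1.2; have [K0 h0] := tF.2.
have G0 z : K1 < `|z| -> K0 < `|z| -> G z = 0.
  by move=> z1 z0; rewrite /G h1 // h0 // !mul0r mulr0 addr0.
have Gp : G z @[z --> +oo] --> 0.
  apply: cvg_near_cst; near=> z; apply: G0.
    by apply: lt_le_trans (ler_norm z); near: z; apply: nbhs_pinfty_gt; rewrite num_real.
  by apply: lt_le_trans (ler_norm z); near: z; apply: nbhs_pinfty_gt; rewrite num_real.
have Gm : G z @[z --> -oo] --> 0.
  apply: cvg_near_cst; near=> z; apply: G0; rewrite -normrN.
    apply: lt_le_trans (ler_norm (- z)); rewrite ltrNr.
    by near: z; apply: nbhs_ninfty_lt; rewrite num_real.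
  apply: lt_le_trans (ler_norm (- z)); rewrite ltrNr.
  by near: z; apply: nbhs_ninfty_lt; rewrite num_real.
have := FTC_line cg dG ig Gp Gm.
rewrite subrr /g (IntD i2 i0) IntZ; last exact: integ_cos (testfun_integ tF).
by rewrite -/(cosT F2 k) -/(cosT F k) addrC => /eqP; rewrite addr_eq0 => /eqP.
Unshelve. all: by end_near. Qed.

(** Four derivatives give a decay like [k^(-4)], which survives the
    multiplication by [|k|] with enough to spare for integrability. *)
Lemma cosT_decay F : testfun F -> exists B : R, forall k, `| `|k| * cosT F k| <= B * lorentz k.
Proof.
move=> tF.
have [F1 [d1 t1]] := testfun_der tF; have [F2 [d2 t2]] := testfun_der t1.
have [F3 [d3 t3]] := testfun_der t2; have [F4 [d4 t4]] := testfun_der t3.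
pose B0 := Int (fun z => `|F z|); pose B4 := Int (fun z => `|F4 z|).
exists (2 * (B0 + B4)) => k.
have b0 := cosT_bd k (testfun_integ tF); rewrite -/B0 in b0.
have b4 := cosT_bd k (testfun_integ t4); rewrite -/B4 in b4.
have e : k ^+ 4 * cosT F k = cosT F4 k.
  have := cosT_ibp k tF d1 t1 d2 t2; have := cosT_ibp k t2 d3 t3 d4 t4.
  move=> e2 e1; rewrite (_ : k ^+ 4 = k ^+ 2 * k ^+ 2); last by ring.
  by rewrite -mulrA e1 mulrN e2 opprK.
rewrite -e normrM normrX in b4.
rewrite normrM normr_id /lorentz ler_pdivlMr ?sqr1_gt0 // -(real_normK (num_real k)).
have := normr_ge0 k; have := normr_ge0 (cosT F k).
move: b0 b4; set c := `|cosT F k|; set a := `|k| => b0 b4 c0 a0.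
have p : a * (1 + a ^+ 2) <= 2 * (1 + a ^+ 4).
  have := sqr_ge0 (a - 1); have := sqr_ge0 (a ^+ 2 - a); have := sqr_ge0 (a ^+ 2 - 1).
  rewrite (_ : a ^+ 4 = a ^+ 2 * a ^+ 2); last by ring.
  nra.
have : a * (1 + a ^+ 2) * c <= 2 * (1 + a ^+ 4) * c by rewrite ler_wpM2r.
lra.
Qed.

Lemma cosT_mfun F : integ F -> mfun (cosT F).
Proof.
move=> iF.
pose K (k z : R) := lorentz k * (F z * cos (k * z)).
have mx := @mfun2_l R _ (@measurable_id _ _ setT : mfun (fun x => x)).
have my := @mfun2_r R _ (@measurable_id _ _ setT : mfun (fun x => x)).
have mK : mfun2 K.
  apply: mfun2M; first exact: mfun2_l lorentz_mfun.
  apply: mfun2M; first exact: mfun2_r (integ_mfun iF).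
  exact: mfun2_comp (cont_mfun (@continuous_cos R)) (mfun2M mx my).
have bK k z : `|K k z| <= lorentz k * `|F z|.
  rewrite /K !normrM (gtr0_norm (lorentz_gt0 k)); apply: ler_wpM2l; first exact/ltW/lorentz_gt0.
  by rewrite ler_piMr // cos_max.
have [iK _] := Int_fubini mK (@integ_lorentz R) (integ_norm iF) bK.
have -> : cosT F = (fun k => (lorentz k)^-1 * Int (K k)).
  apply/funext => k; rewrite /K IntZ; last exact: integ_cos.
  by rewrite mulKf // gt_eqF // lorentz_gt0.
apply: mfunM; last exact: integ_mfun iK.
exact: mfun_comp mfun_inv lorentz_mfun.
Qed.

Lemma abel_bd (d k : R) : 0 < d -> 0 <= k ->
  k * expR (- (d * k)) <= (d^-1 + 6 / d ^+ 3) * lorentz k.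
Proof.
move=> d0 k0; set t := d * k.
have t0 : 0 <= t by rewrite mulr_ge0 // ltW.
have E0 := expR_gt0 t.
have e1 : t <= expR t by apply: le_trans (expR_ge1Dx t); rewrite lerDr.
have e3 : t ^+ 3 / 6 <= expR t.
  have := expR_ge1Dxn 2 t0; have -> : 3`! = 6%N by [].
  by apply: le_trans; rewrite lerDr.
rewrite expRN /lorentz ler_pdivrMr // mulrAC ler_pdivlMr ?sqr1_gt0 //.
have -> : k * (1 + k ^+ 2) = d^-1 * t + 6 / d ^+ 3 * (t ^+ 3 / 6).
  by rewrite /t; field; rewrite gt_eqF.
have a1 : d^-1 * t <= d^-1 * expR t by rewrite ler_wpM2l // invr_ge0 ltW.
have a2 : 6 / d ^+ 3 * (t ^+ 3 / 6) <= 6 / d ^+ 3 * expR t.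
  by rewrite ler_wpM2l // divr_ge0 // exprn_ge0 // ltW.
lra.
Qed.

(** The multiplier [|k|] with Abel damping. *)
Definition abel (d k : R) : R := `|k| * expR (- (d * `|k|)).

Lemma abel_mfun d : mfun (abel d).
Proof.
have mn : mfun (fun k : R => `|k|) by exact: cont_mfun (@norm_continuous _ _).
apply: mfunM => //; apply: mfun_comp; first exact: cont_mfun (@continuous_expR R).
apply: (@mfun_comp _ (fun z : R => - z)); first exact: oppr_measurable.
by apply: mfunM => //; exact: mfun_cst.
Qed.

Lemma abel_le d k : 0 < d -> `|abel d k| <= (d^-1 + 6 / d ^+ 3) * lorentz k.
Proof.
move=> d0; rewrite /abel ger0_norm ?mulr_ge0 ?expR_ge0 //.
by have := abel_bd d0 (normr_ge0 k); rewrite /lorentz real_normK ?num_real.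
Qed.

Lemma integ_abel d : 0 < d -> integ (abel d).
Proof.
move=> d0; apply: (le_integ (abel_mfun d) (integZ (d^-1 + 6 / d ^+ 3) (@integ_lorentz R))).
by move=> k; exact: abel_le.
Qed.

(** Minus the derivative in [d] of the Poisson kernel [d / (d^2 + z^2)]. *)
Definition dpoisson (d z : R) : R := (d ^+ 2 - z ^+ 2) / (d ^+ 2 + z ^+ 2) ^+ 2.

Let half_abel (d z : R) : 0 < d ->
  Int (fun k => (0 <= k)%R%:R * (k * expR (- (d * k)) * cos (k * z))) = dpoisson d z.
Proof.
move=> d0; set c := d ^+ 2 + z ^+ 2.
have c0 : c != 0 by rewrite gt_eqF // ltr_wpDr ?sqr_ge0 // exprn_gt0.
pose g k := k * expR (- (d * k)) * cos (k * z).
(* [exp(-d k) P k] is an antiderivative of [exp(-d k) cos(k z)], and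
   [exp(-d k) Q k] one of [- exp(-d k) P k]: [G] comes from integrating [g] by
   parts *)
pose P k := (z * sin (k * z) - d * cos (k * z)) / c.
pose Q k := (2 * d * z * sin (k * z) + (z ^+ 2 - d ^+ 2) * cos (k * z)) / c ^+ 2.
pose G k := expR (- (d * k)) * (k * P k + Q k).
have dl1 (b k : R) : is_derive k 1 (fun k : R => b * k) b.
  by apply: (is_derive_eq (derM (der_cst b k) (der_id k))); rewrite mul0r add0r mulr1.
have dr1 (k : R) : is_derive k 1 (fun k : R => k * z) z.
  by apply: (is_derive_eq (derM (der_id k) (der_cst z k))); rewrite mulr0 addr0 mul1r.
have dE (k : R) : is_derive k 1 (fun k : R => expR (- (d * k))) (- d * expR (- (d * k))).
  have := @der_comp _ (@expR R) (fun k => - (d * k)) k _ _ (is_derive_expR _) (derN (dl1 d k)).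
  by rewrite mulrC.
have ds (k : R) : is_derive k 1 (fun k : R => sin (k * z)) (cos (k * z) * z).
  exact: (@der_comp _ (@sin R) (fun k => k * z) k _ _ (is_derive_sin _) (dr1 k)).
have dc (k : R) : is_derive k 1 (fun k : R => cos (k * z)) (- sin (k * z) * z).
  exact: (@der_comp _ (@cos R) (fun k => k * z) k _ _ (is_derive_cos _) (dr1 k)).
have dG : Der G g.
  move=> k.
  have dP := derM (derB (derM (der_cst z k) (ds k)) (derM (der_cst d k) (dc k))) (der_cst c^-1 k).
  have dQ := derM (derD (derM (der_cst (2 * d * z) k) (ds k))
    (derM (der_cst (z ^+ 2 - d ^+ 2) k) (dc k))) (der_cst (c ^+ 2)^-1 k).
  apply: (is_derive_eq (derM (dE k) (derD (derM (der_id k) dP) dQ))).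
  rewrite /g /P /Q; move: (sin (k * z)) (cos (k * z)) (expR (- (d * k))) => s1 c1 e1.
  by rewrite /c in c0 *; field.
have cE : continuous (fun k : R => expR (- (d * k))).
  by apply: (Der_cont (g := fun k => - d * expR (- (d * k)))) => y; exact: dE.
have cg : continuous g.
  move=> k; apply: cvgM; last
      by apply: (Der_cont (g := fun k => - sin (k * z) * z)) => y; exact: dc.
  by apply: cvgM; [exact: cvg_id|exact: cE].
have mfk : mfun (fun k : R => cos (k * z)).
  by apply: cont_mfun; apply: (Der_cont (g := fun k => - sin (k * z) * z)) => y; exact: dc.
have ig : integ (fun k => (0 <= k)%R%:R * g k).
  apply: (@le_integ _ _ (fun k => (d^-1 + 6 / d ^+ 3) * lorentz k)).
  - by apply: mfunM; [exact: mfun_le|exact: cont_mfun cg].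
  - exact: integZ (@integ_lorentz R).
  - move=> k; case: (leP 0 k) => k0; last first.
      have C0 : 0 <= d^-1 + 6 / d ^+ 3.
        by rewrite addr_ge0 ?invr_ge0 ?divr_ge0 ?exprn_ge0 // ltW.
      by rewrite mul0r normr0 mulr_ge0 // ltW // lorentz_gt0.
    rewrite mul1r /g normrM ger0_norm ?mulr_ge0 ?expR_ge0 //.
    by apply: le_trans (abel_bd d0 k0); rewrite ler_piMr ?mulr_ge0 ?expR_ge0 // cos_max.
have kE : k * expR (- (d * k)) @[k --> +oo] --> 0.
  apply: (@squeeze_cvgr _ _ _ _ (fun=> 0) (fun k => (d^-1 + 6 / d ^+ 3) * lorentz k)).
  - near=> k.
    have k0 : 0 <= k by near: k; apply: nbhs_pinfty_ge; rewrite num_real.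
    by rewrite mulr_ge0 ?expR_ge0 // abel_bd.
  - exact: cvg_cst.
  - by rewrite -(mulr0 (d^-1 + 6 / d ^+ 3)); apply: cvgM;
        [exact: cvg_cst|exact: cvg_lorentz_pinfty].
have E0 : expR (- (d * k)) @[k --> +oo] --> 0.
  apply: (@squeeze_cvgr _ _ _ _ (fun=> 0) (fun k => k * expR (- (d * k)))) => //.
  - near=> k.
    have k1 : 1 <= k by near: k; apply: nbhs_pinfty_ge; rewrite num_real.
    by rewrite expR_ge0 /= ler_peMl // expR_ge0.
  - exact: cvg_cst.
have sc (al be : R) k : `|al * sin (k * z) + be * cos (k * z)| <= `|al| + `|be|.
  apply: (le_trans (ler_normD _ _)); rewrite !normrM.
  by apply: lerD; rewrite ler_piMr // ?sin_max ?cos_max.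
have G0 : G k @[k --> +oo] --> 0.
  have -> : G = (fun k => k * expR (- (d * k)) * P k + expR (- (d * k)) * Q k).
    by apply/funext => k; rewrite /G; ring.
  rewrite -(addr0 0); apply: cvgD.
    apply: (cvg0_bounded (B := (`|z| + `|- d|) * `|c^-1|)) => // k.
    rewrite /P normrM ler_wpM2r // -mulNr; exact: sc.
  apply: (cvg0_bounded (B := (`|2 * d * z| + `|z ^+ 2 - d ^+ 2|) * `|(c ^+ 2)^-1|)) => // k.
  rewrite /Q normrM ler_wpM2r //; exact: sc.
rewrite (FTC_right cg dG ig G0) /G /P /Q /dpoisson -/c.
rewrite mulr0 oppr0 expR0 !mul0r sin0 cos0 mulr0 mulr1 !add0r mul1r.
by rewrite -mulNr opprB.
Unshelve. all: by end_near. Qed.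

(** The damped multiplier has an explicit convolution kernel: up to a constant
    factor, the derivative in [d] of the Poisson kernel. *)
Lemma Int_abel_cos (d z : R) : 0 < d -> Int (fun k => abel d k * cos (k * z)) = 2 * dpoisson d z.
Proof.
move=> d0.
have ih : integ (fun k => abel d k * cos (k * z)).
  apply: (@eq_integ _ (fun k => cos (z * k) * abel d k)).
    by move=> k; rewrite mulrC (mulrC z).
  apply: (@integ_bdM _ 1); [exact: cos_mfun|by move=> k; exact: cos_max|exact: integ_abel].
have b01 (b : bool) : `|b%:R : R| <= 1 by rewrite ger0_norm ?ler0n // lern1 leq_b1.
have ip : integ (fun k => (0 <= k)%R%:R * (abel d k * cos (k * z))).
  by apply: (@integ_bdM _ 1) => //; exact: mfun_le.
have im : integ (fun k => (k <= 0)%R%:R * (abel d k * cos (k * z))).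
  by apply: (@integ_bdM _ 1) => //; exact: mfun_ge.
have Ip : Int (fun k => (0 <= k)%R%:R * (abel d k * cos (k * z))) = dpoisson d z.
  rewrite -(half_abel z d0); apply: eq_Int => k; case: (leP 0 k) => k0; last by rewrite !mul0r.
  by rewrite /abel ger0_norm.
have [_ Im] := Int_opp im.
have Im' : Int (fun k => (k <= 0)%R%:R * (abel d k * cos (k * z))) = dpoisson d z.
  rewrite -Im -Ip; apply: eq_Int => k.
  by rewrite oppr_le0 /abel normrN mulNr cosN.
rewrite (_ : 2 * dpoisson d z = dpoisson d z + dpoisson d z); last by ring.
rewrite -{1}Ip -Im' -(IntD ip im); apply: eq_Int => k.
have [k0|k0|->] := ltgtP k 0; rewrite ?mul0r ?mul1r ?addr0 ?add0r //.
by rewrite /abel normr0 !mul0r addr0.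
Qed.

Lemma dpoisson_scale (d z : R) : 0 < d -> dpoisson d z = d^-1 ^+ 2 * dxlorentz (0 + d^-1 * z).
Proof.
move=> d0; rewrite /dpoisson /dxlorentz add0r; field.
have c0 : 0 < d ^+ 2 + z ^+ 2 by rewrite ltr_wpDr ?sqr_ge0 // exprn_gt0.
by rewrite !gt_eqF.
Qed.

Lemma dpoisson_int (d : R) : 0 < d -> integ (dpoisson d) /\ Int (dpoisson d) = 0.
Proof.
move=> d0; have di : 0 < d^-1 by rewrite invr_gt0.
have [i I] := Int_affine 0 di (@integ_dxlorentz R).
have E z : d^-1 ^+ 2 * dxlorentz (0 + d^-1 * z) = dpoisson d z by rewrite dpoisson_scale.
split; first exact: eq_integ E (integZ _ i).
by rewrite -(eq_Int E) IntZ // I Int_dxlorentz !mulr0.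
Qed.

Lemma dpoissonN d z : dpoisson d (- z) = dpoisson d z. Proof. by rewrite /dpoisson sqrrN. Qed.

(** The factor [- z^2 dpoisson d z] by which the damping modifies the
    kernel [1 / z^2] of [sdq]. *)
Definition damp (d z : R) : R := z ^+ 2 * (z ^+ 2 - d ^+ 2) / (d ^+ 2 + z ^+ 2) ^+ 2.

Lemma damp_le1 (d z : R) : 0 < d -> `|damp d z| <= 1.
Proof.
move=> d0.
have c0 : 0 < d ^+ 2 + z ^+ 2 by rewrite ltr_wpDr ?sqr_ge0 // exprn_gt0.
rewrite /damp normrM normfV (ger0_norm (sqr_ge0 (_ + _))) ler_pdivrMr ?exprn_gt0 // mul1r.
have := sqr_ge0 d; have := sqr_ge0 z.
rewrite ler_norml; move: (z ^+ 2) (d ^+ 2) => a b a0 b0.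
by rewrite !expr2; apply/andP; split; nra.
Qed.

Lemma cvg_damp (z : R) : z != 0 -> damp (harm n) z @[n --> \oo] --> (1 : R).
Proof.
move=> z0.
have d2 : harm n ^+ 2 @[n --> \oo] --> 0.
  by rewrite -(mulr0 0); under eq_fun do rewrite expr2; apply: cvgM; exact: cvg_harmonic.
have -> : nbhs (1 : R) = nbhs (z ^+ 2 * (z ^+ 2 - 0) / ((0 + z ^+ 2) * (0 + z ^+ 2))).
  by congr nbhs; rewrite subr0 add0r divff // mulf_neq0 // expf_neq0.
apply: cvgM; first by apply: cvgM; [exact: cvg_cst|apply: cvgB => //; exact: cvg_cst].
under eq_fun do rewrite expr2.
have c : harm n ^+ 2 + z ^+ 2 @[n --> \oo] --> 0 + z ^+ 2 by apply: cvgD => //; exact: cvg_cst.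
apply: cvgV; last by apply: cvgM.
by rewrite add0r mulf_neq0 // expf_neq0.
Qed.

Lemma damp_mfun d : mfun (damp d).
Proof.
have sq : mfun (fun z : R => z ^+ 2) by exact: cont_mfun (@exprn_continuous _ 2).
apply: mfunM.
  by apply: mfunM => //; apply: mfunB => //; exact: mfun_cst.
apply: (@mfun_comp _ (fun z => z^-1)); first exact: mfun_inv.
apply: (@mfun_comp _ (fun z => z ^+ 2)) => //.
by apply: mfunD => //; exact: mfun_cst.
Qed.

(** Fubini moves the damped multiplier onto its kernel [dpoisson].  This kernel
    has mean zero, so a multiple of the value at [x] can be subtracted, and the
    second difference appears. *)
Lemma Int_abel_cosT f (x d : R) : testfun f -> 0 < d ->
  Int (fun k => abel d k * cosT (fun z => f (x - z)) k) = Int (fun z => damp d z * sdq f x z).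
Proof.
move=> tf d0.
pose F z := f (x - z).
have iF : integ F := (Int_reflect x (testfun_integ tf)).1.
have iFp : integ (fun z => f (x + z)) := (Int_shift x (testfun_integ tf)).1.
pose K (k z : R) := abel d k * (F z * cos (k * z)).
have mx := @mfun2_l R _ (@measurable_id _ _ setT : mfun (fun x => x)).
have my := @mfun2_r R _ (@measurable_id _ _ setT : mfun (fun x => x)).
have mK : mfun2 K.
  apply: mfun2M; first exact: mfun2_l (abel_mfun d).
  apply: mfun2M; first exact: mfun2_r (integ_mfun iF).
  exact: mfun2_comp (cont_mfun (@continuous_cos R)) (mfun2M mx my).
have bK k z : `|K k z| <= `|abel d k| * `|F z|.
  by rewrite /K !normrM ler_wpM2l // ler_piMr // cos_max.
have [_ fub] := Int_fubini mK (integ_norm (integ_abel d0)) (integ_norm iF) bK.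
have ikd := (dpoisson_int d0).1; have Ikd := (dpoisson_int d0).2.
have [Bf hBf] := testfun_bd tf.
have kbd g : (forall z, `|g z| <= Bf) -> mfun g -> integ (fun z => g z * dpoisson d z).
  by move=> hg mg; exact: (@integ_bdM _ Bf).
have iFk : integ (fun z => F z * dpoisson d z)
    by apply: kbd => [z|]; [exact: hBf|exact: integ_mfun].
have [iFk' IFk'] := Int_opp iFk.
have ifk : integ (fun z => f (x + z) * dpoisson d z)
    by apply: kbd => [z|]; [exact: hBf|exact: integ_mfun].
transitivity (Int (fun z => F z * dpoisson d z) + Int (fun z => f (x + z) * dpoisson d z)).
  rewrite (_ : Int _ = Int (fun k => Int (K k))); last first.
    by apply: eq_Int => k; rewrite /K IntZ //; exact: integ_cos.
  rewrite fub (_ : Int _ = Int (fun z => 2 * (F z * dpoisson d z))); last first.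
    apply: eq_Int => z; rewrite /K.
    rewrite (_ : Int _ = Int (fun k => F z * (abel d k * cos (k * z)))); last first.
      by apply: eq_Int => k; ring.
    rewrite IntZ ?(Int_abel_cos z d0); first by ring.
    apply: (@eq_integ _ (fun k => cos (z * k) * abel d k)).
      by move=> k; rewrite mulrC (mulrC z).
    by apply: (@integ_bdM _ 1); [exact: cos_mfun|move=> k; exact: cos_max|exact: integ_abel].
  rewrite IntZ // mulr2n mulrDl mul1r; congr (_ + _).
  by rewrite -IFk'; apply: eq_Int => z; rewrite /F opprK dpoissonN.
rewrite -(IntD iFk ifk).
transitivity (Int (fun z => F z * dpoisson d z + f (x + z) * dpoisson d z - (2 * f x) * dpoisson d z)).
  by rewrite (IntB (integD iFk ifk) (integZ _ ikd)) (IntZ _ ikd) Ikd mulr0 subr0.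
apply: eq_Int => z; rewrite /damp /sdq /dpoisson /F.
have [->|z0] := eqVneq z 0.
  by rewrite subr0 addr0 expr0n /= invr0 !(mulr0, mul0r); ring.
have c0 : d ^+ 2 + z ^+ 2 != 0.
  by apply: lt0r_neq0; exact: ltr_wpDr (sqr_ge0 z) (exprn_gt0 2 d0).
move: (f x) (f (x - z)) (f (x + z)) => a1 a2 a3.
by field; rewrite z0 c0.
Qed.

(** The damping disappears in the limit on both sides: on the left by the decay
    of the transform, on the right because [damp] is bounded by one. *)
Lemma Int_abs_cosT f (x : R) : testfun f ->
  Int (fun k => `|k| * cosT (fun z => f (x - z)) k) = Int (sdq f x).
Proof.
move=> tf; pose F z := f (x - z).
have tF : testfun F.
  have -> : F = (fun z => f (-1 * z + x)) by apply/funext => z; rewrite /F mulN1r addrC.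
  by apply: testfun_affine => //; rewrite oppr_eq0 oner_eq0.
have [B hB] := cosT_decay tF.
have [f1 [d1 t1]] := testfun_der tf; have [f2 [d2 t2]] := testfun_der t1.
have [M0 h0] := testfun_lorentz tf; have [M2 h2] := testfun_lorentz t2.
have le1 (a b : R) z : a * lorentz z <= (`|a| + `|b|) * lorentz z.
  by rewrite ler_wpM2r ?(ltW (lorentz_gt0 z)) // (le_trans (ler_norm a)) // lerDl.
have le2 (a b : R) z : b * lorentz z <= (`|a| + `|b|) * lorentz z by rewrite addrC le1.
have iK : integ (sdq f x).
  exact: (integ_sdq d1 d2 (fun z => le_trans (h0 z) (le1 M0 M2 z))
                           (fun z => le_trans (h2 z) (le2 M0 M2 z))).
have mE (d : R) : mfun (fun k => expR (- (d * `|k|))).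
  apply: mfun_comp; first exact: cont_mfun (@continuous_expR R).
  apply: (@mfun_comp _ (fun z : R => - z)); first exact: oppr_measurable.
  apply: mfunM; first exact: mfun_cst.
  exact: cont_mfun (@norm_continuous _ _).
have mC : mfun (fun k => `|k| * cosT F k).
  apply: mfunM; last exact: cosT_mfun (testfun_integ tF).
  exact: cont_mfun (@norm_continuous _ _).
have [_ L1] : integ (fun k => `|k| * cosT F k) /\
    Int (fun k => expR (- (harm n * `|k|)) * (`|k| * cosT F k)) @[n --> \oo] -->
    Int (fun k => `|k| * cosT F k).
  apply: (@Int_dominated_cvg _ _ _ (fun k => B * lorentz k)).
  - by move=> n; apply: mfunM.
  - move=> k; rewrite -[X in _ --> X]mul1r; apply: cvgM; last exact: cvg_cst.
    rewrite -expR0; apply: continuous_cvg; first exact: continuous_expR.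
    rewrite -[X in _ --> X]oppr0; apply: cvgN.
    by rewrite -[X in _ --> X](mul0r `|k|); apply: cvgM; [exact: cvg_harmonic|exact: cvg_cst].
  - exact: integZ (@integ_lorentz R).
  - move=> n k; apply: le_trans (hB k); rewrite normrM ler_piMl //.
    by rewrite ger0_norm ?expR_ge0 // expR_le1 oppr_le0 mulr_ge0 // ltW // harmonic_gt0.
have [_ L2] : integ (sdq f x) /\
    Int (fun z => damp (harm n) z * sdq f x z) @[n --> \oo] --> Int (sdq f x).
  apply: (@Int_dominated_cvg _ _ _ (fun z => `|sdq f x z|)).
  - by move=> n; apply: mfunM; [exact: damp_mfun|exact: integ_mfun].
  - move=> z; have [->|z0] := eqVneq z 0.
      rewrite /sdq expr0n /= invr0 mulr0.
      by under eq_fun do rewrite mulr0; exact: cvg_cst.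
    rewrite -[X in _ --> X]mul1r; apply: cvgM; last exact: cvg_cst.
    exact: cvg_damp.
  - exact: integ_norm.
  - by move=> n z; rewrite normrM ler_piMl // damp_le1 // harmonic_gt0.
apply: (cvg_unique _ L1) => //.
rewrite (_ : (fun n => _) = (fun n => Int (fun z => damp (harm n) z * sdq f x z))) //.
apply/funext => n; rewrite -(Int_abel_cosT x tf (harmonic_gt0 n)).
by apply: eq_Int => k; rewrite /abel mulrCA mulrA.
Qed.

(** Centring the function at [x] turns the real part of the inverse transform
    into a cosine transform. *)
Lemma fracLap_cosT f (x : R) : testfun f ->
  fracLap 2^-1 f x = (2 * pi)^-1 * Int (fun k => `|k| * cosT (fun z => f (x - z)) k).
Proof.
move=> tf; rewrite /fracLap /inv_fourier /cintegral /= !mul0r subr0.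
congr (_ * _); apply: eq_Int => k.
rewrite !mul0r subr0 addr0 divff // powRr1 //.
have itf := testfun_integ tf.
have ic : integ (fun y => f y * cos (k * y)) := integ_cos k itf.
have is_ : integ (fun y => f y * sin (k * y)).
  apply: (@eq_integ _ (fun z => sin (k * z) * f z)).
    by move=> z; rewrite mulrC.
  apply: (@integ_bdM _ 1) => //; last by move=> z; exact: sin_max.
  apply: mfun_comp; first exact: cont_mfun (@continuous_sin R).
  by apply: mfunM; [exact: mfun_cst|exact: measurable_id].
have E1 : (\int[lebesgue_measure]_x1 (f x1 * cos (- (k * x1)) - 0 * sin (- (k * x1))))%R
    = Int (fun y => f y * cos (k * y)).
  by apply: eq_Int => y; rewrite mul0r subr0 cosN.
have E2 : (\int[lebesgue_measure]_x1 (f x1 * sin (- (k * x1)) + 0 * cos (- (k * x1))))%R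
    = - Int (fun y => f y * sin (k * y)).
  rewrite -mulN1r -IntZ //; apply: eq_Int => y.
  by rewrite mul0r addr0 sinN; ring.
rewrite E1 E2 -mulrA -mulrA -mulrBr; congr (_ * _).
rewrite mulNr opprK -![Int _ * _]mulrC -!IntZ // -IntD; [|exact: integZ|exact: integZ].
pose G y := f y * cos (k * (x - y)).
have iG : integ G.
  apply: (@eq_integ _ (fun z => cos (k * (x - z)) * f z)).
    by move=> z; rewrite mulrC.
  apply: (@integ_bdM _ 1) => //; last by move=> z; exact: cos_max.
  apply: mfun_comp; first exact: cont_mfun (@continuous_cos R).
  apply: mfunM; first exact: mfun_cst.
  by apply: mfunB; [exact: mfun_cst|exact: measurable_id].
have [_ EG] := Int_reflect x iG.
transitivity (Int G).
  by apply: eq_Int => y; rewrite /G mulrBr cosB; ring.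
by rewrite -EG; apply: eq_Int => y; rewrite /G (_ : x - (x - y) = y) //; ring.
Qed.

Lemma fracLapE f : testfun f -> fracLap 2^-1 f =1 halfLap f.
Proof. by move=> tf x; rewrite fracLap_cosT // Int_abs_cosT. Qed.

End fourier_side.

(** * Scaling and monotone weights *)
Section scaling.
Context {R : realType}.
Implicit Types f g h K : R -> R.
Local Notation harm := (@harmonic R).

Lemma testfun_C2 f : testfun f -> exists f1 f2 (M : R), [/\ Der f f1, Der f1 f2,
  (forall x, `|f x| <= M * lorentz x) & (forall x, `|f2 x| <= M * lorentz x)].
Proof.
move=> tf; have [f1 [d1 t1]] := testfun_der tf; have [f2 [d2 t2]] := testfun_der t1.
have [M0 h0] := testfun_lorentz tf; have [M2 h2] := testfun_lorentz t2.
exists f1, f2, (`|M0| + `|M2|); split => // x.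
  apply: (le_trans (h0 x)); rewrite ler_wpM2r ?(ltW (lorentz_gt0 x)) //.
  by rewrite (le_trans (ler_norm M0)) // lerDl.
apply: (le_trans (h2 x)); rewrite ler_wpM2r ?(ltW (lorentz_gt0 x)) //.
by rewrite (le_trans (ler_norm M2)) // lerDr.
Qed.

Lemma testfun_integ_sdq f x : testfun f -> integ (sdq f x).
Proof. by move=> /testfun_C2[f1 [f2 [M [d1 d2 h1 h2]]]]; exact: integ_sdq d1 d2 h1 h2 x. Qed.

Lemma testfun_integ_halfLap f : testfun f -> integ (halfLap f).
Proof. by move=> /testfun_C2[f1 [f2 [M [d1 d2 h1 h2]]]]; exact: integ_halfLap d1 d2 h1 h2. Qed.

Lemma halfLap_scale f (c d x : R) : 0 < d -> testfun f ->
  halfLap (fun x => f (d^-1 * x + c)) x = d^-1 * halfLap f (d^-1 * x + c).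
Proof.
move=> d0 tf; have dn : d != 0 by rewrite gt_eqF.
have di : 0 < d^-1 by rewrite invr_gt0.
set X := d^-1 * x + c.
have iK := testfun_integ_sdq X tf.
have [i1 I1] := Int_affine 0 di iK.
rewrite /halfLap; have -> : Int (sdq (fun x => f (d^-1 * x + c)) x) =
    Int (fun y => d^-1 ^+ 2 * sdq f X (0 + d^-1 * y)).
  apply: eq_Int => y; rewrite /sdq add0r exprMn.
  rewrite mulrDr mulrBr /X.
  have -> : d^-1 * x + d^-1 * y + c = d^-1 * x + c + d^-1 * y by ring.
  have -> : d^-1 * x - d^-1 * y + c = d^-1 * x + c - d^-1 * y by ring.
  rewrite [RHS]mulrCA; congr (_ * _).
  rewrite (invfM (d^-1 ^+ 2)) mulrA mulfV ?mul1r //.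
  by rewrite expf_neq0 // invr_neq0.
have pn : pi != 0 :> R by rewrite gt_eqF // pi_gt0.
have fin (I p : R) : p != 0 ->
    (2 * p)^-1 * (d^-1 ^+ 2 * (d * I)) = d^-1 * ((2 * p)^-1 * I).
  by move=> p0; field; rewrite p0 dn.
by rewrite IntZ // I1 invrK fin.
Qed.

Lemma testfun_MVT f f1 (x h : R) : Der f f1 -> 0 < h ->
  exists2 c, x < c < x + h & f (x + h) - f x = h * f1 c.
Proof.
move=> d1 h0; have [|c hc E] := MVT_line d1 (_ : x < x + h); first by rewrite ltrDl.
by exists c => //; rewrite E mulrC; congr (_ * _); ring.
Qed.

Lemma lorentz_near (x c : R) : `|x - c| <= 1 -> lorentz c <= 3 * lorentz x.
Proof.
move=> h; have e1 : (x - c) ^+ 2 <= 1.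
  by rewrite -(real_normK (num_real _)) expr_le1.
rewrite /lorentz ler_pdivlMr ?sqr1_gt0 // mulrC ler_pdivrMr ?sqr1_gt0 //.
by have := sqr_ge0 (x - 2 * c); have := sqr_ge0 c; lra.
Qed.

(** The derivative of the test function is a limit of difference quotients,
    whose shift can be moved to the monotone factor; so the distributional
    derivative of [K] is nonpositive although [K] may jump. *)
Lemma noninc_weak K f f1 (B : R) : {homo K : x y / x <= y >-> y <= x} ->
  (forall x, `|K x| <= B) -> testfun f -> Der f f1 -> (forall x, 0 <= f x) ->
  0 <= Int (fun x => K x * f1 x).
Proof.
move=> mK KB tf d1 f0.
have mfK : mfun K by exact: nonincreasing_measurable.
have [g [dg t1]] := testfun_der tf; rewrite (Der_uniq dg d1) in t1.
have [f2 [d2 t2]] := testfun_der t1.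
have [M hM] := testfun_lorentz t1; have [B2 hB2] := testfun_bd t2.
have itf := testfun_integ tf.
have [_ L] : integ (fun x => K x * f1 x) /\
    Int (fun x => K x * ((f (x + harm n) - f x) / harm n)) @[n --> \oo] -->
        Int (fun x => K x * f1 x).
  apply: (@Int_dominated_cvg _ _ _ (fun x => B * (M * (3 * lorentz x)))).
  - move=> n; apply: mfunM => //; apply: mfunM; last exact: mfun_cst.
    apply: mfunB; last exact: integ_mfun itf.
    apply: mfun_comp; first exact: integ_mfun itf.
    by apply: mfunD; [exact: measurable_id|exact: mfun_cst].
  - move=> x; apply: cvgM; first exact: cvg_cst.
    apply/subr_cvg0; apply/norm_cvg0P.
    apply: (@squeeze_cvgr _ _ _ _ (fun=> 0) (fun n => B2 * harm n)).
    + near=> n; rewrite normr_ge0 /=.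
      have n0 := harmonic_gt0 (R := R) n.
      have [c /andP[c1 c2] ->] := testfun_MVT x d1 n0.
      rewrite mulrAC divff ?gt_eqF // mul1r.
      have [e _ ->] := MVT_line d2 c1.
      rewrite normrM; apply: ler_pM => //.
      by rewrite gtr0_norm ?subr_gt0 // lerBlDl ltW.
    + exact: cvg_cst.
    + by rewrite -(mulr0 B2); apply: cvgM; [exact: cvg_cst|exact: cvg_harmonic].
  - by do 3 apply: integZ; exact: integ_lorentz.
  - move=> n x; rewrite normrM; apply: ler_pM => //.
    have n0 := harmonic_gt0 (R := R) n.
    have [c /andP[c1 c2] ->] := testfun_MVT x d1 n0.
    rewrite mulrAC divff ?gt_eqF // mul1r.
    apply: (le_trans (hM c)).
    have M0 : 0 <= M by have := le_trans (normr_ge0 _) (hM 0); rewrite pmulr_lge0 // lorentz_gt0.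
    apply: ler_wpM2l => //; apply: lorentz_near.
    rewrite distrC gtr0_norm ?subr_gt0 // lerBlDl ltW //; apply: (lt_le_trans c2).
    by rewrite lerD2l invf_le1 // ler1n.
apply: (@closed_cvg _ _ \oo eventually_filter _ [set y : R | 0 <= y] _ _ _ L).
  exact: closed_ge.
apply: nearW => n /=; have n0 := harmonic_gt0 (R := R) n.
have iKf : integ (fun x => K x * f x) by apply: (integ_bdM mfK KB).
have iKs : integ (fun x => K x * f (x + harm n)).
  apply: (integ_bdM mfK KB); have [h _] := Int_shift (harm n) itf.
  by apply: eq_integ h => x; rewrite addrC.
rewrite (_ : Int _ = (harm n)^-1 * (Int (fun x => K x * f (x + harm n)) - Int (fun x => K x * f x))); last first.
  rewrite -IntB // -IntZ; last exact: integB.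
  by apply: eq_Int => x; ring.
apply: mulr_ge0; first by rewrite invr_ge0 ltW.
rewrite subr_ge0.
have iKm : integ (fun x => K (x - harm n) * f x).
  apply: (@integ_bdM _ B) => //.
  by apply: mfun_comp => //; apply: mfunB; [exact: measurable_id|exact: mfun_cst].
have [_ E] := Int_shift (harm n) iKm.
have -> : Int (fun x => K x * f (x + harm n)) = Int (fun x => K (x - harm n) * f x).
  by rewrite -E; apply: eq_Int => x; rewrite addrAC subrr add0r (addrC x).
apply: le_Int => // x; apply: ler_wpM2r => //; apply: mK.
by rewrite gerBl ltW.
Unshelve. all: by end_near. Qed.

Lemma Der_loc0 f f1 (c x : R) : Der f f1 -> (forall y, y < c -> f y = 0) -> x < c -> f1 x = 0.
Proof.
move=> d h xc; have [_ <-] := d x.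
have -> : 0 = 'D_1 (fun _ : R => 0 : R) x by rewrite derive_cst.
apply: near_eq_derive; near=> y; apply: h; near: y; exact: lt_nbhsl.
Unshelve. all: by end_near. Qed.

End scaling.

(** * The selfsimilar profile *)
Section profile.
Context {R : realType}.
Local Notation harm := (@harmonic R).
Variables (L : R) (H : R -> R).
Hypothesis L0 : 0 < L.
Hypothesis Hmono : {homo H : x y / x <= y >-> y <= x}.
Let U := Phi2 L \o H.
(** The latent part of the enthalpy. *)
Let E x := H x - U x.

Lemma U_pos x : L <= H x -> U x = H x - L.
Proof.
move=> h; rewrite /U /= /Phi2 max_l ?subr_ge0 // min_r ?addr0 //.
exact: le_trans (ltW L0) h.
Qed.

Lemma U_neg x : H x <= 0 -> U x = H x.
Proof.
by move=> h; rewrite /U /= /Phi2 max_r ?min_l ?add0r //; have := L0; lra.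
Qed.

Lemma U_mid x : 0 <= H x <= L -> U x = 0.
Proof.
by move=> /andP[h1 h2]; rewrite /U /= /Phi2 max_r ?min_r ?add0r //; lra.
Qed.

Lemma E_mono : {homo E : x y / x <= y >-> y <= x}.
Proof.
move=> x y xy; have := Hmono xy; rewrite /E.
have [hx|hx] := leP L (H x); have [hy|hy] := leP L (H y).
- by rewrite !U_pos //; lra.
- rewrite (U_pos hx); have [h0|h0] := leP 0 (H y).
    have my : 0 <= H y <= L by rewrite h0 ltW.
    by rewrite (U_mid my); lra.
  by rewrite (U_neg (ltW h0)); have := L0; lra.
- by lra.
- have [h0|h0] := leP 0 (H y); have [h1|h1] := leP 0 (H x).
  + have my : 0 <= H y <= L by rewrite h0 ltW.
    have mx : 0 <= H x <= L by rewrite h1 ltW.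
    by rewrite (U_mid my) (U_mid mx); lra.
  + by lra.
  + have mx : 0 <= H x <= L by rewrite h1 ltW.
    by rewrite (U_neg (ltW h0)) (U_mid mx); lra.
  + by rewrite (U_neg (ltW h0)) (U_neg (ltW h1)); lra.
Qed.

Lemma E_bd x : 0 <= E x <= L.
Proof.
rewrite /E; have [hx|hx] := leP L (H x).
  by rewrite U_pos //; have := L0; lra.
have [h0|h0] := leP 0 (H x); first by rewrite (U_mid (x := x)) ?subr0 h0 ltW.
by rewrite (U_neg (ltW h0)) subrr lexx ltW.
Qed.

Lemma E_neg x : H x <= 0 -> E x = 0.
Proof. by move=> h; rewrite /E U_neg // subrr. Qed.

Variables (xw xi : R).
Hypothesis water : water_interphase L H xw.
Hypothesis ice : ice_interphase H xi.

Lemma xw_le_xi : xw <= xi.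
Proof.
rewrite leNgt; apply/negP => h.
have h1 := water.2 ((xw + xi) / 2); have h2 := ice.2 ((xw + xi) / 2).
have p1 : (xw + xi) / 2 < xw by lra.
have p2 : xi < (xw + xi) / 2 by lra.
by have := h1 p1; have := h2 p2; have := L0; lra.
Qed.

Lemma H_le_L x : xw <= x -> H x <= L.
Proof.
move=> h; apply: (@closed_cvg _ _ (xw^'-) _ _ [set y : R | H x <= y] _ _ _ water.1).
  exact: closed_ge.
near=> y; apply: Hmono; apply: le_trans h; apply: ltW.
by near: y; exact: nbhs_left_lt.
Unshelve. all: by end_near. Qed.

Lemma H_ge_0 x : x <= xi -> 0 <= H x.
Proof.
move=> h; apply: (@closed_cvg _ _ (xi^'+) _ _ [set y : R | y <= H x] _ _ _ ice.1).
  exact: closed_le.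
near=> y; apply: Hmono; apply: (le_trans h); apply: ltW.
by near: y; exact: nbhs_right_gt.
Unshelve. all: by end_near. Qed.

Lemma U_mushy x : xw <= x <= xi -> U x = 0.
Proof. by move=> /andP[h1 h2]; apply: U_mid; rewrite H_ge_0 // H_le_L. Qed.

Lemma U_water x : x < xw -> 0 < U x.
Proof. by move=> h; rewrite U_pos ?subr_gt0 ?ltW //; exact: water.2. Qed.

Lemma U_ice x : xi < x -> U x = H x /\ U x < 0.
Proof. by move=> /(ice.2) h; rewrite U_neg ?ltW. Qed.

Hypothesis Hbd : exists M : R, forall x, `|H x| <= M.
Hypothesis Ubd : exists M : R, forall x, `|U x| <= M.
Hypothesis Ucont : continuous U.
Hypothesis PE : profile_equation 2^-1 H U.

Lemma mfunH : mfun H. Proof. exact: nonincreasing_measurable. Qed.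
Lemma mfunU : mfun U. Proof. exact: cont_mfun. Qed.

Lemma testfun_D1 f f1 (c d : R) : testfun f -> Der f f1 -> integ (fun x => d * f x + (c + d * x) * f1 x).
Proof.
move=> tf d1; have [g [dg t1]] := testfun_der tf; rewrite (Der_uniq dg d1) in t1.
apply: integD; first exact/integZ/testfun_integ.
apply: (@eq_integ _ (fun x => f1 x * (c + d * x))); first by move=> x; rewrite mulrC.
apply: testfun_integ; apply: testfun_mul => // n; apply: CkD; first exact: Ck_cst.
by apply: CkM; [exact: Ck_cst|exact: Ck_id].
Qed.

Lemma profile_testfun f f1 : testfun f -> Der f f1 ->
  Int (fun x => H x * (f x + x * f1 x)) + Int (fun x => U x * halfLap f x) = 0.
Proof.
move=> tf d1; have := PE (testfun_test_line tf).
rewrite divff // invr1 mul1r => e; rewrite -[RHS]e; congr (_ + _).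
  apply: eq_Int => x; congr (_ * _).
  have [_ e1] := derM (der_id x) (d1 x).
  by rewrite derive1E e1 mul1r.
by apply: eq_Int => x; rewrite fracLapE.
Qed.

(** The equation in the variable [a + d y]: blow-ups and blow-downs of the
    profile are obtained by letting [d] tend to zero or to infinity. *)
Lemma profile_scaled f f1 (a d : R) : 0 < d -> testfun f -> Der f f1 ->
  Int (fun y => H (a + d * y) * (d * f y + (a + d * y) * f1 y))
  + Int (fun y => U (a + d * y) * halfLap f y) = 0.
Proof.
move=> d0 tf d1; have dn : d != 0 by rewrite gt_eqF.
have [MH hH] := Hbd; have [MU hU] := Ubd.
pose fd x := f (d^-1 * x + (- (d^-1 * a))).
pose fd1 x := f1 (d^-1 * x + (- (d^-1 * a))) * d^-1.
have tfd : testfun fd by apply: testfun_affine => //; rewrite invr_neq0.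
have dfd : Der fd fd1.
  move=> x; have e : is_derive x 1 (fun x : R => d^-1 * x + (- (d^-1 * a))) d^-1.
    apply: (is_derive_eq (derD (derM (der_cst d^-1 x) (der_id x)) (der_cst _ x))).
    by rewrite mul0r add0r mulr1 addr0.
  exact: (@der_comp _ f (fun x => d^-1 * x + (- (d^-1 * a))) x _ _ (d1 _) e).
have e0 := profile_testfun tfd dfd.
have i1 : integ (fun x => H x * (fd x + x * fd1 x)).
  apply: (integ_bdM mfunH hH).
  by apply: eq_integ (testfun_D1 0 1 tfd dfd) => x; rewrite add0r !mul1r.
have i2 : integ (fun x => U x * halfLap fd x) by exact: (integ_bdM mfunU hU (testfun_integ_halfLap tfd)).
have [j1 J1] := Int_affine a d0 i1; have [j2 J2] := Int_affine a d0 i2.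
have back y : d^-1 * (a + d * y) + - (d^-1 * a) = y by field.
have e1 : Int (fun y => H (a + d * y) * (d * f y + (a + d * y) * f1 y)) =
    d * (d^-1 * Int (fun x => H x * (fd x + x * fd1 x))).
  rewrite -J1 -IntZ //; apply: eq_Int => y; rewrite /fd /fd1 back; by field.
have e2 : Int (fun y => U (a + d * y) * halfLap f y) =
    d * (d^-1 * Int (fun x => U x * halfLap fd x)).
  rewrite -J2 -IntZ //; apply: eq_Int => y; rewrite (halfLap_scale _ _ d0 tf) back; by field.
by rewrite e1 e2 -mulrDr -mulrDr e0 !mulr0.
Qed.

Lemma cvg_harmonic_affine (a y : R) : a + harm n * y @[n --> \oo] --> a.
Proof.
rewrite -[X in _ --> X]addr0 -(mul0r y); apply: cvgD; first exact: cvg_cst.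
by apply: cvgM; [exact: cvg_harmonic|exact: cvg_cst].
Qed.

(** In a blow-up at a jump of the enthalpy, [- xi H'] becomes a multiple of a
    Dirac mass, and nothing balances it since the continuous temperature
    vanishes at the jump; the multiple is proportional to the abscissa. *)
Lemma no_jump : xw = xi -> xw = 0.
Proof.
move=> xx; set a := xw.
have [MH hH] := Hbd; have [MU hU] := Ubd.
have [b1 [d1 t1]] := testfun_der (@testfun_bump R).
have ib := testfun_integ (@testfun_bump R); have ib1 := testfun_integ t1.
have iyb1 : integ (fun y => `|y * b1 y|).
  apply: integ_norm; apply: (@eq_integ _ (fun y => b1 y * y)); first by move=> y; rewrite mulrC.
  by apply: testfun_integ; apply: testfun_mul => // n; exact: Ck_id.
have Hl (y : R) : y < 0 -> H (a + harm n * y) @[n --> \oo] --> L.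
  move=> y0; have := water.1 => /cvg_at_leftP; apply; split; last exact: cvg_harmonic_affine.
  by move=> n; rewrite gtrDl pmulr_rlt0 // harmonic_gt0.
have Hr (y : R) : 0 < y -> H (a + harm n * y) @[n --> \oo] --> 0.
  move=> y0; have := ice.1; rewrite -xx => /cvg_at_rightP; apply; split;
      last exact: cvg_harmonic_affine.
  by move=> n; rewrite ltrDl mulr_gt0 // harmonic_gt0.
(* the limit integrand; at [y = 0] the blown-up enthalpy is constantly [H a] *)
pose q y := (if y < 0 then L else if y == 0 then H a else 0) * (a * b1 y).
have [iq Lq] : integ q /\
    Int (fun y => H (a + harm n * y) * (harm n * bump y + (a + harm n * y) * b1 y))
      @[n --> \oo] --> Int q.
  apply: (@Int_dominated_cvg _ _ _ (fun y => MH * (`|bump y| + (`|a| * `|b1 y| + `|y * b1 y|)))).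
  - move=> n; apply: mfunM; last exact: integ_mfun (testfun_D1 _ _ (@testfun_bump R) d1).
    apply: mfun_comp; first exact: mfunH.
    apply: mfunD; first exact: mfun_cst.
    by apply: mfunM; [exact: mfun_cst|exact: measurable_id].
  - move=> y; apply: cvgM.
      have [y0|y0|->] := ltgtP y 0; [exact: Hl|exact: Hr|].
      by under eq_fun do rewrite mulr0 addr0; exact: cvg_cst.
    rewrite -[X in _ --> X]add0r; apply: cvgD.
      by rewrite -(mul0r (bump y)); apply: cvgM; [exact: cvg_harmonic|exact: cvg_cst].
    by apply: cvgM; [exact: cvg_harmonic_affine|exact: cvg_cst].
  - apply: integZ; apply: integD; first exact: integ_norm.
    by apply: integD => //; apply: integZ; exact: integ_norm.
  - move=> n y; rewrite normrM; apply: ler_pM => //.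
    apply: (le_trans (ler_normD _ _)).
    have n1 : `|harm n| <= 1 by rewrite gtr0_norm ?harmonic_gt0 // invf_le1 // ler1n.
    apply: lerD; first by rewrite normrM ler_piMl.
    rewrite mulrDl; apply: (le_trans (ler_normD _ _)); apply: lerD; first by rewrite normrM.
    by rewrite -mulrA normrM ler_piMl.
have [_ L2] : integ (fun y => U a * halfLap bump y) /\
    Int (fun y => U (a + harm n * y) * halfLap bump y) @[n --> \oo] -->
    Int (fun y => U a * halfLap bump y).
  apply: (@Int_dominated_cvg _ _ _ (fun y => MU * `|halfLap bump y|)).
  - move=> n; apply: mfunM; last exact: integ_mfun (testfun_integ_halfLap (@testfun_bump R)).
    apply: mfun_comp; first exact: mfunU.
    apply: mfunD; first exact: mfun_cst.
    by apply: mfunM; [exact: mfun_cst|exact: measurable_id].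
  - move=> y; apply: cvgM; last exact: cvg_cst.
    by apply: continuous_cvg; [exact: Ucont|exact: cvg_harmonic_affine].
  - by apply: integZ; apply: integ_norm; exact: testfun_integ_halfLap (@testfun_bump R).
  - by move=> n y; rewrite normrM ler_wpM2r.
have Ua : U a = 0 by apply: U_mushy; rewrite lexx /a xw_le_xi.
have Iq0 : Int q = 0.
  have e n : Int (fun y => H (a + harm n * y) * (harm n * bump y + (a + harm n * y) * b1 y)) =
      - Int (fun y => U (a + harm n * y) * halfLap bump y).
    by apply/eqP; rewrite -addr_eq0; apply/eqP;
        exact: profile_scaled (harmonic_gt0 n) (@testfun_bump R) d1.
  have L3 : Int (fun y => H (a + harm n * y) * (harm n * bump y + (a + harm n * y) * b1 y))
      @[n --> \oo] --> - Int (fun y => U a * halfLap bump y).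
    by under eq_fun do rewrite e; apply: cvgN.
  rewrite (cvg_unique _ Lq L3) // -[RHS]oppr0; congr (- _).
  by rewrite -[RHS]Int0; apply: eq_Int => y; rewrite Ua mul0r.
have cb1 : continuous b1 by exact: (t1.1 0%N).
have ineg : integ (fun y => (y <= 0)%R%:R * b1 y).
  apply: (@integ_bdM _ 1) => //; first exact: mfun_ge.
  by move=> y; rewrite ger0_norm ?ler0n // lern1 leq_b1.
have bm : bump y @[y --> -oo] --> (0 : R).
  apply: cvg_near_cst; near=> y; apply: bump_eq0; rewrite -normrN.
  apply: le_trans (ler_norm (- y)); rewrite lerNr.
  by near: y; apply: nbhs_ninfty_le; rewrite num_real.
have F := FTC_left cb1 d1 ineg bm.
have [_ F2] : integ (fun y => L * a * ((y <= 0)%R%:R * b1 y)) /\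
    Int (fun y => L * a * ((y <= 0)%R%:R * b1 y)) = Int q.
  apply: (Int_eq_off (c := 0) iq) => y y0; rewrite /q (negbTE y0) le_eqVlt (negbTE y0) /=.
  by case: ifP => _; rewrite ?mul1r ?mul0r ?mulr0 // mulrA.
have b0 : bump (0 : R) != 0 by rewrite gt_eqF //; apply: bump_gt0; lra.
move/eqP: F2; rewrite IntZ // F Iq0 subr0 mulf_eq0 (negbTE b0) orbF.
by rewrite mulf_eq0 (gt_eqF L0) => /eqP.
Unshelve. all: by end_near. Qed.

Definition bump12 (y : R) : R := bump (2 * y + (-3)).

Lemma testfun_bump12 : testfun bump12.
Proof. by apply: testfun_affine; [rewrite pnatr_eq0|exact: testfun_bump]. Qed.

Lemma bump12_ge0 y : 0 <= bump12 y. Proof. exact: bump_ge0. Qed.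

Lemma bump12_gt0 y : 1 < y < 2 -> 0 < bump12 y.
Proof. by move=> h; apply: bump_gt0; lra. Qed.

Lemma bump12_eq0 y : y <= 1 \/ 2 <= y -> bump12 y = 0.
Proof.
by move=> h; apply: bump_eq0; rewrite ler_normr; apply/orP; case: h => h; [right|left]; lra.
Qed.

(** Outside the support of the test function the second difference reduces to
    an absolutely convergent integral of it against the kernel; this is that
    integral, seen from [x], for [bump12] dilated by [d]. *)
Definition far_field (d x : R) : R := Int (fun z => bump12 z / (d * z - x) ^+ 2).

Lemma far_field_integ (d x c : R) : 0 < c -> (forall z, 1 < z < 2 -> c <= `|d * z - x|) ->
  integ (fun z => bump12 z / (d * z - x) ^+ 2).
Proof.
move=> c0 hc; apply: (@le_integ _ _ (fun z => c ^- 2 * bump12 z)).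
- apply: mfunM; first exact: integ_mfun (testfun_integ testfun_bump12).
  apply: (@mfun_comp _ (fun z => z^-1)); first exact: mfun_inv.
  apply: (@mfun_comp _ (fun z => z ^+ 2)); first exact: cont_mfun (@exprn_continuous _ 2).
  apply: mfunB; last exact: mfun_cst.
  by apply: mfunM; [exact: mfun_cst|exact: measurable_id].
- exact/integZ/testfun_integ/testfun_bump12.
- move=> z; rewrite normrM (ger0_norm (bump12_ge0 z)) mulrC.
  have [z1|z1] := leP z 1; first by rewrite bump12_eq0 ?mulr0 //; left.
  have [z2|z2] := leP 2 z; first by rewrite bump12_eq0 ?mulr0 //; right.
  have zz : 1 < z < 2 by rewrite z1.
  apply: ler_wpM2r; first exact: bump12_ge0.
  have cz := hc z zz.
  have s0 : 0 < (d * z - x) ^+ 2.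
    by rewrite -(real_normK (num_real (d * z - x))) exprn_gt0 // (lt_le_trans c0).
  rewrite normfV ger0_norm ?sqr_ge0 // lef_pV2 ?posrE //; last exact: exprn_gt0.
  by rewrite -(real_normK (num_real (d * z - x))) lerXn2r // nnegrE ltW.
Qed.

Lemma halfLap_bump12 (y : R) : y < 1 \/ 2 < y ->
  halfLap bump12 y = - pi^-1 * Int (fun z => bump12 z / (z - y) ^+ 2).
Proof.
move=> hy; have iK := testfun_integ_sdq y testfun_bump12.
have py : bump12 y = 0 by apply: bump12_eq0; case: hy => h; [left|right]; exact: ltW.
pose g z := bump12 z / (z - y) ^+ 2.
have ig : integ g.
  have h : integ (fun z => bump12 z / (1 * z - y) ^+ 2).
    case: hy => hy; [have c0 : 0 < 1 - y by lra|have c0 : 0 < y - 2 by lra];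
    apply: (far_field_integ c0) => z /andP[z1 z2]; rewrite ler_normr; apply/orP; [left|right]; lra.
  by apply: eq_integ h => z; rewrite mul1r.
have [i1 I1] := Int_shift y ig; have [i2 I2] := Int_reflect y ig.
have -> : halfLap bump12 y = (2 * pi)^-1 * Int (fun z => -1 * (g (y + z) + g (y - z))).
  congr (_ * _); apply: eq_Int => z; rewrite /sdq /g py mulr0 sub0r.
  have -> : y + z - y = z by ring.
  have -> : (y - z - y) ^+ 2 = z ^+ 2 by ring.
  by ring.
rewrite IntZ; last exact: integD.
rewrite (IntD i1 i2) I1 I2.
have fin (I p : R) : p != 0 -> (2 * p)^-1 * (-1 * (I + I)) = - p^-1 * I.
  by move=> p0; field; rewrite p0.
by rewrite fin // gt_eqF // pi_gt0.
Qed.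

(** On the left the dilated bump moves away from [x]. *)
Lemma far_field_le_left (d d' x : R) : 0 < d -> d < d' -> x <= 0 ->
  far_field d' x <= far_field d x.
Proof.
move=> d0 dd x0.
have d'0 : 0 < d' by lra.
have i1 : integ (fun z => bump12 z / (d * z - x) ^+ 2).
  by apply: (far_field_integ d0) => z /andP[z1 z2]; rewrite ger0_norm; nra.
have i2 : integ (fun z => bump12 z / (d' * z - x) ^+ 2).
  by apply: (far_field_integ d'0) => z /andP[z1 z2]; rewrite ger0_norm; nra.
apply: le_Int => // z.
have [z1|z1] := leP z 1; first by rewrite bump12_eq0 ?mul0r //; left.
have p1 : 0 < d * z - x by nra.
have p2 : d * z - x <= d' * z - x by nra.
apply: ler_wpM2l; first exact: bump12_ge0.
by rewrite lef_pV2 ?posrE ?exprn_gt0 ?(lt_le_trans p1) // lerXn2r // nnegrE ltW // (lt_le_trans p1).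
Qed.

(** On the right the dilated bump approaches [x]. *)
Lemma far_field_lt_right (d d' x p : R) : 0 < d -> d < d' -> 2 * d' < p -> p <= x ->
  far_field d x < far_field d' x.
Proof.
move=> d0 dd dp x0.
have c0 : 0 < p - 2 * d' by lra.
have i1 : integ (fun z => bump12 z / (d * z - x) ^+ 2).
  by apply: (far_field_integ c0) => z /andP[z1 z2]; rewrite ler0_norm; nra.
have i2 : integ (fun z => bump12 z / (d' * z - x) ^+ 2).
  by apply: (far_field_integ c0) => z /andP[z1 z2]; rewrite ler0_norm; nra.
rewrite -subr_gt0 -IntB //.
have lt z : 1 < z < 2 -> (d * z - x) ^- 2 < (d' * z - x) ^- 2.
  move=> /andP[z1 z2].
  have q2 : d' * z - x < 0 by nra.
  have q1 : d * z - x < d' * z - x by nra.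
  have s1 : 0 < (d' * z - x) ^+ 2 by nra.
  have s2 : (d' * z - x) ^+ 2 < (d * z - x) ^+ 2 by nra.
  by rewrite ltf_pV2 ?posrE // (lt_trans s1).
apply: (@Int_gt0 _ _ 1 2); first exact: integB.
- move=> z.
  have [z1|z1] := leP z 1; first by rewrite bump12_eq0 ?mul0r ?subrr //; left.
  have [z2|z2] := leP 2 z; first by rewrite bump12_eq0 ?mul0r ?subrr //; right.
  by rewrite -mulrBr mulr_ge0 ?bump12_ge0 // subr_ge0 ltW // lt // z1.
- by rewrite ltr1n.
- by move=> z hz; rewrite -mulrBr mulr_gt0 ?bump12_gt0 // subr_gt0 lt.
Qed.

Lemma far_field_scaled (d x c : R) : 0 < d -> 0 < c -> (forall z, 1 < z < 2 -> c <= `|d * z - x|) ->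
  Int (fun z => bump12 z / (z - d^-1 * x) ^+ 2) = d ^+ 2 * far_field d x.
Proof.
move=> d0 c0 hc; have dn : d != 0 by rewrite gt_eqF.
rewrite -IntZ; last exact: far_field_integ c0 hc.
apply: eq_Int => z; have -> : d * z - x = d * (z - d^-1 * x) by field.
by rewrite exprMn (invfM (d ^+ 2)) mulrCA mulVKf // expf_neq0.
Qed.

(** The support [[d, 2 d]] of the dilated bump lies in the mushy region, where
    [U] vanishes, so only the far field of the bump meets [U]. *)
Lemma blowup_far_field (d : R) dbump12 : xw <= 0 -> 0 < d -> 2 * d < xi -> Der bump12 dbump12 ->
  integ (fun x => U x * far_field d x) /\
  Int (fun y => H (d * y) * (bump12 y + y * dbump12 y)) =
      pi^-1 * Int (fun x => U x * far_field d x).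
Proof.
move=> xw0 d0 dxi d1.
have [MU hU] := Ubd.
have pn : pi != 0 :> R by rewrite gt_eqF // pi_gt0.
have dn : d != 0 by rewrite gt_eqF.
have fin (u F p : R) : p != 0 -> u * (- p^-1 * (d ^+ 2 * F)) = - (d ^+ 2 / p) * (u * F).
  by move=> p0; field; rewrite p0.
have e x : U (0 + d * (0 + d^-1 * x)) * halfLap bump12 (0 + d^-1 * x) =
    - (d ^+ 2 / pi) * (U x * far_field d x).
  have -> : 0 + d * (0 + d^-1 * x) = x by field.
  have mush : d <= x <= 2 * d -> U x = 0.
    by move=> /andP[h1 h2]; apply: U_mushy; apply/andP; split; lra.
  rewrite add0r; have [h|h] := leP d x.
    have [h2|h2] := leP x (2 * d); first by rewrite mush ?h ?h2 // !mul0r mulr0.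
    rewrite halfLap_bump12; last by right; rewrite ltr_pdivlMl // mulrC.
    rewrite (far_field_scaled d0 (c := x - 2 * d)); first exact: fin.
      by lra.
    by move=> z /andP[z1 z2]; rewrite ler_normr; apply/orP; right; nra.
  rewrite halfLap_bump12; last by left; rewrite ltr_pdivrMl // mulr1.
  rewrite (far_field_scaled d0 (c := d - x)); first exact: fin.
    by lra.
  by move=> z /andP[z1 z2]; rewrite ler_normr; apply/orP; left; nra.
have := profile_scaled 0 d0 testfun_bump12 d1.
have iA := testfun_integ_halfLap testfun_bump12.
have mUd : mfun (fun y => U (0 + d * y)).
  apply: mfun_comp; first exact: mfunU.
  apply: mfunD; first exact: mfun_cst.
  by apply: mfunM; [exact: mfun_cst|exact: measurable_id].
have iUA : integ (fun y => U (0 + d * y) * halfLap bump12 y) by exact: (@integ_bdM _ MU).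
have di : 0 < d^-1 by rewrite invr_gt0.
have [j J] := Int_affine 0 di iUA.
have iUf : integ (fun x => U x * far_field d x).
  have := integZ (- (pi / d ^+ 2)) j; apply: eq_integ => x; rewrite e.
  have fin2 (u F p : R) : p != 0 -> - (p / d ^+ 2) * (- (d ^+ 2 / p) * (u * F)) = u * F.
    by move=> p0; field; rewrite p0 dn.
  exact: fin2.
move=> P; split; first exact: iUf.
have J2 := etrans (esym (etrans (eq_Int e) (IntZ _ iUf))) J.
rewrite (invrK d) in J2.
have Eg : Int (fun y => H (0 + d * y) * (d * bump12 y + (0 + d * y) * dbump12 y)) =
    d * Int (fun y => H (d * y) * (bump12 y + y * dbump12 y)).
  rewrite -IntZ.
    by apply: eq_Int => y; rewrite add0r; ring.
  have [MH hH] := Hbd.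
  apply: (@integ_bdM _ MH) => //.
    by apply: mfun_comp; [exact: mfunH|apply: mfunM; [exact: mfun_cst|exact: measurable_id]].
  by apply: eq_integ (testfun_D1 0 1 testfun_bump12 d1) => y; rewrite add0r !mul1r.
apply: (mulfI dn); move: P; rewrite Eg => /eqP; rewrite addr_eq0 => /eqP ->.
apply: (mulfI dn); rewrite mulrN -J2.
have fin3 (I p : R) : p != 0 -> - (- (d ^+ 2 / p) * I) = d * (d * (p^-1 * I)).
  by move=> p0; field; rewrite p0.
exact: fin3.
Qed.

(** The pairing [g] of the profile with the bump at scale [d] is nonnegative
    because [H] is nonincreasing, tends to zero with [d], and yet strictly
    decreases in [d] because the far field is monotone on either side. *)
Lemma mushy_off_origin : xw <= 0 -> 0 < xi -> False.
Proof.
move=> xw0 xi0.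
have [dbump12 [d1 t1]] := testfun_der testfun_bump12.
have [MH hH] := Hbd.
pose g d := Int (fun y => H (d * y) * (bump12 y + y * dbump12 y)).
pose ps y := y * bump12 y; pose ps1 y := bump12 y + y * dbump12 y.
have tps : testfun ps.
  have -> : ps = (fun y => bump12 y * y) by apply/funext => y; rewrite /ps mulrC.
  by apply: testfun_mul testfun_bump12 _ => n; exact: Ck_id.
have dps : Der ps ps1.
  by move=> y; apply: (is_derive_eq (derM (der_id y) (d1 y))); rewrite mul1r.
have tps1 : testfun ps1 by have [q [dq tq]] := testfun_der tps; rewrite (Der_uniq dps dq).
have ps_ge0 y : 0 <= ps y.
  rewrite /ps; have [y1|y1] := leP y 1; first by rewrite bump12_eq0 ?mulr0 //; left.
  by rewrite mulr_ge0 ?bump12_ge0 // ltW // (lt_trans ltr01).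
have g_ge0 d : 0 < d -> 0 <= g d.
  move=> d0; apply: (noninc_weak (K := fun y => H (d * y)) _ _ tps dps ps_ge0 (B := MH)) => //.
  by move=> x y xy; apply: Hmono; rewrite ler_pM2l.
have g_dec d d' : 0 < d -> d < d' -> 2 * d' < xi -> g d' < g d.
  move=> d0 dd dxi.
  have dxi' : 2 * d < xi by lra.
  have [i1 E1] := blowup_far_field xw0 d0 dxi' d1.
  have [i2 E2] := blowup_far_field xw0 (lt_trans d0 dd) dxi d1.
  rewrite /g E1 E2 ltr_pM2l ?invr_gt0 ?pi_gt0 // -subr_gt0 -IntB //.
  (* both sides of the mushy region contribute with the right sign; any
     interval inside the ice gives strictness *)
  apply: (@Int_gt0 _ _ (xi + 1) (xi + 2)); first exact: integB.
  - move=> x; rewrite -mulrBr; have [x0|x0] := leP x 0.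
      have fl := far_field_le_left d0 dd x0.
      have U0 : 0 <= U x.
        by have [h|h] := ltP x xw; [exact/ltW/U_water|rewrite U_mushy // h (le_trans x0) // ltW].
      by rewrite mulr_ge0 // subr_ge0.
    have [xx|xx] := leP x xi.
      by rewrite U_mushy ?mul0r // xx andbT (le_trans xw0) // ltW.
    by rewrite mulr_le0 ?subr_le0 ?ltW ?(U_ice xx).2 //; apply: far_field_lt_right dxi _ => //;
        exact: ltW.
  - by rewrite ltrD2l ltr1n.
  - move=> x /andP[x1 x2]; have xx : xi < x by apply: lt_trans x1; rewrite ltrDl.
    rewrite -mulrBr nmulr_rgt0 ?(U_ice xx).2 // subr_lt0.
    by apply: far_field_lt_right dxi _ => //; exact: ltW.
have [l Hl] : exists l : R, H x @[x --> 0^'+] --> l.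
  eexists; apply: (@nonincreasing_at_right_cvgr _ H 0 +oo%O) => //.
    by move=> x y _ _; exact: Hmono.
  by exists MH => _ [x _ <-]; exact: le_trans (ler_norm _) (hH x).
have L1 : g (harm n) @[n --> \oo] --> 0.
  have [_ C] : integ (fun y => l * ps1 y) /\ g (harm n) @[n --> \oo] --> Int (fun y => l * ps1 y).
    apply: (@Int_dominated_cvg _ _ _ (fun y => MH * `|ps1 y|)).
    - move=> n; apply: mfunM; last exact: integ_mfun (testfun_integ tps1).
      apply: mfun_comp; first exact: mfunH.
      by apply: mfunM; [exact: mfun_cst|exact: measurable_id].
    - move=> y; have [y0|y0] := leP y 0.
        have e0 : ps1 y = 0.
          apply: (Der_loc0 dps (c := 1)); last by rewrite (le_lt_trans y0).
          by move=> z z1; rewrite /ps bump12_eq0 ?mulr0 //; left; exact: ltW.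
        rewrite e0 mulr0; apply: cvg_near_cst; apply: nearW => n.
        by rewrite -/(ps1 y) e0 mulr0.
      apply: cvgM; last exact: cvg_cst.
      move: Hl => /cvg_at_rightP; apply; split.
        by move=> n; rewrite mulr_gt0 // harmonic_gt0.
      by rewrite -[X in _ --> X](mul0r y); apply: cvgM; [exact: cvg_harmonic|exact: cvg_cst].
    - by apply: integZ; apply: integ_norm; exact: testfun_integ.
    - by move=> n y; rewrite normrM; apply: ler_wpM2r.
  rewrite IntZ in C; last exact: testfun_integ.
  have I0 : Int ps1 = 0.
    have [K hK] := tps.2.
    have pp : ps y @[y --> +oo] --> 0.
      apply: cvg_near_cst; near=> y; apply: hK; apply: lt_le_trans (ler_norm y).
      by near: y; apply: nbhs_pinfty_gt; rewrite num_real.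
    have pm : ps y @[y --> -oo] --> 0.
      apply: cvg_near_cst; near=> y; apply: hK; rewrite -normrN.
      apply: lt_le_trans (ler_norm (- y)); rewrite ltrNr.
      by near: y; apply: nbhs_ninfty_lt; rewrite num_real.
    by rewrite (FTC_line (tps1.1 0%N) dps (testfun_integ tps1) pp pm) subrr.
  by rewrite I0 mulr0 in C.
(* two scales are compared so as to get a positive value; both satisfy the
   constraint [2 d < xi] *)
have c0 : 0 < g (xi / 8).
  by apply: le_lt_trans (g_dec (xi / 8) (xi / 4) _ _ _); [apply: g_ge0|..]; lra.
have : g (xi / 8) <= 0.
  apply: (@closed_cvg _ _ \oo eventually_filter _ [set y : R | g (xi / 8) <= y] _ _ _ L1).
    exact: closed_ge.
  near=> n; apply: ltW; apply: g_dec; [exact: harmonic_gt0| |by lra].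
  by near: n; move/cvgr_lt: (cvg_harmonic (R := R)); apply; lra.
by rewrite leNgt c0.
Unshelve. all: by end_near. Qed.

(** Truncations of [lorentz] at scale [n.+1], divided by the value of the bump
    at the origin so that they converge to [lorentz]. *)
Definition cut_lorentz (n : nat) (y : R) : R := bump (harm n * y + 0) * ((bump (0 : R))^-1 * lorentz y).

Lemma bump0_gt0 : 0 < bump (0 : R).
Proof. by apply: bump_gt0; lra. Qed.

Lemma testfun_cut_lorentz n : testfun (cut_lorentz n).
Proof.
apply: testfun_mul; first by apply: testfun_affine;
    [rewrite gt_eqF // harmonic_gt0|exact: testfun_bump].
by move=> k; apply: CkM; [exact: Ck_cst|exact: Ck_lorentz].
Qed.

Lemma harmonic_le1 n : harm n <= 1 :> R.
Proof. by rewrite invf_le1 // ler1n. Qed.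

Lemma lorentz1_bd (y : R) : `|- (2 * y) * lorentz y ^+ 2| <= lorentz y.
Proof.
have w0 := lorentz_gt0 y.
rewrite (_ : - (2 * y) * lorentz y ^+ 2 = - (2 * (y * lorentz y)) * lorentz y); last by ring.
rewrite normrM (gtr0_norm w0) ler_piMl ?(ltW w0) // normrN normrM ger0_norm //.
by have := xlorentz_le y; lra.
Qed.

(** The truncation is slow, each derivative of the cut-off gaining a factor
    [harmonic n], so the bounds by [lorentz] are uniform in [n].  In
    [x * cut1 n x] that factor is absorbed by [x], which is why the derivative
    of the bump times the identity has to be bounded. *)
Lemma cut_lorentz_C2 : exists (cut1 cut2 : nat -> R -> R) (M : R),
  [/\ (forall n, Der (cut_lorentz n) (cut1 n)), (forall n, Der (cut1 n) (cut2 n)),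
      (forall n x, `|cut_lorentz n x| <= M * lorentz x), (forall n x, `|cut2 n x| <= M * lorentz x) &
      (forall n x, `|cut_lorentz n x + x * cut1 n x| <= M * lorentz x) /\
      (forall x, cut_lorentz n x + x * cut1 n x @[n --> \oo] --> dxlorentz x)].
Proof.
have [b1 [d1 t1]] := testfun_der (@testfun_bump R); have [b2 [d2 t2]] := testfun_der t1.
have [B1 h1] := testfun_bd t1; have [B2 h2] := testfun_bd t2.
have [B3 h3] := testfun_bd (testfun_mul t1 (fun n => @Ck_id R n)).
have B1_0 : 0 <= B1 := le_trans (normr_ge0 _) (h1 0).
have B2_0 : 0 <= B2 := le_trans (normr_ge0 _) (h2 0).
have B3_0 : 0 <= B3 := le_trans (normr_ge0 _) (h3 0).
pose c := (bump (0 : R))^-1.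
have c0 : 0 < c by rewrite invr_gt0 bump0_gt0.
pose w1 (y : R) := - (2 * y) * lorentz y ^+ 2; pose w2 (y : R) := (6 * y ^+ 2 - 2) * lorentz y ^+ 3.
pose t n (y : R) := harm n * y + 0.
pose cut1 n y := (b1 (t n y) * harm n) * (c * lorentz y) + bump (t n y) * (c * w1 y).
pose cut2 n y := (b2 (t n y) * harm n * harm n) * (c * lorentz y) + (b1 (t n y) * harm n) * (c * w1 y) +
   ((b1 (t n y) * harm n) * (c * w1 y) + bump (t n y) * (c * w2 y)).
have dt n (y : R) : is_derive y 1 (t n) (harm n).
  apply: (is_derive_eq (derD (derM (der_cst (harm n) y) (der_id y)) (der_cst 0 y))).
  by rewrite mul0r add0r mulr1 addr0.
have db f f1 n (y : R) : Der f f1 -> is_derive y 1 (fun y => f (t n y)) (f1 (t n y) * harm n).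
  by move=> df; exact: (@der_comp _ f (t n) y _ _ (df _) (dt n y)).
have dc f f1 (y : R) : Der f f1 -> is_derive y 1 (fun y => c * f y) (c * f1 y).
  move=> df; apply: (is_derive_eq (derM (der_cst c y) (df y))).
  by rewrite mul0r add0r.
pose M := c * (B2 + 2 * B1 + 6 + B3).
have bb (x : R) : `|bump x| <= 1 by rewrite ger0_norm ?bump_ge0 ?bump_le1.
have dd n : `|harm n| <= 1 by rewrite gtr0_norm ?harmonic_gt0 ?harmonic_le1.
have le1 (a b x B : R) : `|a| <= B -> `|b| <= x -> `|a * (c * b)| <= c * B * x.
  move=> ha hb; rewrite !normrM (gtr0_norm c0) (_ : c * B * x = B * (c * x)); last by ring.
  by apply: ler_pM => //; [rewrite mulr_ge0 // ltW|rewrite ler_wpM2l // ltW].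
have nw (y : R) : `|lorentz y| <= lorentz y by rewrite ger0_norm // ltW // lorentz_gt0.
have cw (y : R) : 0 <= c * lorentz y by rewrite mulr_ge0 // ltW // lorentz_gt0.
have bd1 n x : `|b1 x * harm n| <= B1.
  by rewrite normrM (le_trans (ler_piMr _ (dd n))).
have bd2 n x : `|b2 x * harm n * harm n| <= B2.
  by rewrite normrM (le_trans (ler_piMr _ (dd n))) // normrM (le_trans (ler_piMr _ (dd n))).
have ME a x : c * a * lorentz x <= M * lorentz x <->
    0 <= (B2 + 2 * B1 + 6 + B3 - a) * (c * lorentz x).
  have -> : (B2 + 2 * B1 + 6 + B3 - a) * (c * lorentz x) =
      M * lorentz x - c * a * lorentz x by rewrite /M; ring.
  by rewrite subr_ge0.
have Ec n x : cut_lorentz n x + x * cut1 n x =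
    bump (t n x) * (c * dxlorentz x) + b1 (t n x) * t n x * (c * lorentz x).
  have -> : dxlorentz x = lorentz x + x * w1 x.
    by rewrite /dxlorentz /w1 /lorentz; field; exact: sqr1_neq0.
  by rewrite /cut_lorentz /cut1 -/c -/(t n x) {6}/t; ring.
exists cut1, cut2, M; split; last split.
- by move=> n y; exact: (derM (db _ _ n y d1) (dc _ _ y (@der_lorentz R))).
- move=> n y; apply: derD.
    apply: derM; last exact: dc (@der_lorentz R).
    apply: (is_derive_eq (derM (db _ _ n y d2) (der_cst (harm n) y))).
    by rewrite mulr0 addr0.
  by apply: derM; [exact: db|exact: dc (@der2_lorentz R)].
- move=> n x; apply: (le_trans (le1 _ _ _ _ (bb _) (nw x))).
  by apply/ME; rewrite mulr_ge0 //; lra.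
- move=> n x; rewrite /cut2.
  have q1 := le1 _ _ _ _ (bd2 n (t n x)) (nw x).
  have q2 := le1 _ _ _ _ (bd1 n (t n x)) (lorentz1_bd x).
  have q3 : `|bump (t n x) * (c * w2 x)| <= c * 1 * (6 * lorentz x) by apply: le1 => //;
      exact: lorentz2_bd.
  apply: (le_trans (ler_normD _ _)).
  apply: (le_trans (lerD (ler_normD _ _) (ler_normD _ _))).
  have := cw x; move: q1 q2 q3 => q1 q2 q3 cwx.
  have B3w : 0 <= B3 * (c * lorentz x) by rewrite mulr_ge0.
  rewrite -/(w1 x) /M in q2 *; lra.
- move=> n x; rewrite Ec.
  have q1 : `|bump (t n x) * (c * dxlorentz x)| <= c * 1 * lorentz x by apply: le1 => //;
      exact: dxlorentz_le.
  have q2 := le1 _ _ _ _ (h3 (t n x)) (nw x).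
  apply: (le_trans (ler_normD _ _)); have cwx := cw x.
  have B1w : 0 <= B1 * (c * lorentz x) by rewrite mulr_ge0.
  have B2w : 0 <= B2 * (c * lorentz x) by rewrite mulr_ge0.
  rewrite /M; lra.
- move=> x; under eq_fun do rewrite Ec.
  have tn : t n x @[n --> \oo] --> (0 : R).
    rewrite -[X in _ --> X](addr0 0); apply: cvgD; last exact: cvg_cst.
    by rewrite -[X in _ --> X](mul0r x); apply: cvgM; [exact: cvg_harmonic|exact: cvg_cst].
  have -> : nbhs (dxlorentz x) = nbhs (bump 0 * (c * dxlorentz x) + b1 0 * 0 * (c * lorentz x)).
    by rewrite mulrA divff ?mul1r ?mulr0 ?mul0r ?addr0 // gt_eqF // bump0_gt0.
  apply: cvgD.
    apply: cvgM; last exact: cvg_cst.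
    by apply: continuous_cvg => //; exact: ((@testfun_bump R).1 0%N).
  apply: cvgM; last exact: cvg_cst.
  by apply: cvgM => //; apply: continuous_cvg => //; exact: (t1.1 0%N).
Qed.

Lemma cvg_cut_lorentz (x : R) : cut_lorentz n x @[n --> \oo] --> lorentz x.
Proof.
have bn : bump (0 : R) != 0 by rewrite gt_eqF // bump0_gt0.
have -> : nbhs (lorentz x) = nbhs (bump 0 * ((bump (0 : R))^-1 * lorentz x)).
  by rewrite mulrA divff ?mul1r.
apply: cvgM; last exact: cvg_cst.
apply: continuous_cvg; first exact: ((@testfun_bump R).1 0%N).
rewrite -[X in _ --> X](addr0 0); apply: cvgD; last exact: cvg_cst.
by rewrite -[X in _ --> X](mul0r x); apply: cvgM; [exact: cvg_harmonic|exact: cvg_cst].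
Qed.

(** The weight [lorentz] is admissible as a limit of truncations.  Both terms
    of the equation then carry the same weight, since [dxlorentz] is the
    derivative of [x * lorentz x] as well as the half-Laplacian of [lorentz]. *)
Lemma poisson_identity (d : R) : 0 < d ->
  d * Int (fun y => H (d * y) * dxlorentz y) + Int (fun y => U (d * y) * dxlorentz y) = 0.
Proof.
move=> d0; have [MH hH] := Hbd; have [MU hU] := Ubd.
have [cut1 [cut2 [M [c1 c2 m0 m2 [mk ck]]]]] := cut_lorentz_C2.
have mHd : mfun (fun y => H (d * y)).
  by apply: mfun_comp; [exact: mfunH|apply: mfunM; [exact: mfun_cst|exact: measurable_id]].
have mUd : mfun (fun y => U (d * y)).
  by apply: mfun_comp; [exact: mfunU|apply: mfunM; [exact: mfun_cst|exact: measurable_id]].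
have Acv y : halfLap (cut_lorentz n) y @[n --> \oo] --> halfLap lorentz y.
  apply: cvgM; first exact: cvg_cst.
  have [_ C] : integ (sdq lorentz y) /\
      Int (sdq (cut_lorentz n) y) @[n --> \oo] --> Int (sdq lorentz y).
    apply: (@Int_dominated_cvg _ _ _ (fun z => 12 * M * lorentz y * lorentz_sum y z)).
    - by move=> n; exact: integ_mfun (testfun_integ_sdq y (testfun_cut_lorentz n)).
    - move=> z; apply: cvgM; last exact: cvg_cst.
      apply: cvgB; last exact: cvg_cut_lorentz.
      apply: cvgB; last exact: cvg_cut_lorentz.
      by apply: cvgM; [exact: cvg_cst|exact: cvg_cut_lorentz].
    - by apply: integZ; exact: (lorentz_sum_int y).1.
    - by move=> n z; exact: sdq_bd (c1 n) (c2 n) (m0 n) (m2 n) y z.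
  exact: C.
have [_ LU] : integ (fun y => U (d * y) * halfLap lorentz y) /\
    Int (fun y => U (d * y) * halfLap (cut_lorentz n) y) @[n --> \oo] -->
        Int (fun y => U (d * y) * halfLap lorentz y).
  apply: (@Int_dominated_cvg _ _ _ (fun y => MU * (18 * M * lorentz y))).
  - by move=> n; apply: mfunM => //;
        exact: integ_mfun (testfun_integ_halfLap (testfun_cut_lorentz n)).
  - by move=> y; apply: cvgM; [exact: cvg_cst|exact: Acv].
  - by do 2 apply: integZ; exact: integ_lorentz.
  - by move=> n y; rewrite normrM; apply: ler_pM => //;
        exact: halfLap_bd (c1 n) (c2 n) (m0 n) (m2 n) y.
have [_ LH] : integ (fun y => H (d * y) * dxlorentz y) /\
    Int (fun y => H (d * y) * (cut_lorentz n y + y * cut1 n y)) @[n --> \oo] -->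
        Int (fun y => H (d * y) * dxlorentz y).
  apply: (@Int_dominated_cvg _ _ _ (fun y => MH * (M * lorentz y))).
  - move=> n; apply: mfunM => //; have h := integ_mfun (testfun_D1 0 1 (testfun_cut_lorentz n) (c1 n)).
    rewrite (_ : (fun y => cut_lorentz n y + _) =
        (fun y => 1 * cut_lorentz n y + (0 + 1 * y) * cut1 n y)) //.
    by apply/funext => y; rewrite add0r !mul1r.
  - by move=> y; apply: cvgM; [exact: cvg_cst|exact: ck].
  - by do 2 apply: integZ; exact: integ_lorentz.
  - by move=> n y; rewrite normrM; apply: ler_pM => //; exact: mk.
have e n : Int (fun y => U (d * y) * halfLap (cut_lorentz n) y) =
    - (d * Int (fun y => H (d * y) * (cut_lorentz n y + y * cut1 n y))).
  have := profile_scaled 0 d0 (testfun_cut_lorentz n) (c1 n).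
  have -> : Int (fun y => H (0 + d * y) * (d * cut_lorentz n y + (0 + d * y) * cut1 n y)) =
      d * Int (fun y => H (d * y) * (cut_lorentz n y + y * cut1 n y)).
    rewrite -IntZ; first by apply: eq_Int => y; rewrite add0r; ring.
    apply: (@integ_bdM _ MH) => //.
    by apply: eq_integ (testfun_D1 0 1 (testfun_cut_lorentz n) (c1 n)) => y; rewrite add0r !mul1r.
  rewrite addrC => /eqP; rewrite addr_eq0 => /eqP <-.
  by apply: eq_Int => y; rewrite add0r.
have LU' : Int (fun y => U (d * y) * halfLap (cut_lorentz n) y) @[n --> \oo] -->
    - (d * Int (fun y => H (d * y) * dxlorentz y)).
  under eq_fun do rewrite e; apply: cvgN; apply: cvgM => //; exact: cvg_cst.
have EA : Int (fun y => U (d * y) * halfLap lorentz y) = Int (fun y => U (d * y) * dxlorentz y).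
  by apply: eq_Int => y; rewrite halfLap_lorentz.
rewrite EA in LU; rewrite (cvg_unique _ LU LU') //.
by rewrite subrr.
Qed.

(** Splitting [H] into [U] and [E] in [poisson_identity] leaves a multiple of
    [int E k], with [k] the weight [dxlorentz].  On the negative axis [k] has integral
    zero and changes sign once, from negative to positive, while [E] is
    nonincreasing; on the positive axis [E] vanishes. *)
Lemma Int_U_dxlorentz_ge0 (d : R) : xi <= 0 -> 0 < d -> 0 <= Int (fun y => U (d * y) * dxlorentz y).
Proof.
move=> xi0 d0; have [MH hH] := Hbd; have [MU hU] := Ubd.
have ml : mfun (fun y : R => d * y) by apply: mfunM; [exact: mfun_cst|exact: measurable_id].
have iU : integ (fun y => U (d * y) * dxlorentz y).
  by apply: (@integ_bdM _ MU) => //; [exact: mfun_comp mfunU ml|exact: integ_dxlorentz].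
have iE : integ (fun y => E (d * y) * dxlorentz y).
  apply: (@integ_bdM _ L); [|by move=> y; have := E_bd (d * y); move=> /andP[h1 h2]; rewrite ger0_norm|exact: integ_dxlorentz].
  by apply: mfun_comp ml; exact: nonincreasing_measurable E_mono.
have EE : Int (fun y => H (d * y) * dxlorentz y) =
    Int (fun y => U (d * y) * dxlorentz y) + Int (fun y => E (d * y) * dxlorentz y).
  by rewrite -IntD //; apply: eq_Int => y; rewrite /E; ring.
have iK : integ (fun x : R => (x <= 0)%R%:R * dxlorentz x).
  apply: (@integ_bdM _ 1) => //; [exact: mfun_ge| |exact: integ_dxlorentz].
  by move=> x; rewrite ger0_norm ?ler0n // lern1 leq_b1.
have E0 : Int (fun y => E (d * y) * dxlorentz y) <= 0.
  (* [dxlorentz] changes sign at [-1], which is [- d] before scaling *)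
  rewrite -(mulr0 (E (- d))) -(@Int_dxlorentz_le0 R) -IntZ //.
  apply: le_Int => //; first exact: integZ.
  have kp y : -1 <= y <= 1 -> 0 <= dxlorentz y.
    by move=> h; rewrite /dxlorentz divr_ge0 ?sqr_ge0 // subr_ge0; nra.
  have km y : y <= -1 -> dxlorentz y <= 0.
    move=> h; rewrite /dxlorentz mulr_le0_ge0 ?invr_ge0 ?sqr_ge0 //.
    by rewrite subr_le0; nra.
  move=> y; case: (leP y 0) => y0; last first.
    rewrite E_neg ?mul0r ?mulr0 //; apply/ltW/ice.2.
    by rewrite (le_lt_trans xi0) // mulr_gt0.
  rewrite mul1r; have [y1|y1] := leP y (-1).
    by apply: ler_wnM2r; [exact: km|apply: E_mono; nra].
  apply: ler_wpM2r; first by apply: kp; apply/andP; split; lra.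
  by apply: E_mono; nra.
have := poisson_identity d0; rewrite EE.
set a := Int _; set b := Int _ => P.
have : (1 + d) * a = - (d * b) by rewrite mulrDl mul1r; lra.
rewrite -/b in E0; nra.
Qed.

Definition poisson_ker (t x : R) : R := t / (t ^+ 2 + x ^+ 2).

Lemma inv_le (t x a : R) : 0 < a -> a <= t -> (t ^+ 2 + x ^+ 2)^-1 <= (1 + a ^- 2) * lorentz x.
Proof.
move=> a0 at'.
have t0 : 0 < t := lt_le_trans a0 at'.
have p0 : 0 < t ^+ 2 + x ^+ 2 by rewrite ltr_wpDr ?sqr_ge0 // exprn_gt0.
have q0 : 0 < a ^+ 2 by rewrite exprn_gt0.
rewrite /lorentz ler_pdivlMr ?sqr1_gt0 // mulrC ler_pdivrMr //.
have at2 : a ^+ 2 <= t ^+ 2 by rewrite lerXn2r // nnegrE ltW.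
have : 1 <= a ^- 2 * t ^+ 2 by rewrite mulrC ler_pdivlMr // mul1r.
have : 0 <= a ^- 2 * x ^+ 2 by rewrite mulr_ge0 ?sqr_ge0 // invr_ge0 ltW.
have := sqr_ge0 t; lra.
Qed.

Lemma dpoisson_bd (t x a : R) : 0 < a -> a <= t -> `|dpoisson t x| <= (1 + a ^- 2) * lorentz x.
Proof.
move=> a0 at'; apply: le_trans (inv_le x a0 at').
have t0 : 0 < t := lt_le_trans a0 at'.
have p0 : 0 < t ^+ 2 + x ^+ 2 by rewrite ltr_wpDr ?sqr_ge0 // exprn_gt0.
rewrite /dpoisson normrM normfV (ger0_norm (sqr_ge0 (_ + _))).
rewrite ler_pdivrMr ?exprn_gt0 // expr2 mulKf ?gt_eqF //.
by rewrite ler_norml; have := sqr_ge0 x; have := sqr_ge0 t; lra.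
Qed.

Lemma poisson_ker_bd (t x : R) : 0 < t -> `|poisson_ker t x| <= t * ((1 + t ^- 2) * lorentz x).
Proof.
move=> t0; have p0 : 0 < t ^+ 2 + x ^+ 2 by rewrite ltr_wpDr ?sqr_ge0 // exprn_gt0.
have q0 : 0 <= t / (t ^+ 2 + x ^+ 2) by rewrite divr_ge0 // ltW.
by rewrite /poisson_ker ger0_norm // ler_pM2l //; exact: inv_le.
Qed.

Let msq : mfun (fun x : R => x ^+ 2).
Proof. exact: cont_mfun (@exprn_continuous _ 2). Qed.

Lemma poisson_ker_mfun t : mfun (poisson_ker t).
Proof.
apply: mfunM; first exact: mfun_cst.
apply: (@mfun_comp _ (fun z => z^-1)); first exact: mfun_inv.
by apply: mfunD; [exact: mfun_cst|exact: msq].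
Qed.

Lemma dpoisson_mfun2 : mfun2 (fun x t : R => dpoisson t x).
Proof.
have mx := @mfun2_l R _ msq; have my := @mfun2_r R _ msq.
apply: mfun2M; first exact: mfun2B.
apply: (@mfun2_comp _ (fun z => z^-1)); first exact: mfun_inv.
by apply: (@mfun2_comp _ (fun z => z ^+ 2)); [exact: msq|exact: mfun2D].
Qed.

Lemma integ_U_poisson_ker t : 0 < t -> integ (fun x => U x * poisson_ker t x).
Proof.
move=> t0; have [MU hU] := Ubd; apply: (@integ_bdM _ MU) => //; first exact: mfunU.
apply: (@le_integ _ _ (fun x => t * ((1 + t ^- 2) * lorentz x))); first exact: poisson_ker_mfun.
  by do 2 apply: integZ; exact: integ_lorentz.
by move=> x; exact: poisson_ker_bd.
Qed.

Lemma integ_U_dpoisson t : 0 < t -> integ (fun x => U x * dpoisson t x).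
Proof.
move=> t0; have [MU hU] := Ubd; apply: (@integ_bdM _ MU) => //; first exact: mfunU.
exact: (dpoisson_int t0).1.
Qed.

Lemma ext_U (t : R) : 0 < t -> Int (fun y => U (t * y) * lorentz y) =
    Int (fun x => U x * poisson_ker t x).
Proof.
move=> t0; have tn : t != 0 by rewrite gt_eqF.
have [i I] := Int_affine 0 t0 (integ_U_poisson_ker t0).
apply: (mulfI (invr_neq0 tn)); rewrite -I -IntZ.
  apply: eq_Int => y; rewrite add0r /poisson_ker /lorentz; field.
  rewrite sqr1_neq0 tn /= gt_eqF //.
  by rewrite ltr_wpDr ?sqr_ge0 // exprn_gt0.
have [MU hU] := Ubd; apply: (@integ_bdM _ MU) => //; last exact: integ_lorentz.
by apply: mfun_comp; [exact: mfunU|apply: mfunM; [exact: mfun_cst|exact: measurable_id]].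
Qed.

Lemma ext_U_dpoisson (t : R) : 0 < t ->
    Int (fun y => U (t * y) * dxlorentz y) = t * Int (fun x => U x * dpoisson t x).
Proof.
move=> t0; have tn : t != 0 by rewrite gt_eqF.
have [i I] := Int_affine 0 t0 (integ_U_dpoisson t0).
apply: (mulfI (invr_neq0 tn)); rewrite mulKf //; apply: (mulfI (invr_neq0 tn)).
rewrite -I -IntZ; last first.
  have [MU hU] := Ubd; apply: (@integ_bdM _ MU) => //; last exact: integ_dxlorentz.
  by apply: mfun_comp; [exact: mfunU|apply: mfunM; [exact: mfun_cst|exact: measurable_id]].
rewrite -IntZ.
  apply: eq_Int => y; rewrite add0r /dpoisson /dxlorentz; field.
  rewrite sqr1_neq0 tn /= gt_eqF //.
  by rewrite ltr_wpDr ?sqr_ge0 // exprn_gt0.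
apply: integZ; have [MU hU] := Ubd; apply: (@integ_bdM _ MU) => //; last exact: integ_dxlorentz.
by apply: mfun_comp; [exact: mfunU|apply: mfunM; [exact: mfun_cst|exact: measurable_id]].
Qed.

(** The difference of two Poisson kernels is an integral of [dpoisson] over the
    heights between them, and at each height the pairing of [U] with
    [dpoisson] is nonnegative by [Int_U_dxlorentz_ge0]. *)
Lemma extension_noninc (a b : R) : xi <= 0 -> 0 < a -> a < b ->
  Int (fun y => U (b * y) * lorentz y) <= Int (fun y => U (a * y) * lorentz y).
Proof.
move=> xi0 a0 ab; have b0 := lt_trans a0 ab.
have [MU hU] := Ubd.
rewrite !ext_U // -subr_ge0 -IntB; [|exact: integ_U_poisson_ker|exact: integ_U_poisson_ker].
pose F x t := U x * ((a <= t <= b)%R%:R * dpoisson t x).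
have ind01 (t : R) : 0 <= (a <= t <= b)%R%:R :> R by rewrite ler0n.
have iind : integ (fun t => (a <= t <= b)%R%:R).
  apply: (@le_integ _ _ (fun t => (1 + b ^+ 2) * lorentz t)); first exact: mfun_itv.
    exact/integZ/integ_lorentz.
  move=> t; rewrite ger0_norm //; have w0 := lorentz_gt0 t; case: (boolP (a <= t <= b)) => [/andP[h1 h2]|_]; last first.
    by rewrite mulr_ge0 ?(ltW w0) // addr_ge0 ?sqr_ge0.
  by rewrite /lorentz ler_pdivlMr ?sqr1_gt0 // mul1r lerD2l lerXn2r // nnegrE; lra.
have mF : mfun2 F.
  apply: mfun2M; first exact: mfun2_l mfunU.
  by apply: mfun2M; [exact: mfun2_r (mfun_itv a b)|exact: dpoisson_mfun2].
have bF x t : `|F x t| <= (MU * ((1 + a ^- 2) * lorentz x)) * (a <= t <= b)%R%:R.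
  rewrite /F; case: (boolP (a <= t <= b)) => [/andP[h1 h2]|_]; last by rewrite mul0r !mulr0 normr0.
  by rewrite mulr1 mul1r normrM; apply: ler_pM => //; exact: dpoisson_bd.
have iw : integ (fun x => MU * ((1 + a ^- 2) * lorentz x)) by do 2 apply: integZ;
    exact: integ_lorentz.
have [iF fub] := Int_fubini mF iw iind bF.
have inner x : x != 0 -> Int (F x) = U x * poisson_ker a x - U x * poisson_ker b x.
  move=> x0; have pos (t : R) : t ^+ 2 + x ^+ 2 != 0.
    have x2 : 0 < x ^+ 2 by rewrite lt_def sqr_ge0 expf_neq0.
    by apply: lt0r_neq0; exact: ltr_wpDl (sqr_ge0 t) x2.
  have dN : Der (fun t => - poisson_ker t x) (fun t => dpoisson t x).
    move=> t.
    have ds : is_derive t 1 (fun t : R => t ^+ 2 + x ^+ 2) (2 * t).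
      apply: (is_derive_eq (derD (derM (der_id t) (der_id t)) (der_cst (x ^+ 2) t))).
      by ring.
    apply: (is_derive_eq (derN (derM (der_id t) (derV (pos t : (fun t : R => t ^+ 2 + x ^+ 2) t != 0) ds)))).
    by rewrite /dpoisson; field; exact: pos.
  have ck : continuous (fun t => dpoisson t x).
    move=> t; apply: cvgM.
      by apply: cvgB; [exact: exprn_continuous|exact: cvg_cst].
    apply: cvgV; first by rewrite expf_neq0.
    by rewrite expr2; under eq_fun do rewrite expr2; apply: cvgM; (apply: cvgD;
        [exact: exprn_continuous|exact: cvg_cst]).
  have := FTC_itv ck dN ab.
  rewrite /F IntZ => [->|]; first by ring.
  apply: (@le_integ _ _ (fun t => (1 + a ^- 2) * lorentz x * (a <= t <= b)%R%:R)).
  - by apply: mfunM; [exact: mfun_itv|exact: mfun2_sec1 dpoisson_mfun2].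
  - exact: integZ.
  - move=> t; case: (boolP (a <= t <= b)) => [/andP[h1 h2]|_]; last by rewrite mul0r mulr0 normr0.
    by rewrite mulr1 mul1r; exact: dpoisson_bd.
have [_ ->] := Int_eq_off iF inner.
rewrite fub; apply: Int_ge0 => t.
rewrite /F; case: (boolP (a <= t <= b)) => [/andP[h1 h2]|_]; last first.
  have -> : Int (fun x => U x * (false%:R * dpoisson t x)) = Int (fun=> 0).
    by apply: eq_Int => x; rewrite mul0r mulr0.
  by rewrite Int0.
have t0 : 0 < t := lt_le_trans a0 h1.
have e : Int (fun x => U x * (true%:R * dpoisson t x)) = Int (fun x => U x * dpoisson t x).
  by apply: eq_Int => x; rewrite mul1r.
have h : 0 <= t * Int (fun x => U x * dpoisson t x).
  by rewrite -(ext_U_dpoisson t0); exact: Int_U_dxlorentz_ge0.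
by rewrite e; move: h; rewrite pmulr_rge0.
Qed.

Variables (P1 P2 : R).
Hypothesis P12 : P2 < P1.
Hypothesis HNy : H x @[x --> -oo] --> L + P1.
Hypothesis Hy : H x @[x --> +oo] --> - P2.

(** Small heights see the trace of the temperature at the origin, which is not
    positive on the closure of the ice; large heights see the mean of the two
    values at infinity, which is positive.  A nonincreasing extension cannot
    join them. *)
Lemma xi_gt0 : 0 < xi.
Proof.
rewrite ltNge; apply/negP => xi0.
have [MU hU] := Ubd.
have UNy : U x @[x --> -oo] --> P1.
  have h : H x - L @[x --> -oo] --> P1.
    by rewrite [X in _ --> X](_ : P1 = L + P1 - L); [apply: cvgB => //; exact: cvg_cst|ring].
  apply: cvg_trans h; apply: near_eq_cvg; near=> x; rewrite U_pos //; apply/ltW/water.2.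
  by near: x; apply: nbhs_ninfty_lt; rewrite num_real.
have Uy : U x @[x --> +oo] --> - P2.
  apply: cvg_trans Hy; apply: near_eq_cvg; near=> x; rewrite (U_ice _).1 //.
  by near: x; apply: nbhs_pinfty_gt; rewrite num_real.
pose G t := Int (fun y => U (t * y) * lorentz y).
have mU (t : R) : mfun (fun y => U (t * y) * lorentz y).
  apply: mfunM; last exact: lorentz_mfun.
  by apply: mfun_comp; [exact: mfunU|apply: mfunM; [exact: mfun_cst|exact: measurable_id]].
have iMw : integ (fun y => MU * lorentz y) by apply: integZ; exact: integ_lorentz.
have bMw (t y : R) : `|U (t * y) * lorentz y| <= MU * lorentz y.
  rewrite normrM (gtr0_norm (lorentz_gt0 y)); apply: ler_wpM2r => //; exact/ltW/lorentz_gt0.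
have [_ L1] : integ (fun y => U 0 * lorentz y) /\
    G (harm n) @[n --> \oo] --> Int (fun y => U 0 * lorentz y).
  apply: (@Int_dominated_cvg _ _ _ (fun y => MU * lorentz y)) => // y.
  apply: cvgM; last exact: cvg_cst.
  apply: continuous_cvg; first exact: Ucont.
  by rewrite -[X in _ --> X](mul0r y); apply: cvgM; [exact: cvg_harmonic|exact: cvg_cst].
(* the limit at infinite height; at [y = 0] the value stays equal to [U 0] *)
pose q y := (if y < 0 then P1 else if y == 0 then U 0 else - P2) * lorentz y.
have [iq L2] : integ q /\ G n.+1%:R @[n --> \oo] --> Int q.
  apply: (@Int_dominated_cvg _ _ _ (fun y => MU * lorentz y)) => // y.
  apply: cvgM; last exact: cvg_cst.
  have [y0|y0|->] := ltgtP y 0.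
  - have h : (n.+1%:R * y : R) @[n --> \oo] --> -oo.
      apply/cvgrNyPle => a; apply: filterS (near_natr_ge (a / y)) => n.
      by rewrite ler_ndivrMr.
    exact: (cvg_comp _ _ h UNy).
  - have h : (n.+1%:R * y : R) @[n --> \oo] --> +oo.
      apply/cvgryPge => a; apply: filterS (near_natr_ge (a / y)) => n.
      by rewrite ler_pdivrMr.
    exact: (cvg_comp _ _ h Uy).
  - by apply: cvg_near_cst; apply: nearW => n; rewrite mulr0.
have iwn : integ (fun y : R => (y <= 0)%R%:R * lorentz y).
  apply: (@integ_bdM _ 1) => //; [exact: mfun_ge| |exact: integ_lorentz].
  by move=> x; rewrite ger0_norm ?ler0n // lern1 leq_b1.
have datan : Der (@atan R) lorentz by move=> x; exact: is_derive1_atan.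
have Iwn := FTC_left (@lorentz_cont R) datan iwn (@cvg_atan_ninfty R).
have [_ Iq] : integ (fun y => (P1 + P2) * ((y <= 0)%R%:R * lorentz y) - P2 * lorentz y) /\
    Int (fun y => (P1 + P2) * ((y <= 0)%R%:R * lorentz y) - P2 * lorentz y) = Int q.
  apply: (Int_eq_off (c := 0) iq) => y y0; rewrite /q (negbTE y0) le_eqVlt (negbTE y0) /=.
  by case: ifP => _; rewrite ?mul1r ?mul0r ?mulr0; ring.
rewrite IntB in Iq; [|exact: integZ|by apply: integZ; exact: integ_lorentz].
rewrite IntZ // IntZ in Iq; last exact: integ_lorentz.
rewrite Iwn Int_lorentz atan0 in Iq.
rewrite IntZ in L1; last exact: integ_lorentz.
rewrite Int_lorentz in L1.
have U00 : U 0 <= 0.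
  have c : U (0 + harm n * 1) @[n --> \oo] --> U 0.
    by apply: continuous_cvg; [exact: Ucont|exact: cvg_harmonic_affine].
  apply: (@closed_cvg _ _ \oo eventually_filter _ [set y : R | y <= 0] _ _ _ c); first exact: closed_le.
  apply: nearW => n /=; apply/ltW/(U_ice _).2.
  by rewrite add0r mulr1 (le_lt_trans xi0) // harmonic_gt0.
have GG n : G n.+1%:R <= G (harm n).
  have d1 : harm n <= n.+1%:R :> R by rewrite (le_trans (harmonic_le1 n)) // ler1n.
  move: d1; rewrite le_eqVlt => /orP[/eqP ->|d1]; first exact: lexx.
  by apply: extension_noninc => //; exact: harmonic_gt0.
have le_lim : Int q <= U 0 * pi by apply: (ler_cvg_to L2 L1); exact: nearW.
rewrite -Iq in le_lim.
have p0 := pi_gt0 R.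
have h1 : U 0 * pi <= 0 by rewrite mulr_le0_ge0 // ltW.
have h2 : 0 < (P1 - P2) * pi by rewrite mulr_gt0 // subr_gt0.
by move: le_lim h1 h2; lra.
Unshelve. all: by end_near. Qed.

Lemma interphases_pos : 0 < xw /\ xw < xi.
Proof.
have xi0 := xi_gt0.
have xw0 : 0 < xw.
  by rewrite ltNge; apply/negP => h; exact: mushy_off_origin h xi0.
split => //; rewrite lt_neqAle xw_le_xi andbT; apply/eqP => e.
by move: xw0; rewrite (no_jump e) ltxx.
Qed.

End profile.

Theorem theorem5p10 (R : realType) (T L P1 P2 : R) (h : R * R -> R)
    (H : R -> R) (xi_w xi_i : R)
    (hT : 0 < T) (hL : 0 < L) (hP2 : 0 < P2) (hP12 : P2 < P1)
    (h_sol : very_weak_solution (2^-1) T (Phi2 L) (step_datum L P1 P2) h)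
    (h_prof : enthalpy_profile (2^-1) T L P1 P2 h H)
    (h_w : water_interphase L H xi_w)
    (h_i : ice_interphase H xi_i) :
  0 < xi_w /\ xi_w < xi_i.
Proof.
case: h_prof => _ [Hbd Hmono HNy Hy] PE Ucont Ubd.
exact: (interphases_pos hL Hmono h_w h_i Hbd Ubd Ucont PE hP12 HNy Hy).
Qed.
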